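(* Let $r\ge 2$ and let $\lambda=(a_1,\dots,a_r)$ be integers with $a_1>a_2>\cdots>a_{r-1}>a_r=0$. Put $d(\lambda)=\gcd(a_1,\dots,a_r)$ and $\rho=(r-1,r-2,\dots,1,0)$. For a tuple $\mu=(b_1,\dots,b_r)$ of non-negative integers let $S(\mu)=\det\big(x_i^{b_j}\big)_{1\le i,j\le r}\in\mathbb{C}[x_1,\dots,x_r]$, and for a positive integer $d$ write $d\rho=(d(r-1),d(r-2),\dots,d,0)$. If $\lambda\neq d(\lambda)\rho$, then the polynomial $C(\lambda)=S(\lambda)/S(d(\lambda)\rho)$ (which is a symmetric polynomial) is irreducible in the ring $\mathbb{C}[x_1,\dots,x_r]$.
   Context: $S(d\rho)=\prod_{i<j}(x_i^d-x_j^d)$ divides $S(\lambda)$ when $d\mid d(\lambda)$, so $C(\lambda)$ is a polynomial. Irreducible means: not a unit and not a product of two non-units. *)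

(* Defs.v *)
From mathcomp Require Import all_boot all_algebra.
From mathcomp Require Import mpoly.
From mathcomp Require Import complex.
From mathcomp Require Import Rstruct.
Set Implicit Arguments. Unset Strict Implicit. Unset Printing Implicit Defensive.
Import GRing.Theory.
Local Open Scope ring_scope.

Definition CC : closedFieldType := complex Rdefinitions.R.

Definition Sdet (r : nat) (mu : 'I_r -> nat) : {mpoly CC[r]} :=
  \det (\matrix_(i < r, j < r) ('X_i ^+ mu j : {mpoly CC[r]})).

Definition dlam (r : nat) (lam : 'I_r -> nat) : nat := \big[gcdn/0%N]_(i < r) lam i.

Definition drho (r : nat) (d : nat) : 'I_r -> nat := fun j => (d * (r.-1 - j))%N.

Definition irreducible_elt (R : comUnitRingType) (p : R) : Prop :=
  p \isn't a GRing.unit /\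
  ~ (exists a b : R, [/\ a \isn't a GRing.unit, b \isn't a GRing.unit & p = a * b]).

(* Main.v *)
(** Write n_j = a_j - a_(j+1).  Setting x_i = 0 in S(lambda) gives, up to a
    monomial, the alternant with differences (n_1, ..., n_(r-2)) in the other
    variables; the leading coefficient in x_i is the one with differences
    (n_2, ..., n_(r-1)).  So, by induction on r, in a factorization C = G H each of
    these facets of G or of H is a product of variables and of linear forms
    x_p - w x_q, where w is a root of unity.

    Suppose that r >= 4.  If one of the factors has this property for all its facets,
    it is constant, since a variable or a linear form occurring in one facet would
    have to show up in another one.  Otherwise a comparison of degrees shows that,
    up to reversal, (n_j) = (qe, e, ..., e, b) with gcd(e, b) = d.  The facets exclude
    q = 1 and e = b = d directly.  The other cases are excluded by substituting
    x_p = w x_q with w^e = 1 <> w^b, which turns S(lambda) into a multiple of its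
    facet x_p = 0, or, if e = d, by an Eisenstein argument in the variable x_i.
    Reversal of (n_j) is the substitution x_i |-> 1/x_i.

    For r = 3 there remain two cases, up to reversal.  If both differences exceed
    d, an Eisenstein argument applies again.  For (qd, d) the quotient is a complete
    homogeneous polynomial in x^d, y^d, z^d; by a resultant, two factors would have
    a common zero off the x-axis, and there the quotient would be singular. *)
Require Import Defs.
From HB Require Import structures.
From mathcomp Require Import all_boot all_order all_fingroup all_algebra.
From mathcomp Require Import separable cyclotomic complex Rstruct.
From mathcomp Require Import mpoly zify ring.
From Stdlib Require Import FunctionalExtensionality.
Set Implicit Arguments. Unset Strict Implicit. Unset Printing Implicit Defensive.
Import GRing.Theory.
Local Open Scope ring_scope.

(** * Divisibility up to units *)

Section Divisibility.
Variable D : idomainType.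
Implicit Types (p q r f g h u x y : D) (P Q : D -> Prop).

(** The linear forms come from a mismatch of gcds. A facet has a gcd of its own, [e] or [e'], which
    is a multiple of d. Dividing the facet by the forms with w^d = 1 therefore leaves, besides the
    quotient that belongs to the facet, the forms with w^e = 1 and w^d <> 1. By induction that
    quotient is irreducible or a unit and goes as a whole into one of the two factors; the obstacle
    is that different facets may put it into different factors. Unique factorization is never
    invoked. An irreducible quotient is not known to be prime, and only variables and linear forms
    are stripped off, which are prime because they generate kernels of substitutions. All variables
    live in one fixed ring and an alternant carries the set [V] of those it involves, so a facet
    stays in the same ring and the induction runs over #|V|. Identities hold up to units, which
    absorb the signs of permutations and constants such as -w. *)

Definition dvdr p q := exists r, q = r * p.
Definition assoc p q := exists2 u, u \is a GRing.unit & p = u * q.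
Definition prime_elt p :=
  [/\ p != 0, p \isn't a GRing.unit
    & forall f g, dvdr p (f * g) -> dvdr p f \/ dvdr p g].

Lemma dvd_refl p : dvdr p p. Proof. by exists 1; rewrite mul1r. Qed.
Lemma dvd_trans q p r : dvdr p q -> dvdr q r -> dvdr p r.
Proof. by move=> [a ->] [b ->]; exists (b * a); rewrite mulrA. Qed.
Lemma dvd_mull p q r : dvdr p q -> dvdr p (r * q).
Proof. by move=> [a ->]; exists (r * a); rewrite mulrA. Qed.
Lemma dvd_mulr p q r : dvdr p q -> dvdr p (q * r).
Proof. by rewrite mulrC; apply: dvd_mull. Qed.
Lemma dvd1 p : dvdr 1 p. Proof. by exists p; rewrite mulr1. Qed.
Lemma dvd0 p : dvdr p 0. Proof. by exists 0; rewrite mul0r. Qed.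
Lemma dvd_mul p q r f : dvdr p q -> dvdr r f -> dvdr (p * r) (q * f).
Proof. by move=> [a ->] [b ->]; exists (a * b); rewrite mulrACA. Qed.
Lemma dvd_cancel r p q : r != 0 -> dvdr (r * p) (r * q) -> dvdr p q.
Proof.
by move=> r0 [a e]; exists a; apply: (mulfI r0); rewrite e mulrCA.
Qed.
Lemma dvd_neq0 p q : dvdr p q -> q != 0 -> p != 0.
Proof. by move=> [a ->]; rewrite mulf_eq0 negb_or => /andP[]. Qed.

Lemma assoc_refl p : assoc p p.
Proof. by exists 1; rewrite ?unitr1 ?mul1r. Qed.
Lemma assoc_eq p q : p = q -> assoc p q.
Proof. by move=> ->; apply: assoc_refl. Qed.
Lemma assoc_sym p q : assoc p q -> assoc q p.
Proof. by move=> [u uu ->]; exists u^-1; rewrite ?unitrV ?mulKr. Qed.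
Lemma assoc_trans q p r : assoc p q -> assoc q r -> assoc p r.
Proof.
by move=> [u uu ->] [v vu ->]; exists (u * v); rewrite ?unitrM ?uu ?vu ?mulrA.
Qed.
Lemma assoc_mul p q r f : assoc p q -> assoc r f -> assoc (p * r) (q * f).
Proof.
move=> [u uu ->] [v vu ->]; exists (u * v); rewrite ?unitrM ?uu ?vu //.
by rewrite mulrACA.
Qed.
Lemma assoc_mull p q r : assoc p q -> assoc (r * p) (r * q).
Proof. exact/assoc_mul/assoc_refl. Qed.
Lemma assoc_mulr p q r : assoc p q -> assoc (p * r) (q * r).
Proof. by move=> ?; apply/assoc_mul => //; apply: assoc_refl. Qed.
Lemma assoc_neq0 p q : assoc p q -> (p != 0) = (q != 0).
Proof.
move=> [u uu ->]; rewrite mulf_eq0; case: eqP => [u0|//].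
by rewrite u0 unitr0 in uu.
Qed.
Lemma assoc_cancel r p q : r != 0 -> assoc (r * p) (r * q) -> assoc p q.
Proof.
by move=> r0 [u uu e]; exists u => //; apply: (mulfI r0); rewrite e mulrCA.
Qed.
Lemma assoc_unitl u p : u \is a GRing.unit -> assoc (u * p) p.
Proof. by exists u. Qed.
Lemma assoc_dvd p q : assoc p q -> dvdr p q.
Proof. by move=> [u uu ->]; exists u^-1; rewrite mulKr. Qed.
Lemma assoc_sign (b : nat) p : assoc ((-1) ^+ b * p) p.
Proof. by exists ((-1) ^+ b); rewrite // unitrX ?unitrN1. Qed.
Lemma assoc_unit p q : assoc p q -> (p \is a GRing.unit) = (q \is a GRing.unit).
Proof. by move=> [u uu ->]; rewrite unitrM uu. Qed.
Lemma dvd_unit p q : dvdr p q -> q \is a GRing.unit -> p \is a GRing.unit.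
Proof. by move=> [a ->]; rewrite unitrM => /andP[]. Qed.
Lemma unit_dvd p q : p \is a GRing.unit -> dvdr p q.
Proof. by move=> pu; exists (q / p); rewrite divrK. Qed.
(** A factorization that carries the primality of its factors, so that they can be cancelled one by
    one; [P] records which primes may occur. *)
Inductive pprods P : D -> Prop :=
| pprod_unit u : u \is a GRing.unit -> pprods P u
| pprod_cons p f : prime_elt p -> P p -> pprods P f -> pprods P (p * f).

Lemma pprod1 P : pprods P 1.
Proof. exact/pprod_unit/unitr1. Qed.

Lemma pprod_prime P p : prime_elt p -> P p -> pprods P p.
Proof. by move=> pp Pp; rewrite -[p]mulr1; apply/pprod_cons/pprod1. Qed.

Lemma pprodM P f g : pprods P f -> pprods P g -> pprods P (f * g).
Proof.
elim=> [u uu|p h pp Pp _ IH] Pg; last by rewrite -mulrA; apply/pprod_cons/IH.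
elim: Pg => [v vu|p h pp Pp _ IH]; first by apply/pprod_unit; rewrite unitrM uu.
by rewrite mulrCA; apply: pprod_cons.
Qed.

Lemma pprodX P f k : pprods P f -> pprods P (f ^+ k).
Proof.
by move=> Pf; elim: k => [|k IH]; [apply: pprod1|rewrite exprS; apply: pprodM].
Qed.

Lemma pprod_prod (I : Type) (s : seq I) (B : pred I) (F : I -> D) P :
  (forall i, B i -> pprods P (F i)) -> pprods P (\prod_(i <- s | B i) F i).
Proof. by move=> h; apply: big_ind => //; [apply: pprod1|apply: pprodM]. Qed.

Lemma pprod_sub P Q f : (forall p, P p -> Q p) -> pprods P f -> pprods Q f.
Proof.
move=> PQ; elim=> [u uu|p g pp Pp _ IH]; first exact: pprod_unit.
by apply: pprod_cons => //; apply: PQ.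
Qed.

Lemma pprod_neq0 P f : pprods P f -> f != 0.
Proof.
elim=> [u uu|p g [p0 _ _] _ _ g0]; last by rewrite mulf_neq0.
by apply: contraTneq uu => ->; rewrite unitr0.
Qed.

(** If f * g = a * h, a prime p of f divides a, as it does not divide h, and can be cancelled. *)
Lemma pprod_strip P f g h :
  pprods P f -> (forall p, P p -> ~ dvdr p h) -> dvdr h (f * g) -> dvdr h g.
Proof.
move=> Pf hP; elim: Pf g => [u uu|p k [p0 pu pp] Pp _ IH] g.
  by move=> /dvd_trans; apply; apply/assoc_dvd/assoc_unitl.
rewrite -mulrA => -[a e]; have: dvdr p (a * h) by rewrite -e; apply/dvd_mulr/dvd_refl.
case/pp => [[b ab]|/hP //]; apply: IH; exists b; apply: (mulfI p0).
by rewrite e ab [b * p]mulrC mulrA.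
Qed.

(** Each prime of f divides g or h and is cancelled there, until g * h is associated to the
    irreducible p and one of the two is a unit. This is how the induction hypothesis is used: it
    yields irreducibility, not primality. *)
Lemma pprod_irr P f p g h :
  pprods P f -> irreducible_elt p -> assoc (g * h) (f * p) -> dvdr g f \/ dvdr h f.
Proof.
move=> Pf [_ irr]; elim: Pf g h => [u uu|q k [q0 qu pq] Pq _ IH] g h gh.
  have [v vu e] : assoc p (g * h).
    by apply/assoc_sym/(assoc_trans gh)/assoc_unitl.
  have [gu|gu] := boolP (g \is a GRing.unit); first by left; apply: unit_dvd.
  have [hu|hu] := boolP (h \is a GRing.unit); first by right; apply: unit_dvd.
  case: irr; exists (v * g), h; split; rewrite ?mulrA // ?e ?mulrA //.
  by rewrite unitrM vu.
have : dvdr q (g * h).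
  have [v _ ->] := gh; apply/dvd_mull; rewrite -mulrA; apply/dvd_mulr/dvd_refl.
case/pq => [[a e]|[a e]].
- have := gh; rewrite e [a * q]mulrC -!mulrA => /(assoc_cancel q0) /IH.
  case=> [ak|hk]; first by left; apply: dvd_mul; [apply: dvd_refl|].
  by right; apply: dvd_mull.
- have e2 : g * (a * q) = q * (g * a) by rewrite mulrA mulrC.
  have := gh; rewrite e e2 -[q * k * p]mulrA => /(assoc_cancel q0).
  move=> /IH [gk|ak]; first by left; apply: dvd_mull.
  by right; rewrite [q * k]mulrC; apply: dvd_mul; [|apply: dvd_refl].
Qed.

Lemma dvd_prod_primes (I : eqType) (s : seq I) (F : I -> D) x :
  uniq s -> (forall i, i \in s -> prime_elt (F i)) ->
  (forall i j, i \in s -> j \in s -> i != j -> ~ dvdr (F i) (F j)) ->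
  (forall i, i \in s -> dvdr (F i) x) -> dvdr (\prod_(i <- s) F i) x.
Proof.
elim: s x => [|i s IH] x; first by rewrite big_nil => *; apply: dvd1.
move=> /= /andP[ins us] pF nF dF; rewrite big_cons.
have [a ea] := dF i (mem_head _ _).
rewrite ea mulrC; apply: dvd_mul; last exact: dvd_refl.
apply: IH => // [j js|j k js ks|j js].
- by apply: pF; rewrite inE js orbT.
- by apply: nF; rewrite inE ?js ?ks orbT.
- have js' : j \in i :: s by rewrite inE js orbT.
  have [_ _ pj] := pF j js'.
  case: (pj a (F i)) => [|//|h]; first by rewrite -ea; apply: dF.
  case: (nF j i js' (mem_head _ _) _ h).
  by apply: contraNneq ins => <-.
Qed.

End Divisibility.

(** * Polynomials in one distinguished variable *)

Section OneVariable.
Variables (K : closedFieldType) (N : nat).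
Local Notation R := {mpoly K[N]}.
Implicit Types (p q r t u : R) (i j : 'I_N).

Lemma mpoly_hom_ext (S : comNzRingType) (f g : {rmorphism R -> S}) :
  (forall c, f c%:MP = g c%:MP) -> (forall i, f 'X_i = g 'X_i) -> f =1 g.
Proof.
move=> fgC fgX; elim/mpolyind => [|c m p _ _ IH]; first by rewrite !rmorph0.
rewrite !rmorphD IH -mul_mpolyC !rmorphM fgC mpolyXE_id !rmorph_prod.
by congr (_ * _ + _); apply: eq_bigr => i _; rewrite !rmorphXn fgX.
Qed.

(* [upoly i p] is [p] as a polynomial in x_i; its coefficients stay in the full
   ring and do not involve x_i, see [coef_free]. *)
Definition upoly i p : {poly R} :=
  mmap (polyC \o @mpolyC N K) (fun j => if j == i then 'X else ('X_j)%:P) p.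
HB.instance Definition _ i := GRing.RMorphism.copy (upoly i)
  (mmap (polyC \o @mpolyC N K) (fun j => if j == i then 'X else ('X_j)%:P)).
Definition subst i t p := (upoly i p).[t].
HB.instance Definition _ i t :=
  GRing.RMorphism.copy (subst i t) (horner_eval t \o upoly i).
Definition lc i p := lead_coef (upoly i p).
Definition dg i p := (size (upoly i p)).-1.
Definition freeof i p := upoly i p = p%:P.

Lemma upolyC i c : upoly i c%:MP = (c%:MP)%:P.
Proof. by rewrite /upoly /= mmapC. Qed.

Lemma upolyX i : upoly i 'X_i = 'X.
Proof. by rewrite /upoly /= mmapX mmap1U eqxx. Qed.

Lemma upolyXn i j : j != i -> upoly i 'X_j = ('X_j)%:P.
Proof. by move=> ji; rewrite /upoly /= mmapX mmap1U (negbTE ji). Qed.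

Lemma substE i t p : subst i t p = (upoly i p).[t].
Proof. by []. Qed.

Lemma substM i t p q : subst i t (p * q) = subst i t p * subst i t q.
Proof. by rewrite rmorphM. Qed.
Lemma substB i t p q : subst i t (p - q) = subst i t p - subst i t q.
Proof. by rewrite rmorphB. Qed.
Lemma subst_exp i t p k : subst i t (p ^+ k) = subst i t p ^+ k.
Proof. by rewrite rmorphXn. Qed.
Lemma substC i t c : subst i t c%:MP = c%:MP.
Proof. by rewrite substE upolyC hornerC. Qed.

Lemma substX i t : subst i t 'X_i = t.
Proof. by rewrite substE upolyX hornerX. Qed.

Lemma upolyK i p : (upoly i p).['X_i] = p.
Proof.
rewrite -substE; apply: (mpoly_hom_ext (f := subst i 'X_i) (g := idfun)) => [c|j].
  by rewrite /= substE upolyC hornerC.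
by case: (eqVneq j i) => [->|ji]; rewrite /= substE ?upolyX ?hornerX ?upolyXn ?hornerC.
Qed.

Lemma upoly_eq0 i p : (upoly i p == 0) = (p == 0).
Proof.
apply/eqP/eqP => [e|->]; last by rewrite rmorph0.
by rewrite -(upolyK i p) e horner0.
Qed.

Lemma freeC i c : freeof i c%:MP. Proof. exact: upolyC. Qed.
Lemma freeX i j : j != i -> freeof i 'X_j. Proof. exact: upolyXn. Qed.
Lemma free0 i : freeof i 0. Proof. by rewrite /freeof !rmorph0. Qed.
Lemma free1 i : freeof i 1. Proof. by rewrite /freeof !rmorph1. Qed.
Lemma freeD i p q : freeof i p -> freeof i q -> freeof i (p + q).
Proof. by rewrite /freeof => fp fq; rewrite !rmorphD /= fp fq. Qed.
Lemma freeN i p : freeof i p -> freeof i (- p).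
Proof. by rewrite /freeof => fp; rewrite !rmorphN /= fp. Qed.
Lemma freeM i p q : freeof i p -> freeof i q -> freeof i (p * q).
Proof. by rewrite /freeof => fp fq; rewrite !rmorphM /= fp fq. Qed.
Lemma freeXn i p k : freeof i p -> freeof i (p ^+ k).
Proof. by rewrite /freeof => fp; rewrite !rmorphXn /= fp. Qed.
Lemma free_prod i (I : Type) (s : seq I) (P : pred I) (F : I -> R) :
  (forall x, P x -> freeof i (F x)) -> freeof i (\prod_(x <- s | P x) F x).
Proof. by move=> h; apply: big_ind => //; [apply: free1|apply: freeM]. Qed.

Lemma subst_free i t p : freeof i p -> subst i t p = p.
Proof. by rewrite substE => ->; rewrite hornerC. Qed.

Lemma lc_free i p : freeof i p -> lc i p = p.
Proof. by rewrite /lc => ->; rewrite lead_coefC. Qed.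

Lemma dg_free i p : freeof i p -> dg i p = 0%N.
Proof. by rewrite /dg => ->; rewrite size_polyC; case: (p == 0). Qed.

Lemma free_dg0 i p : dg i p = 0%N -> upoly i p = (lc i p)%:P.
Proof.
rewrite /dg /lc => h.
have /size1_polyC e : (size (upoly i p) <= 1)%N by rewrite -(leq_add2r 0) addn0 leqNgt -ltn_predRL h ltnn.
by rewrite lead_coefE h -e.
Qed.

Lemma dg0_lc i p : dg i p = 0%N -> lc i p = p.
Proof. by move=> /free_dg0 h; rewrite -{2}(upolyK i p) h hornerC. Qed.

Lemma dg0_free i p : dg i p = 0%N -> freeof i p.
Proof. by move=> h; rewrite /freeof free_dg0 // dg0_lc. Qed.

(** Expanding the coefficients in x_i once more must give constants; this is an equality of two ring
    morphisms, so it is enough to check it on constants and variables. *)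
Lemma coef_free i p k : freeof i (upoly i p)`_k.
Proof.
have h : map_poly (upoly i) (upoly i p) = map_poly polyC (upoly i p).
  apply: (mpoly_hom_ext (f := map_poly (upoly i) \o upoly i)
                        (g := map_poly polyC \o upoly i)) => [c|j] /=.
    by rewrite !upolyC !map_polyC /= upolyC.
  case: (eqVneq j i) => [->|ji]; first by rewrite !upolyX !map_polyX.
  by rewrite !upolyXn // !map_polyC /= upolyXn.
by rewrite /freeof -!coef_map h.
Qed.

Lemma free_subst i t p : freeof i t -> freeof i (subst i t p).
Proof.
move=> ft; rewrite substE horner_coef.
apply: big_ind => [||k _]; [exact: free0|exact: freeD|].
by apply: freeM; [apply: coef_free|apply: freeXn].
Qed.

Lemma upoly_subst i j t p : i != j -> freeof j t ->
  upoly j (subst i t p) = map_poly (subst i t) (upoly j p).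
Proof.
move=> ij ft; apply: (mpoly_hom_ext (f := upoly j \o subst i t)
               (g := map_poly (subst i t) \o upoly j)) => [c|k].
  change (upoly j (subst i t c%:MP) = map_poly (subst i t) (upoly j c%:MP)).
  by rewrite upolyC map_polyC /= !(subst_free t (freeC i c)) upolyC.
change (upoly j (subst i t 'X_k) = map_poly (subst i t) (upoly j 'X_k)).
case: (eqVneq k j) => [->|kj].
  rewrite (upolyX j) map_polyX subst_free ?upolyX //.
  by apply: freeX; rewrite eq_sym.
rewrite (upolyXn kj) map_polyC /=.
case: (eqVneq k i) => [->|ki]; first by rewrite !substX.
by rewrite !(subst_free t (freeX ki)) upolyXn.
Qed.

Lemma lcE i p : lc i p = lead_coef (upoly i p). Proof. by []. Qed.
Lemma dgE i p : dg i p = (size (upoly i p)).-1. Proof. by []. Qed.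

Lemma lcM i p q : lc i (p * q) = lc i p * lc i q.
Proof. by rewrite /lc rmorphM lead_coefM. Qed.

Lemma lc_eq0 i p : (lc i p == 0) = (p == 0).
Proof. by rewrite /lc lead_coef_eq0 upoly_eq0. Qed.

Lemma lc0 i : lc i 0 = 0. Proof. by rewrite /lc rmorph0 lead_coef0. Qed.

Lemma lcX i p k : lc i (p ^+ k) = lc i p ^+ k.
Proof. by rewrite /lc rmorphXn lead_coef_exp. Qed.

Lemma dgM i p q : p != 0 -> q != 0 -> dg i (p * q) = (dg i p + dg i q)%N.
Proof.
move=> p0 q0; rewrite /dg rmorphM size_mul ?upoly_eq0 //.
have h a b : (0 < a)%N -> (0 < b)%N -> (a + b).-2 = (a.-1 + b.-1)%N.
  by case: a => // a; case: b => // b; rewrite addnS.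
by apply: h; rewrite size_poly_gt0 upoly_eq0.
Qed.

Lemma dg_dvd i p q : dvdr p q -> q != 0 -> (dg i p <= dg i q)%N.
Proof.
by move=> [r ->]; rewrite mulf_eq0 negb_or => /andP[r0 p0]; rewrite dgM // leq_addl.
Qed.

Lemma dgX i p k : p != 0 -> dg i (p ^+ k) = (k * dg i p)%N.
Proof.
move=> p0; elim: k => [|k IH]; first by rewrite expr0 dg_free //; apply: free1.
by rewrite exprS dgM ?expf_neq0 // IH mulSn.
Qed.

Lemma dg_le i p m : (forall s, (m < s)%N -> (upoly i p)`_s = 0) -> (dg i p <= m)%N.
Proof.
by move=> h; rewrite /dg -subn1 leq_subLR add1n; apply/leq_sizeP.
Qed.

Lemma lc_coef i p : lc i p = (upoly i p)`_(dg i p).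
Proof. by rewrite /lc lead_coefE. Qed.

Lemma dg_X i : dg i 'X_i = 1%N.
Proof. by rewrite /dg upolyX size_polyX. Qed.

Lemma lc_unit i u : u \is a GRing.unit -> lc i u \is a GRing.unit.
Proof.
by move=> uu; apply/unitrPr; exists (lc i u^-1); rewrite -lcM divrr ?lc_free //; apply: free1.
Qed.

Lemma subst_unit i t u : u \is a GRing.unit -> subst i t u \is a GRing.unit.
Proof. exact: rmorph_unit. Qed.

Lemma dg_unit i u : u \is a GRing.unit -> dg i u = 0%N.
Proof.
move=> uu; have u0 : u != 0 by apply: contraTneq uu => ->; rewrite unitr0.
have v0 : u^-1 != 0 by rewrite invr_eq0.
have := dgM i u0 v0; rewrite divrr // (dg_free (free1 i)).
by move=> /esym/eqP; rewrite addn_eq0 => /andP[/eqP].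
Qed.

Lemma lc_dvd i p q : dvdr p q -> dvdr (lc i p) (lc i q).
Proof. by move=> [r ->]; exists (lc i r); rewrite lcM. Qed.

Lemma subst_dvd i t p q : dvdr p q -> dvdr (subst i t p) (subst i t q).
Proof. by move=> [r ->]; exists (subst i t r); rewrite rmorphM. Qed.

Lemma lc_assoc i p q : assoc p q -> assoc (lc i p) (lc i q).
Proof. by move=> [u uu ->]; exists (lc i u); rewrite ?lcM ?lc_unit. Qed.

Lemma subst_assoc i t p q : assoc p q -> assoc (subst i t p) (subst i t q).
Proof. by move=> [u uu ->]; exists (subst i t u); rewrite ?rmorphM ?subst_unit. Qed.

Lemma dg_assoc i p q : assoc p q -> dg i p = dg i q.
Proof.
move=> [u uu ->]; have [->|q0] := eqVneq q 0; first by rewrite mulr0.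
have u0 : u != 0 by apply: contraTneq uu => ->; rewrite unitr0.
by rewrite dgM // dg_unit.
Qed.

Lemma unit_dg_lc i p : lc i p \is a GRing.unit -> dg i p = 0%N ->
  p \is a GRing.unit.
Proof. by move=> u /dg0_lc <-. Qed.

Lemma substXn i j t : j != i -> subst i t 'X_j = 'X_j.
Proof. by move=> ji; rewrite substE upolyXn // hornerC. Qed.

Lemma subst_lc i j t p : i != j -> freeof j t -> subst i t (lc j p) != 0 ->
  lc j (subst i t p) = subst i t (lc j p).
Proof. by move=> ij ft h; rewrite /lc upoly_subst // lead_coef_map_eq. Qed.

Lemma dg_subst i j t p : i != j -> freeof j t -> subst i t (lc j p) != 0 ->
  dg j (subst i t p) = dg j p.
Proof. by move=> ij ft h; rewrite /dg upoly_subst // size_map_poly_id0. Qed.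

Lemma dg_subst_le i j t p : i != j -> freeof j t ->
  (dg j (subst i t p) <= dg j p)%N.
Proof.
move=> ij ft; rewrite /dg upoly_subst // -!subn1 leq_sub2r //.
exact: size_poly.
Qed.

(** The factor theorem over R; evaluating the formal variable at x_i brings the quotient back into
    R. *)
Lemma dvd_lin i t p : freeof i t -> dvdr ('X_i - t) p <-> subst i t p = 0.
Proof.
move=> ft; split=> [[r ->]|].
  by rewrite rmorphM rmorphB /= substX (subst_free t ft) subrr mulr0.
move=> /rootP /factor_theorem [q e]; exists q.['X_i].
by rewrite -{1}(upolyK i p) e hornerM hornerXsubC.
Qed.

Lemma prime_lin i t : freeof i t -> prime_elt ('X_i - t).
Proof.
move=> ft; have np : ~ dvdr ('X_i - t) 1.
  by move/(dvd_lin _ ft) => /eqP; rewrite rmorph1 oner_eq0.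
split.
- by rewrite -(upoly_eq0 i) rmorphB /= upolyX ft polyXsubC_eq0.
- by apply: contra_notN np; apply: unit_dvd.
- move=> f g /(dvd_lin _ ft); rewrite rmorphM => /eqP; rewrite mulf_eq0.
  by case/orP => /eqP /(dvd_lin _ ft); [left|right].
Qed.

Lemma dvd_var i p : dvdr 'X_i p <-> subst i 0 p = 0.
Proof. by rewrite -(dvd_lin _ (free0 i)) subr0. Qed.

Lemma prime_var i : prime_elt ('X_i : R).
Proof. by rewrite -['X_i]subr0; apply: prime_lin; apply: free0. Qed.

End OneVariable.

(** * Alternants *)

(* Exponents are encoded by the sequence [n] of their successive differences, so
   that the last exponent, [expo n (size n)], is 0. *)
Definition expo (n : seq nat) (j : nat) : nat := sumn (drop j n).

Lemma expo0 n : expo n 0 = sumn n. Proof. by rewrite /expo drop0. Qed.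
Lemma expo_cons a n j : expo (a :: n) j.+1 = expo n j. Proof. by []. Qed.
Lemma expo_size n j : (size n <= j)%N -> expo n j = 0%N.
Proof. by move=> h; rewrite /expo drop_oversize. Qed.
Lemma expo_rcons n b j : (j <= size n)%N -> expo (rcons n b) j = (b + expo n j)%N.
Proof. by move=> h; rewrite /expo drop_rcons // sumn_rcons addnC. Qed.

Lemma expo_lt n j l : all (ltn 0) n -> (j < l)%N -> (l <= size n)%N ->
  (expo n l < expo n j)%N.
Proof.
elim: n j l => [|a n IH] [|j] [|l] //= /andP[a0 pn]; rewrite ?ltnS => jl ln.
  rewrite expo0 expo_cons /=; case: (posnP l) => [->|l0].
    by rewrite expo0 -[ltnLHS]add0n ltn_add2r.
  by apply: (leq_trans (IH 0%N l pn l0 ln)); rewrite expo0 leq_addl.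
by rewrite !expo_cons IH.
Qed.

Lemma expo_inj n j l : all (ltn 0) n -> (j <= size n)%N -> (l <= size n)%N ->
  expo n j = expo n l -> j = l.
Proof.
move=> pn jn ln e; case: (ltngtP j l) => // h.
  by have := expo_lt pn h ln; rewrite e ltnn.
by have := expo_lt pn h jn; rewrite e ltnn.
Qed.

Lemma expo_dvd e n j : all (dvdn e) n -> (e %| expo n j)%N.
Proof.
elim: n j => [|a n IH] j; first by rewrite expo_size.
move=> /= /andP[ea en]; case: j => [|j]; last by rewrite expo_cons IH.
by rewrite expo0 /= dvdn_add // -expo0 IH.
Qed.

Lemma polyC_sign (D : comNzRingType) b c (A : D) :
  (-1) ^+ b * ((-1) ^+ c * A)%:P = ((-1) ^+ (b + c) * A)%:P.
Proof. by rewrite exprD -mulrA [RHS]polyCM polyC_exp polyCN. Qed.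

Section Alternants.
Variables (K : closedFieldType) (N : nat).
Local Notation R := {mpoly K[N]}.
Implicit Types (V W : {set 'I_N}) (n : seq nat).

Definition alternant k (v : 'I_k -> 'I_N) (a : nat -> nat) : R :=
  \det (\matrix_(i < k, j < k) ('X_(v i) ^+ a j : R)).
(** The enumeration of [V] affects only the sign, see [S_alt]. *)
Definition Sdiff V n : R := alternant (fun i : 'I_#|V| => enum_val i) (expo n).
Definition varprod V : R := \prod_(p in V) 'X_p.

Lemma alt_ext k (v : 'I_k -> 'I_N) (a b : nat -> nat) :
  (forall l, (l < k)%N -> a l = b l) -> alternant v a = alternant v b.
Proof.
by move=> ab; congr (\det _); apply/matrixP => i j; rewrite !mxE ab.
Qed.

Lemma alt_shift k (v : 'I_k -> 'I_N) (a : nat -> nat) b :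
  alternant v (fun j => b + a j)%N = (\prod_i 'X_(v i)) ^+ b * alternant v a.
Proof.
rewrite /alternant -prodrXl.
pose D : 'rV[R]_k := \row_i 'X_(v i) ^+ b.
have -> : \prod_i ('X_(v i) : R) ^+ b = \det (diag_mx D).
  by rewrite det_diag; apply: eq_bigr => i _; rewrite mxE.
rewrite -det_mulmx mul_diag_mx; congr (\det _).
by apply/matrixP => i j; rewrite !mxE exprD.
Qed.

Lemma alt_set k k' (v : 'I_k -> 'I_N) (v' : 'I_k' -> 'I_N) :
  injective v -> injective v' ->
  [set v i | i : 'I_k] = [set v' i | i : 'I_k'] ->
  exists b : nat, forall a, alternant v' a = (-1) ^+ b * alternant v a.
Proof.
move=> iv iv' e.
have ek : k = k' by rewrite -(card_ord k) -(card_imset _ iv) e card_imset ?card_ord.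
case: k' / ek v' iv' e => v' iv' e.
pose f (i : 'I_k) := odflt i [pick j | v j == v' i].
have fE i : v (f i) = v' i.
  rewrite /f; case: pickP => [j /eqP //|h] /=.
  have : v' i \in [set v i | i : 'I_k] by rewrite e imset_f.
  by case/imsetP => j _ /esym/eqP; rewrite h.
have fi : injective f by move=> i j h; apply: iv'; rewrite -!fE h.
exists (perm fi) => a; rewrite /alternant -det_perm -det_mulmx -row_permE.
by congr (\det _); apply/matrixP => i j; rewrite !mxE permE fE.
Qed.

Lemma enum_valK_set V : [set enum_val i | i : 'I_#|V|] = V.
Proof.
apply/setP => x; apply/imsetP/idP => [[i _ ->]|xV]; first exact: enum_valP.
by exists (enum_rank_in xV x); rewrite ?enum_rankK_in.
Qed.

Lemma S_alt V n k (v : 'I_k -> 'I_N) : injective v ->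
  [set v i | i : 'I_k] = V -> assoc (Sdiff V n) (alternant v (expo n)).
Proof.
move=> iv e; have [|b hb] := alt_set iv (@enum_val_inj _ (mem V)).
  by rewrite e enum_valK_set.
by rewrite /Sdiff hb; apply: assoc_sign.
Qed.

Lemma enum_set_at V i k : #|V| = k.+1 -> i \in V ->
  exists (v : 'I_k.+1 -> 'I_N) i0,
    [/\ injective v, [set v j | j : 'I_k.+1] = V & v i0 = i].
Proof.
move=> cV iV; pose v (j : 'I_k.+1) : 'I_N := enum_val (cast_ord (esym cV) j).
have iv : injective v by move=> x y /enum_val_inj /cast_ord_inj.
have e : [set v j | j : 'I_k.+1] = V.
  apply/setP => x; apply/imsetP/idP => [[j _ ->]|xV]; first exact: enum_valP.
  exists (cast_ord cV (enum_rank_in xV x)) => //.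
  by rewrite /v cast_ordK enum_rankK_in.
have : i \in [set v j | j : 'I_k.+1] by rewrite e.
by case/imsetP => i0 _ ei; exists v, i0.
Qed.

Lemma imset_lift k (v : 'I_k.+1 -> 'I_N) (i0 : 'I_k.+1) : injective v ->
  [set v (lift i0 j) | j : 'I_k] = [set v j | j : 'I_k.+1] :\ v i0.
Proof.
move=> iv; apply/setP => x; rewrite !inE; apply/imsetP/andP.
  move=> [j _ ->]; split; last exact: imset_f.
  by rewrite (inj_eq iv) eq_sym neq_lift.
move=> [xi /imsetP [j _ ej]]; rewrite ej (inj_eq iv) eq_sym in xi.
by case/unlift_some: xi => l el _; exists l; rewrite // ej el.
Qed.

(** Laplace expansion along the only row that contains the chosen variable; [lift i0] skips this row
    and [bump j] the column of the j-th exponent. *)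
Lemma upoly_alt k (v : 'I_k.+1 -> 'I_N) (i0 : 'I_k.+1) a : injective v ->
  upoly (v i0) (alternant v a) =
  \sum_(j < k.+1) ((-1) ^+ (i0 + j) *
     alternant (fun l => v (lift i0 l)) (fun l => a (bump j l)))%:P * 'X^(a j).
Proof.
move=> iv; rewrite /alternant -det_map_mx (expand_det_row _ i0).
apply: eq_bigr => j _; rewrite !mxE rmorphXn /= upolyX mulrC; congr (_ * _).
rewrite /cofactor rmorphM rmorphXn rmorphN rmorph1; congr (_ * _).
rewrite -det_map_mx; congr (\det _); apply/matrixP => x y.
by rewrite !mxE !rmorphXn /= upolyXn // (inj_eq iv) eq_sym neq_lift.
Qed.

Section Facets.
Variables (V : {set 'I_N}) (n : seq nat) (i : 'I_N).
Hypotheses (cV : #|V| = (size n).+1) (iV : i \in V).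

Lemma upoly_S : exists (v : 'I_(size n) -> 'I_N) (b : nat),
  [/\ injective v, [set v l | l : 'I_(size n)] = V :\ i &
      upoly i (Sdiff V n) = \sum_(j < (size n).+1) ((-1) ^+ (b + j) *
        alternant v (fun l => expo n (bump j l)))%:P * 'X^(expo n j)].
Proof.
have [v [i0 [iv e ei]]] := enum_set_at cV iV.
exists (fun l => v (lift i0 l)).
have [|b hb] := alt_set iv (@enum_val_inj _ (mem V)); first by rewrite e enum_valK_set.
exists (b + i0)%N; split; first by move=> x y /iv /lift_inj.
  by rewrite imset_lift // e ei.
rewrite /Sdiff hb rmorphM rmorphXn rmorphN rmorph1 /= -ei upoly_alt // mulr_sumr.
apply: eq_bigr => j _; rewrite mulrA; congr (_ * _).
by rewrite -addnA polyC_sign.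
Qed.

Lemma coef_S_supp s : (upoly i (Sdiff V n))`_s != 0 ->
  exists2 j, (j <= size n)%N & s = expo n j.
Proof.
have [v [b [_ _ ->]]] := upoly_S.
rewrite coef_sum => h.
have [j hj|h0] := pickP (fun j : 'I_(size n).+1 => s == expo n j).
  by exists j; [rewrite -ltnS|apply/eqP].
by rewrite big1 ?eqxx // in h => j _; rewrite coefCM coefXn h0 mulr0.
Qed.

Hypothesis pn : all (ltn 0) n.

(** Positive differences make the exponents distinct, so no two minors contribute to the same power
    of x_i. *)
Lemma coef_S j : (j <= size n)%N ->
  exists v : 'I_(size n) -> 'I_N,
  [/\ injective v, [set v l | l : 'I_(size n)] = V :\ i &
   assoc (upoly i (Sdiff V n))`_(expo n j) (alternant v (fun l => expo n (bump j l)))].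
Proof.
move=> jn; have [v [b [iv e h]]] := upoly_S; exists v; split=> //.
rewrite h coef_sum (bigD1 (Ordinal (jn : (j < (size n).+1)%N))) //=.
rewrite coefCM coefXn eqxx mulr1 big1 ?addr0; first exact: assoc_sign.
move=> l lj; rewrite coefCM coefXn; case: eqP => [e2|_]; last by rewrite mulr0.
have := expo_inj pn jn (ltn_ord l : (l <= size n)%N) e2 => e3.
by case/eqP: lj; apply: val_inj; rewrite /= e3.
Qed.

End Facets.

Lemma mono_image k (v : 'I_k -> 'I_N) V : injective v ->
  [set v l | l : 'I_k] = V -> \prod_l 'X_(v l) = varprod V.
Proof. by move=> iv <-; rewrite /varprod big_imset //= => x y _ _; apply: iv. Qed.

Lemma subst0_coef i p : subst i 0 p = (upoly i p)`_0 :> R.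
Proof. by rewrite substE horner_coef0. Qed.

(** The constant term is the minor without the last column. All its exponents contain the summand b,
    so x_p^b comes out of every row. *)
Lemma z_S V n b i : #|V| = (size n).+2 -> i \in V -> all (ltn 0) n -> (0 < b)%N ->
  assoc (subst i 0 (Sdiff V (rcons n b))) (varprod (V :\ i) ^+ b * Sdiff (V :\ i) n).
Proof.
move=> cV iV pn b0; rewrite subst0_coef.
have cV' : #|V| = (size (rcons n b)).+1 by rewrite size_rcons.
have pn' : all (ltn 0) (rcons n b) by rewrite all_rcons /= b0.
have [v [iv e]] := coef_S cV' iV pn' (leqnn _).
rewrite expo_size // => /assoc_trans; apply.
rewrite (_ : alternant v _ = alternant v (fun l => b + expo n l)%N); last first.
  apply: alt_ext => l; rewrite size_rcons => hl.
  by rewrite /bump leqNgt hl add0n expo_rcons.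
rewrite alt_shift (mono_image iv e); apply/assoc_mull/assoc_sym.
exact: S_alt.
Qed.

Lemma size_S V n i : #|V| = (size n).+1 -> i \in V -> all (ltn 0) n ->
  (size (upoly i (Sdiff V n)) <= (sumn n).+1)%N.
Proof.
move=> cV iV pn; apply/leq_sizeP => s hs; apply/eqP/negPn/negP => /(coef_S_supp cV iV).
move=> [j jn es]; move: hs; rewrite es -expo0 ltnNge; case: (posnP j) => [->|j0].
  by rewrite leqnn.
by rewrite ltnW ?expo_lt.
Qed.

Lemma coef_S_top V a n i : #|V| = (size n).+2 -> i \in V -> all (ltn 0) (a :: n) ->
  assoc (upoly i (Sdiff V (a :: n)))`_(a + sumn n) (Sdiff (V :\ i) n).
Proof.
move=> cV iV pn; have [v [iv e]] := @coef_S V (a :: n) i cV iV pn 0 (leq0n _).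
rewrite expo0 => /assoc_trans; apply; apply: assoc_sym.
exact: S_alt.
Qed.

Lemma S_nil V : #|V| = 1%N -> assoc (Sdiff V [::]) 1.
Proof.
move=> cV; have [x xV] : exists x, x \in V.
  by apply/card_gt0P; rewrite cV.
have [v [i0 [iv e ei]]] := enum_set_at cV xV.
apply: (assoc_trans (S_alt _ iv e)); apply: assoc_eq.
by rewrite /alternant det_mx11 mxE.
Qed.

Lemma S_neq0 V n : #|V| = (size n).+1 -> all (ltn 0) n -> Sdiff V n != 0.
Proof.
elim: n V => [|a n IH] V cV pn.
  by rewrite (assoc_neq0 (S_nil cV)) oner_neq0.
have [i iV] : exists i, i \in V by apply/card_gt0P; rewrite cV.
apply/eqP => S0; have := assoc_neq0 (coef_S_top cV iV pn).
rewrite S0 rmorph0 coef0 eqxx IH //; last by case/andP: pn.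
by apply/eqP; rewrite -eqSS -cV (cardsD1 i V) iV.
Qed.

Lemma cardsD1_S V m i : #|V| = m.+1 -> i \in V -> #|V :\ i| = m.
Proof. by move=> cV iV; apply/eqP; rewrite -eqSS -cV (cardsD1 i V) iV. Qed.

Lemma size_S_eq V n i : #|V| = (size n).+1 -> i \in V -> all (ltn 0) n ->
  size (upoly i (Sdiff V n)) = (sumn n).+1.
Proof.
case: n => [|a n] cV iV pn.
  apply/eqP; rewrite eqn_leq size_S //= size_poly_gt0 upoly_eq0.
  exact: S_neq0.
apply/eqP; rewrite eqn_leq size_S //= ltnNge; apply/negP => /leq_sizeP h.
have := assoc_neq0 (coef_S_top cV iV pn); rewrite h // eqxx => /esym.
by rewrite S_neq0 //; [apply: cardsD1_S|case/andP: pn].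
Qed.

Lemma dg_S V n i : #|V| = (size n).+1 -> i \in V -> all (ltn 0) n ->
  dg i (Sdiff V n) = sumn n.
Proof. by move=> *; rewrite /dg size_S_eq. Qed.

Lemma lc_S V a n i : #|V| = (size n).+2 -> i \in V -> all (ltn 0) (a :: n) ->
  assoc (lc i (Sdiff V (a :: n))) (Sdiff (V :\ i) n).
Proof.
move=> cV iV pn; rewrite /lc lead_coefE size_S_eq //.
exact: coef_S_top.
Qed.

Lemma free_S V n i : i \notin V -> freeof i (Sdiff V n).
Proof.
move=> iV; rewrite /freeof /Sdiff /alternant -det_map_mx -(det_map_mx polyC).
congr (\det _); apply/matrixP => x y; rewrite !mxE !rmorphXn /=.
by rewrite upolyXn //; apply: contraNneq iV => <-; apply: enum_valP.
Qed.

Lemma alternating_S V n p q : p \in V -> q \in V -> p != q ->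
  subst p 'X_q (Sdiff V n) = 0.
Proof.
move=> pV qV pq; rewrite /Sdiff /alternant -det_map_mx.
have rk x (xV : x \in V) : enum_val (enum_rank_in pV x) = x by rewrite enum_rankK_in.
apply: (determinant_alternate (i1 := enum_rank_in pV p) (i2 := enum_rank_in pV q)).
  by apply: contraNneq pq => /(congr1 enum_val); rewrite (rk _ pV) (rk _ qV) => ->.
move=> j; rewrite !mxE !rmorphXn /= (rk _ pV) (rk _ qV) substX subst_free //.
by apply: freeX; rewrite eq_sym.
Qed.

(* All exponents but 0 are congruent to [b] modulo [e], so substituting w x_q
   instead of x_q for x_p, which gives 0, only rescales the constant term. *)
Lemma twist_S V n b e w p q : #|V| = (size n).+2 -> p \in V -> q \in V -> p != q ->
  all (dvdn e) n -> w ^+ e = 1 ->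
  subst p (w%:MP * 'X_q) (Sdiff V (rcons n b)) =
    (1 - w ^+ b)%:MP * subst p 0 (Sdiff V (rcons n b)).
Proof.
move=> cV pV qV pq en we.
have cV' : #|V| = (size (rcons n b)).+1 by rewrite size_rcons.
have supp := coef_S_supp cV' pV.
have alt0 := alternating_S (rcons n b) pV qV pq.
rewrite subst0_coef substE; move: alt0; rewrite substE.
move: (upoly p _) supp => f supp f0.
have -> : f.[w%:MP * 'X_q] = f.[w%:MP * 'X_q] - (w ^+ b)%:MP * f.['X_q].
  by rewrite f0 mulr0 subr0.
rewrite !horner_coef.
rewrite mulr_sumr -sumrB.
have hs s : f`_s != 0 -> s = 0%N \/ w ^+ s = w ^+ b.
  case/supp => j; rewrite size_rcons => jn ->.
  case: (ltngtP j (size n).+1) jn => // [jn _|-> _]; last first.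
    by left; rewrite expo_size // size_rcons.
  right; rewrite expo_rcons // exprD; have /dvdnP [m ->] := expo_dvd j en.
  by rewrite mulnC exprM we expr1n mulr1.
have ht s : f`_s * (w%:MP * 'X_q) ^+ s - (w ^+ b)%:MP * (f`_s * 'X_q ^+ s)
    = (if s == 0%N then (1 - w ^+ b)%:MP * f`_0 else 0).
  have [fs0|/hs h] := eqVneq (f`_s) 0.
    rewrite fs0 !mul0r mulr0 subrr; case: eqP => // s0.
    by rewrite -[in f`_0]s0 fs0 mulr0.
  case: eqP h => [-> _|s0 [//|h]].
    by rewrite !expr0 !mulr1 mpolyCB mulrBl mul1r.
  by rewrite exprMn -rmorphXn /= h mulrCA subrr.
have [e0|fn0] := posnP (size f).
  by rewrite e0 big_ord0 nth_default ?e0 // mulr0.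
by rewrite -(prednK fn0) big_ord_recl ht /= big1 ?addr0 // => s _.
Qed.

End Alternants.

(** * Linear forms and roots of unity *)

Lemma assoc_prod (D : idomainType) (I : Type) (s : seq I) (P : pred I) (F G : I -> D) :
  (forall i, P i -> assoc (F i) (G i)) ->
  assoc (\prod_(i <- s | P i) F i) (\prod_(i <- s | P i) G i).
Proof.
move=> h; elim/big_ind2: _ => //; first exact: assoc_refl.
by move=> *; apply: assoc_mul.
Qed.

Lemma prime_dvd_prod (D : idomainType) (I : eqType) (s : seq I) (P : pred I)
    (F : I -> D) p :
  prime_elt p -> dvdr p (\prod_(i <- s | P i) F i) ->
  exists i, [/\ i \in s, P i & dvdr p (F i)].
Proof.
move=> [p0 pu pp]; elim: s => [|i s IH].
  by rewrite big_nil => /dvd_unit; rewrite unitr1 => /(_ isT); rewrite (negbTE pu).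
rewrite big_cons; case: ifP => Pi.
  case/pp => [h|/IH [j [js Pj h]]]; first by exists i; rewrite mem_head.
  by exists j; rewrite inE js orbT.
by case/IH => j [js Pj h]; exists j; rewrite inE js orbT.
Qed.

Section UnityRoots.
Variables (K : closedFieldType).
Hypothesis K0 : forall m, (m.+1)%:R != 0 :> K.

Definition rts e : seq K := sval (closed_field_poly_normal ('X^e - 1 : {poly K})).

Lemma rtsE e : (0 < e)%N -> 'X^e - 1 = \prod_(w <- rts e) ('X - w%:P) :> {poly K}.
Proof.
move=> e0; rewrite /rts; case: closed_field_poly_normal => r /= h.
by rewrite [LHS]h lead_coefXnsubC // scale1r.
Qed.

Lemma uniq_rts e : (0 < e)%N -> uniq (rts e).
Proof.
move=> e0; rewrite -separable_prod_XsubC -rtsE // separable_Xn_sub_1 //.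
by rewrite -(prednK e0).
Qed.

Lemma mem_rts e w : (0 < e)%N -> (w \in rts e) = (w ^+ e == 1).
Proof.
move=> e0; rewrite -root_prod_XsubC -rtsE // rootE !hornerE.
by rewrite subr_eq0.
Qed.

Lemma size_rts e : (0 < e)%N -> size (rts e) = e.
Proof.
move=> e0; have := size_prod_XsubC (rts e) idfun.
by rewrite -rtsE // size_XnsubC // => -[].
Qed.

Lemma unity_gcd e b (w : K) : w ^+ e = 1 -> w ^+ b = 1 -> w ^+ gcdn e b = 1.
Proof.
case: (posnP e) => [->|e0]; first by rewrite gcd0n.
move=> we wb; have [m pm] := prim_order_exists e0 we.
rewrite (prim_order_dvd pm) => me.
have mb : (m %| b)%N by rewrite (prim_order_dvd pm) wb.
by apply/eqP; rewrite -(prim_order_dvd pm) dvdn_gcd mb (prim_order_dvd pm) we eqxx.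
Qed.

(** Otherwise all e roots would be roots of unity for gcd(e, b), of which there are fewer than e. *)
Lemma exists_rts e b : (0 < e)%N -> ~~ (e %| b)%N ->
  exists2 w, w \in rts e & w ^+ b != 1.
Proof.
move=> e0 eb; apply/hasP; apply: contraNT eb => /hasPn h.
have g0 : (0 < gcdn e b)%N by rewrite gcdn_gt0 e0.
have : (size (rts e) <= size (rts (gcdn e b)))%N.
  apply: uniq_leq_size; first exact: uniq_rts.
  move=> w we; rewrite mem_rts //; apply/eqP/unity_gcd.
    by apply/eqP; rewrite -mem_rts.
  by apply/eqP; have := h w we; rewrite negbK.
rewrite !size_rts // => le; apply/gcdn_idPl/eqP.
by rewrite eqn_leq le dvdn_leq // dvdn_gcdl.
Qed.

Lemma rts_neq0 e w : (0 < e)%N -> w \in rts e -> w != 0.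
Proof.
move=> e0; rewrite mem_rts //; apply: contraTneq => ->.
by rewrite expr0n eqn0Ngt e0 eq_sym oner_eq0.
Qed.

Lemma rts_sub d e w : (0 < e)%N -> (d %| e)%N -> w \in rts d -> w \in rts e.
Proof.
move=> e0 de; have d0 := dvdn_gt0 e0 de; rewrite !mem_rts // => /eqP wd.
by case/dvdnP: de => m ->; rewrite mulnC exprM wd expr1n.
Qed.

End UnityRoots.

Section LinearForms.
Variables (K : closedFieldType) (N : nat).
Hypothesis K0 : forall m, (m.+1)%:R != 0 :> K.
Local Notation R := {mpoly K[N]}.
Implicit Types (V W : {set 'I_N}) (n : seq nat) (p q i j : 'I_N) (w : K) (a : pred K).

Definition lin p q w : R := 'X_p - w%:MP * 'X_q.

Lemma free_cX p q w : p != q -> freeof p (w%:MP * 'X_q : R).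
Proof. by move=> pq; apply: freeM; [apply: freeC|apply: freeX; rewrite eq_sym]. Qed.

Lemma prime_lin_form p q w : p != q -> prime_elt (lin p q w).
Proof. by move=> pq; apply/prime_lin/free_cX. Qed.

Lemma dvd_lin_form p q w (f : R) : p != q ->
  dvdr (lin p q w) f <-> subst p (w%:MP * 'X_q) f = 0.
Proof. by move=> pq; apply/dvd_lin/free_cX. Qed.

Lemma X_neq0 i : 'X_i != 0 :> R.
Proof. by rewrite -(upoly_eq0 i) upolyX polyX_eq0. Qed.

Lemma cX_neq0 i w : w != 0 -> w%:MP * 'X_i != 0 :> R.
Proof. by move=> w0; rewrite mulf_neq0 ?X_neq0 // mpolyC_eq0. Qed.

Lemma lin2_neq0 i j (a b : K) : i != j -> a != 0 ->
  a%:MP * 'X_i - b%:MP * 'X_j != 0 :> R.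
Proof.
move=> ij a0; apply: contraNneq (cX_neq0 i a0) => /(congr1 (subst j 0)).
by rewrite rmorph0 substB !substM !substC substX mulr0 subr0 substXn // => ->.
Qed.

Lemma lin_ndvd_X p q w i : p != q -> w != 0 -> ~ dvdr (lin p q w) 'X_i.
Proof.
move=> pq w0 /(dvd_lin_form _ _ pq); have [->|ip] := eqVneq i p.
  by rewrite substX => /eqP; rewrite (negbTE (cX_neq0 _ w0)).
by rewrite substXn // => /eqP; rewrite (negbTE (X_neq0 _)).
Qed.

Lemma lin_ndvd_lin p q w p' q' w' : (p < q)%N -> (p' < q')%N ->
  w != 0 -> w' != 0 -> (p, q, w) != (p', q', w') -> ~ dvdr (lin p q w) (lin p' q' w').
Proof.
move=> pq pq' w0 w'0 ne.
have npq : p != q by apply: contraTneq pq => ->; rewrite ltnn.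
have npq' : p' != q' by apply: contraTneq pq' => ->; rewrite ltnn.
move/(dvd_lin_form _ _ npq) => /eqP; apply/negP; move: ne.
rewrite /lin substB substM substC.
case: (eqVneq p' p) pq' => [->|pp] pq'.
  have q'p : q' != p by apply: contraTneq pq' => ->; rewrite ltnn.
  rewrite substX substXn //.
  have [-> ne|qq _] := eqVneq q' q; last by rewrite lin2_neq0 // eq_sym.
  rewrite -mulrBl -mpolyCB cX_neq0 // subr_eq0.
  by apply: contraNneq ne => ->.
rewrite (substXn _ pp) -[X in X - _]mul1r -mpolyC1 => _.
have [e|qp] := eqVneq q' p.
  rewrite e substX mulrA -mpolyCM lin2_neq0 ?oner_neq0 //.
  by apply: contraTneq pq' => ->; rewrite e -leqNgt ltnW.
by rewrite (substXn _ qp) lin2_neq0 ?oner_neq0.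
Qed.

(** The order of the indices selects one of the associated forms x_p - w x_q and x_q - w^-1 x_p. *)
Definition pairs W (x : 'I_N * 'I_N) := [&& x.1 \in W, x.2 \in W & (x.1 < x.2)%N].
Definition pairF e (a : pred K) (x : 'I_N * 'I_N) : R :=
  \prod_(w <- rts K e | a w) lin x.1 x.2 w.
Definition linprod W e a : R := \prod_(x | pairs W x) pairF e a x.
Definition linforms W e : R := linprod W e predT.

Lemma pairs_neq W x : pairs W x -> x.1 != x.2.
Proof. by case/and3P => _ _; apply: contraTneq => ->; rewrite ltnn. Qed.

Definition is_lin W e (a : pred K) (f : R) : Prop :=
  exists p q w, [/\ pairs W (p, q), w \in rts K e, a w & f = lin p q w].

Lemma pprod_L W e a : pprods (is_lin W e a) (linprod W e a).
Proof.
apply: pprod_prod => x Wx; rewrite /pairF big_seq_cond.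
apply: pprod_prod => w /andP[we aw]; apply: pprod_prime.
  exact/prime_lin_form/(pairs_neq Wx).
by exists x.1, x.2, w; split=> //; case: x Wx.
Qed.

Definition is_var W (f : R) : Prop := exists2 p, p \in W & f = 'X_p.

Lemma pprod_mono W k : pprods (is_var W) (varprod K W ^+ k).
Proof.
apply: pprodX; apply: pprod_prod => p pW.
by apply: pprod_prime; [apply: prime_var|exists p].
Qed.

Lemma mono_neq0 W k : varprod K W ^+ k != 0.
Proof. exact: pprod_neq0 (pprod_mono W k). Qed.

Lemma L_neq0 W e a : linprod W e a != 0.
Proof. exact: pprod_neq0 (pprod_L W e a). Qed.

Lemma lin_ndvd_mono W p q w k : p != q -> w != 0 -> ~ dvdr (lin p q w) (varprod K W ^+ k).
Proof.
move=> pq w0; have pr := prime_lin_form w pq; have [_ pu pp] := pr.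
elim: k => [/dvd_unit|k IH]; first by rewrite unitr1 (negbTE pu) => /(_ isT).
rewrite exprS => /pp [|//] /(prime_dvd_prod pr) [i [_ _]].
exact: lin_ndvd_X.
Qed.

Lemma lin_dvd_L W e a p q w : (0 < e)%N -> (p < q)%N -> w != 0 ->
  dvdr (lin p q w) (linprod W e a) -> [/\ p \in W, q \in W, w \in rts K e & a w].
Proof.
move=> e0 pq w0; have npq : p != q by apply: contraTneq pq => ->; rewrite ltnn.
have pr := prime_lin_form w npq.
case/(prime_dvd_prod pr) => x [_ Wx] /(prime_dvd_prod pr) [w' [we aw h]].
have [x1 x2 x12] := and3P Wx.
have [e1|ne] := eqVneq (p, q, w) (x.1, x.2, w'); first by case: e1 => -> -> ->.
by case: (lin_ndvd_lin pq x12 w0 (rts_neq0 e0 we) ne).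
Qed.

Lemma L_dvd_lin W e a p q w : pairs W (p, q) -> w \in rts K e -> a w ->
  dvdr (lin p q w) (linprod W e a).
Proof.
move=> Wpq we aw; rewrite /linprod (bigD1 (p, q)) //=; apply/dvd_mulr.
by rewrite /pairF (big_rem w) //= aw; apply/dvd_mulr/dvd_refl.
Qed.

Lemma lc_lin p q w i : i != p -> i != q -> lc i (lin p q w) = lin p q w.
Proof.
move=> ip iq; apply: lc_free; apply: freeD; first by apply: freeX; rewrite eq_sym.
by apply/freeN/free_cX.
Qed.

Lemma lc_lin_unit p q w i : p != q -> w != 0 -> (i == p) || (i == q) ->
  lc i (lin p q w) \is a GRing.unit /\ dg i (lin p q w) = 1%N.
Proof.
move=> pq w0; rewrite /lc /dg /lin rmorphB rmorphM /= upolyC.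
case: eqP => [->|ip]; last case: eqP => // iq _.
  rewrite upolyX upolyXn 1?eq_sym // -polyCM => _.
  by rewrite lead_coefXsubC size_XsubC unitr1.
rewrite -iq upolyX upolyXn; last by rewrite iq.
have wn : w%:MP_[N] != 0 :> R by rewrite mpolyC_eq0.
have sz : size ((w%:MP_[N])%:P * 'X : {poly R}) = 2 by rewrite size_mulX ?polyC_eq0 // size_polyC wn.
rewrite addrC size_polyDl ?size_polyN ?sz; last by rewrite size_polyC; case: eqP.
rewrite lead_coefDl ?size_polyN ?sz; last by rewrite size_polyC; case: eqP.
rewrite lead_coefN lead_coefMX lead_coefC unitrN; split=> //.
by apply/unitrPr; exists (w^-1)%:MP; rewrite -mpolyCM divff.
Qed.

Lemma lc_prod i (I : Type) (s : seq I) (P : pred I) (F : I -> R) :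
  lc i (\prod_(x <- s | P x) F x) = \prod_(x <- s | P x) lc i (F x).
Proof.
apply: (big_morph (lc i)); first exact: lcM.
by rewrite lc_free //; apply: free1.
Qed.

(** A form containing x_i has leading coefficient 1 or -w, a unit since w <> 0; the other forms are
    unchanged. *)
Lemma lc_L W e a i : (0 < e)%N -> i \in W -> assoc (lc i (linprod W e a)) (linprod (W :\ i) e a).
Proof.
move=> e0 iW; rewrite lc_prod.
apply: (assoc_trans (q := \prod_(x | pairs W x)
   if (i == x.1) || (i == x.2) then 1 else pairF e a x)).
  apply: assoc_prod => x Wx; rewrite lc_prod; case: ifP => ix.
    exists (\prod_(w <- rts K e | a w) lc i (lin x.1 x.2 w)); last by rewrite mulr1.
    rewrite big_seq_cond; elim/big_rec: _ => [|w u /andP[we _] uu].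
      exact: unitr1.
    rewrite unitrM uu andbT.
    by apply: (lc_lin_unit (pairs_neq Wx) (rts_neq0 e0 we) ix).1.
  move/negbT: ix; rewrite negb_or => /andP[i1 i2].
  by apply: assoc_eq; apply: eq_bigr => w _; rewrite lc_lin.
apply: assoc_eq; rewrite /linprod big_mkcond [RHS]big_mkcond; apply: eq_bigr => x _.
rewrite /pairs !inE ![i == _]eq_sym.
by case: (x.1 == i); case: (x.2 == i); rewrite /= ?andbF ?if_same.
Qed.

End LinearForms.

(** * Facets of the quotient *)

Section Quotients.
Variables (K : closedFieldType) (N : nat).
Hypothesis K0 : forall m, (m.+1)%:R != 0 :> K.
Local Notation R := {mpoly K[N]}.
Local Notation T := (@linforms K N).
Local Notation L := (@linprod K N).
Local Notation S := (@Sdiff K N).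
Local Notation mono := (@varprod K N).
Implicit Types (V W : {set 'I_N}) (n : seq nat) (p q i j : 'I_N) (w : K) (a : pred K).

Lemma dg_prod i (I : Type) (s : seq I) (P : pred I) (F : I -> R) :
  (forall x, P x -> F x != 0) ->
  dg i (\prod_(x <- s | P x) F x) = (\sum_(x <- s | P x) dg i (F x))%N.
Proof.
move=> h; elim: s => [|x s IH].
  by rewrite !big_nil dg_free //; apply: free1.
rewrite !big_cons; case: ifP => // Px; rewrite dgM ?IH ?h //.
elim/big_rec: _ => [|y u Py u0]; first exact: oner_neq0.
by rewrite mulf_neq0 ?h.
Qed.

Lemma dg_mono W k : k \in W -> dg k (mono W) = 1%N.
Proof.
move=> kW; rewrite dg_prod => [|x _]; last exact: X_neq0.
rewrite (bigD1 k) //= dg_X big1 // => x /andP[_ xk].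
by rewrite dg_free //; apply: freeX.
Qed.

Lemma pairF_neq0 e a (x : 'I_N * 'I_N) : x.1 != x.2 -> pairF e a x != 0.
Proof.
move=> h; rewrite /pairF; elim/big_rec: _ => [|w u _ u0]; first exact: oner_neq0.
by rewrite mulf_neq0 //; case: (prime_lin_form w h).
Qed.

(** Each of the other variables contributes e forms that contain x_i. The inequality suffices for
    [S_nseq], from which [dg_T] gets the equality. *)
Lemma dg_T_ge W e i : (0 < e)%N -> i \in W -> (#|W|.-1 * e <= dg i (T W e))%N.
Proof.
move=> e0 iW; rewrite dg_prod => [|x Wx]; last exact/pairF_neq0/(pairs_neq Wx).
pose A := [set x : 'I_N * 'I_N | pairs W x && ((i == x.1) || (i == x.2))].
apply: (@leq_trans (\sum_(x in A) e)).
  rewrite sum_nat_const leq_mul2r; apply/orP; right.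
  pose f (q : 'I_N) := if (q < i)%N then (q, i) else (i, q).
  have -> : #|W|.-1 = #|W :\ i| by rewrite (cardsD1 i W) iW.
  have fi : {in W :\ i &, injective f}.
    move=> x y; rewrite !inE /f => /andP[xi _] /andP[yi _].
    case: ifP => _; case: ifP => _ [] //.
    - by move=> _ e1; rewrite -e1 eqxx in yi.
    - by move=> e1 _; rewrite e1 eqxx in yi.
  rewrite -(card_in_imset fi); apply/subset_leq_card/subsetP => _ /imsetP [q + ->].
  rewrite !inE /f /pairs => /andP[qi qW].
  case: ltnP => [lt|le] /=; rewrite ?qW ?iW ?eqxx ?orbT ?lt //=.
  by rewrite ltn_neqAle le eq_sym qi.
rewrite [leqRHS](bigID (mem A)) /=.
apply: leq_trans (leq_addr _ _).
rewrite [leqLHS](eq_bigl (fun x => pairs W x && (x \in A))); last first.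
  by move=> x; rewrite inE andbA andbb.
apply: leq_sum => x /andP[Wx xA].
rewrite dg_prod => [|w _]; last by case: (prime_lin_form w (pairs_neq Wx)).
rewrite -{1}(size_rts K e0) -sum1_size !big_seq; apply: leq_sum => w we.
have := lc_lin_unit (N := N) (pairs_neq Wx) (rts_neq0 e0 we).
by move: xA; rewrite inE => /andP[_ h] /(_ _ h) [_ ->].
Qed.

Lemma T_dvd W d (f : R) : (0 < d)%N ->
  (forall p q w, pairs W (p, q) -> w \in rts K d -> dvdr (lin p q w) f) ->
  dvdr (T W d) f.
Proof.
move=> d0 hf.
pose s := [seq (x, w) | x <- [seq x <- index_enum _ | pairs W x], w <- rts K d].
have -> : T W d = \prod_(y <- s) lin y.1.1 y.1.2 y.2.
  rewrite /s big_allpairs_dep big_filter; apply: eq_bigr => x _ /=.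
  by rewrite /pairF; apply: eq_bigl.
have sP y : y \in s -> pairs W y.1 /\ y.2 \in rts K d.
  by case/allpairsP => z [] ; rewrite mem_filter => /andP[h _] h2 ->.
apply: dvd_prod_primes.
- rewrite allpairs_uniq //; first by rewrite filter_uniq // index_enum_uniq.
    exact: uniq_rts.
  by move=> [x w] [y v].
- by move=> y /sP [h _]; apply/prime_lin_form/(pairs_neq h).
- move=> [[p q] w] [[p' q'] w'] /sP [/= h we] /sP [/= h' we'] ne.
  have [_ _ pq] := and3P h; have [_ _ pq'] := and3P h'.
  exact: (lin_ndvd_lin pq pq' (rts_neq0 d0 we) (rts_neq0 d0 we')).
- by move=> [[p q] w] /sP [/= h we]; apply: hf.
Qed.

(** The factor 1 - w^b in [twist_S] vanishes when w^d = 1, because d divides the last difference b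
    as well. *)
Lemma T_dvd_S W d n : (0 < d)%N -> #|W| = (size n).+1 -> all (dvdn d) n ->
  dvdr (T W d) (S W n).
Proof.
move=> d0 cW dn; apply: T_dvd => // p q w h we.
have npq := pairs_neq h; have [/= pW qW _] := and3P h.
apply/(dvd_lin_form _ _ npq).
case/lastP: n cW dn => [cW _|n b]; last first.
  rewrite size_rcons all_rcons => cW /andP[db dn].
  have wd : w ^+ d = 1 by apply/eqP; rewrite -mem_rts.
  rewrite (@twist_S K N W n b d w p q) //.
  by case/dvdnP: db => m ->; rewrite mulnC exprM wd expr1n subrr mpolyC0 mul0r.
have := card_le1_eqP (eq_leq cW) p q pW qW => e.
by rewrite e eqxx in npq.
Qed.

Lemma all_nseqP (P : pred nat) m d : P d -> all P (nseq m d).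
Proof. by move=> h; rewrite all_nseq h orbT. Qed.

(** The Vandermonde determinant in the x_i^d. The forms divide it; comparing degrees in x_i gives a
    quotient free of x_i, and comparing leading coefficients, by induction, makes it a unit. Hence
    S(d rho) can be replaced by [T] everywhere. *)
Lemma S_nseq W m d : (0 < d)%N -> #|W| = m.+1 -> assoc (S W (nseq m d)) (T W d).
Proof.
move=> d0; elim: m W => [|m IH] W cW.
  have := T_dvd_S d0 (n := [::]) cW isT => h.
  have [u uu eS] := S_nil K cW.
  have Su : S W [::] \is a GRing.unit by rewrite eS mulr1.
  have Tu := dvd_unit h Su.
  exists (S W [::] / T W d); first by rewrite unitrM Su unitrV.
  by rewrite divrK.
have cW' : #|W| = (size (nseq m.+1 d)).+1 by rewrite size_nseq.
have [Q eQ] := T_dvd_S d0 cW' (all_nseqP m.+1 (dvdnn d)).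
have [i iW] : exists i, i \in W by apply/card_gt0P; rewrite cW.
have pos : all (ltn 0) (d :: nseq m d) by apply: (all_nseqP m.+1).
have S0 : S W (nseq m.+1 d) != 0 by apply: S_neq0.
have [Q0 T0] : Q != 0 /\ T W d != 0.
  by apply/andP; rewrite -negb_or -mulf_eq0 -eQ.
have dS := dg_S K cW' iW pos; rewrite eQ dgM // in dS.
have dT := dg_T_ge d0 iW; rewrite cW /= in dT.
have ds : sumn (d :: nseq m d) = (m.+1 * d)%N by rewrite /= sumn_nseq mulSn mulnC.
have Q0' : dg i Q = 0%N.
  by apply/eqP; move/eqP: dS; rewrite ds => /eqP dS; rewrite -leqn0 -(leq_add2r (m.+1 * d)) add0n -{2}dS leq_add2l.
have cWi : #|W :\ i| = m.+1 by apply: cardsD1_S.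
have lS : assoc (lc i (S W (d :: nseq m d))) (T (W :\ i) d).
  apply: assoc_trans (IH _ cWi); apply: lc_S => //.
rewrite -[d :: _]/(nseq m.+1 d) eQ lcM in lS.
have lQ : lc i Q \is a GRing.unit.
  have lT := @lc_L K N W d predT i d0 iW.
  have := assoc_trans (assoc_mull (lc i Q) (assoc_sym lT)) lS.
  rewrite mulrC => h.
  have h2 : assoc (T (W :\ i) d * lc i Q) (T (W :\ i) d * 1) by rewrite mulr1.
  by have := assoc_cancel (L_neq0 _ _ _) h2 => /assoc_unit ->; apply: unitr1.
rewrite eQ; apply: assoc_unitl.
exact: unit_dg_lc lQ Q0'.
Qed.

(* The quotient of [linforms W e] by [linforms W d] when [d] divides [e]. *)
Definition lincompl W e d : R := L W e (fun w => w ^+ d != 1).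

Lemma T_split W e d : (0 < e)%N -> (d %| e)%N -> T W e = T W d * lincompl W e d.
Proof.
move=> e0 de; have d0 := dvdn_gt0 e0 de.
rewrite /linforms /lincompl /linprod -big_split; apply: eq_bigr => x _.
rewrite /pairF (bigID (fun w => w ^+ d == 1)) /=; congr (_ * _).
rewrite -[LHS]big_filter; apply: perm_big; apply: uniq_perm.
- by rewrite filter_uniq // uniq_rts.
- exact: uniq_rts.
move=> w; rewrite mem_filter -mem_rts //.
by apply/andP/idP => [[]//|h]; split=> //; apply: rts_sub h.
Qed.

Lemma free_L W e a i : i \notin W -> freeof i (L W e a).
Proof.
move=> iW; have ne x : x \in W -> x != i by apply: contraTneq => ->.
apply: free_prod => x /and3P[/ne x1 /ne x2 _].
apply: free_prod => w _; apply: freeD; first exact: freeX.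
by apply/freeN/freeM; [apply: freeC|apply: freeX].
Qed.

(** Isolates the part of the denominator that involves x_i. One divisibility is checked form by
    form; degree and leading coefficient in x_i show that the quotient is a unit. *)
Lemma T_split_at W d i : (0 < d)%N -> i \in W ->
  assoc (T W d) (T (W :\ i) d * \prod_(j in W :\ i) ('X_i ^+ d - 'X_j ^+ d)).
Proof.
move=> d0 iW; set P := \prod_(j in _) _.
have Pij j : j \in W :\ i -> j != i by case/setD1P.
have uP j : j \in W :\ i ->
    upoly i ('X_i ^+ d - 'X_j ^+ d) = 'X^d - ('X_j ^+ d)%:P :> {poly R}.
  by move/Pij => ji; rewrite rmorphB !rmorphXn /= upolyX upolyXn // polyC_exp.
have lcP : lc i P = 1.
  by rewrite lc_prod big1 // => j jW; rewrite /lc uP // lead_coefXnsubC.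
have P0 : P != 0 by rewrite -(lc_eq0 i) lcP oner_neq0.
have dgP : dg i P = (#|W|.-1 * d)%N.
  rewrite dg_prod => [|j jW]; last first.
    by rewrite -(lc_eq0 i) /lc uP // lead_coefXnsubC // oner_neq0.
  rewrite (eq_bigr (fun=> d)) => [|j jW]; last by rewrite /dg uP // size_XnsubC.
  by rewrite sum_nat_const (cardsD1 i W) iW.
have fT : freeof i (T (W :\ i) d) by apply: free_L; rewrite !inE eqxx.
have T0 : T (W :\ i) d != 0 by apply: L_neq0.
have [Q eQ] : dvdr (T W d) (T (W :\ i) d * P).
  apply: T_dvd => // p q w Wpq we.
  have wd : w ^+ d = 1 by apply/eqP; rewrite -mem_rts.
  have npq : p != q := pairs_neq Wpq; have [/= pW qW pq] := and3P Wpq.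
  have [ep|pi] := eqVneq p i.
    apply/dvd_mull/(dvd_trans (q := 'X_i ^+ d - 'X_q ^+ d)).
      apply/(dvd_lin_form _ _ npq); rewrite ep substB !subst_exp substX substXn.
        by rewrite exprMn -rmorphXn /= wd mpolyC1 mul1r subrr.
      by rewrite -ep eq_sym.
    by rewrite /P (bigD1 q) //=; [apply/dvd_mulr/dvd_refl|rewrite !inE qW -ep eq_sym npq].
  have [eq|qi] := eqVneq q i.
    apply/dvd_mull/(dvd_trans (q := 'X_i ^+ d - 'X_p ^+ d)).
      apply/(dvd_lin_form _ _ npq); rewrite eq substB !subst_exp substX substXn.
        by rewrite exprMn -rmorphXn /= wd mpolyC1 mul1r subrr.
      by rewrite eq_sym.
    by rewrite /P (bigD1 p) //=; [apply/dvd_mulr/dvd_refl|rewrite !inE pW pi].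
  apply/dvd_mulr/L_dvd_lin => //; rewrite /pairs /= !inE pi qi pW qW.
  exact: pq.
have TW0 : T W d != 0 by apply: L_neq0.
have Q0 : Q != 0.
  by apply: contraNneq (mulf_neq0 T0 P0) => q0; rewrite eQ q0 mul0r.
have lQ : lc i Q \is a GRing.unit.
  have h : assoc (T (W :\ i) d * lc i Q) (T (W :\ i) d * 1).
    rewrite mulr1; apply: (assoc_trans (q := lc i (T W d) * lc i Q)).
      by apply/assoc_mulr/assoc_sym; apply: lc_L.
    by apply: assoc_eq; rewrite mulrC -lcM -eQ lcM lcP mulr1 lc_free.
  by rewrite (assoc_unit (assoc_cancel T0 h)) unitr1.
have dQ : dg i Q = 0%N.
  have h := dgM i T0 P0; have h2 := dgM i Q0 TW0.
  rewrite -eQ h dgP (dg_free fT) add0n in h2.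
  apply/eqP; rewrite -leqn0 -(leq_add2r (#|W|.-1 * d)) add0n {2}h2 leq_add2l.
  exact: dg_T_ge.
by rewrite eQ; apply/assoc_sym/assoc_unitl/(unit_dg_lc lQ).
Qed.

Lemma T_neq0 W e : T W e != 0. Proof. exact: L_neq0. Qed.
Lemma Lq_neq0 W e d : lincompl W e d != 0. Proof. exact: L_neq0. Qed.

Lemma dg_T W e i : (0 < e)%N -> i \in W -> dg i (T W e) = (#|W|.-1 * e)%N.
Proof.
move=> e0 iW; have cW : #|W| = #|W|.-1.+1.
  by rewrite prednK //; apply/card_gt0P; exists i.
rewrite -(dg_assoc i (S_nseq e0 cW)) dg_S ?size_nseq ?sumn_nseq 1?mulnC //.
exact: all_nseqP.
Qed.

Lemma dg_Lq W e d i : (0 < e)%N -> (d %| e)%N -> i \in W ->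
  dg i (lincompl W e d) = (#|W|.-1 * (e - d))%N.
Proof.
move=> e0 de iW; have := dg_T e0 iW; rewrite (T_split _ e0 de) dgM ?T_neq0 ?Lq_neq0 //.
have d0 := dvdn_gt0 e0 de.
by rewrite dg_T // mulnBr => <-; rewrite addKn.
Qed.

Lemma nseqSr m (d : nat) : nseq m.+1 d = rcons (nseq m d) d.
Proof. by elim: m => //= m <-. Qed.

Lemma z_T W e i : (0 < e)%N -> i \in W -> (1 < #|W|)%N ->
  assoc (subst i 0 (T W e)) (mono (W :\ i) ^+ e * T (W :\ i) e).
Proof.
move=> e0 iW cW; have [k cW2] : exists k, #|W| = k.+2.
  by exists #|W|.-2; move: cW; case: #|W| => [|[]].
have cWi : #|W :\ i| = k.+1 by apply: cardsD1_S.
apply: (assoc_trans (subst_assoc i 0 (assoc_sym (S_nseq e0 cW2)))).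
apply: (assoc_trans _ (assoc_mull _ (S_nseq e0 cWi))).
by rewrite nseqSr; apply: z_S; rewrite ?size_nseq //; apply: all_nseqP.
Qed.

Lemma z_Lq W e d i : (0 < e)%N -> (d %| e)%N -> i \in W -> (1 < #|W|)%N ->
  assoc (subst i 0 (lincompl W e d)) (mono (W :\ i) ^+ (e - d) * lincompl (W :\ i) e d).
Proof.
move=> e0 de iW cW; have d0 := dvdn_gt0 e0 de.
have hd := z_T d0 iW cW; have he := z_T e0 iW cW.
rewrite (T_split _ e0 de) substM (T_split _ e0 de) in he.
apply: (@assoc_cancel _ (mono (W :\ i) ^+ d * T (W :\ i) d)).
  by rewrite mulf_neq0 ?T_neq0 ?mono_neq0.
apply: (assoc_trans (assoc_mulr _ (assoc_sym hd))); apply: (assoc_trans he).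
apply: assoc_eq; rewrite -{1}(subnKC (dvdn_leq e0 de)) exprD -!mulrA.
by congr (_ * _); rewrite mulrCA.
Qed.

(** * Quotients by the forms of order d and their facets *)

Section QuotientFacets.
Variables (V : {set 'I_N}) (d : nat) (C : R).
Hypothesis d0 : (0 < d)%N.

(** The parameter d is kept apart from n, since a facet is divided both by the forms for the d
    inherited from C and by those for its own gcd. *)
Definition is_quot V n d (C : R) := assoc (S V n) (T V d * C).

Lemma lc_quot (m : nat) n i : is_quot V (m :: n) d C -> #|V| = (size n).+2 ->
  all (ltn 0) (m :: n) -> i \in V -> is_quot (V :\ i) n d (lc i C).
Proof.
move=> hC cV pn iV; have := lc_assoc i hC; rewrite lcM => h.
apply: (assoc_trans (assoc_sym (lc_S K cV iV pn))).
by apply: (assoc_trans h); apply/assoc_mulr/lc_L.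
Qed.

Lemma quot_neq0 n : is_quot V n d C -> #|V| = (size n).+1 -> all (ltn 0) n ->
  C != 0.
Proof.
move=> hC cV pn; have := assoc_neq0 hC; rewrite S_neq0 // => /esym.
by rewrite mulf_eq0 negb_or => /andP[].
Qed.

Lemma dg_quot n i : is_quot V n d C -> #|V| = (size n).+1 ->
  all (ltn 0) n -> i \in V -> (dg i C + size n * d)%N = sumn n.
Proof.
move=> hC cV pn iV; have := dg_assoc i hC.
rewrite dg_S // dgM ?T_neq0 ?(quot_neq0 hC) // dg_T // cV => ->.
by rewrite addnC.
Qed.

Lemma z_quot n b i : is_quot V (rcons n b) d C -> #|V| = (size n).+2 ->
  all (ltn 0) n -> (0 < b)%N -> (d <= b)%N -> i \in V ->
  assoc (mono (V :\ i) ^+ (b - d) * S (V :\ i) n) (T (V :\ i) d * subst i 0 C).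
Proof.
move=> hC cV pn b0 db iV; have := subst_assoc i 0 hC; rewrite substM => h.
apply: (@assoc_cancel _ (mono (V :\ i) ^+ d)); first exact: mono_neq0.
rewrite mulrA -exprD subnKC //.
apply: (assoc_trans (assoc_sym (z_S K cV iV pn b0))).
apply: (assoc_trans h); rewrite mulrA; apply: assoc_mulr.
by apply: z_T; rewrite ?cV.
Qed.

End QuotientFacets.

Lemma ex_quot V n d : (0 < d)%N -> #|V| = (size n).+1 -> all (dvdn d) n ->
  exists C, is_quot V n d C.
Proof.
move=> d0 cV dn; have [Q e] := T_dvd_S d0 cV dn.
by exists Q; apply: assoc_eq; rewrite e mulrC.
Qed.

End Quotients.

(** * Factors whose facets are small *)

Lemma irr_intro (D : comUnitRingType) (p : D) : p \isn't a GRing.unit ->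
  (forall a b, p = a * b -> a \is a GRing.unit \/ b \is a GRing.unit) ->
  irreducible_elt p.
Proof.
by move=> pu h; split=> // -[a [b [au bu /h]]]; rewrite (negbTE au) (negbTE bu) => -[].
Qed.

Lemma pick_out (I : finType) (V : {set I}) (s : seq I) :
  (size s < #|V|)%N -> exists2 x, x \in V & x \notin s.
Proof.
move=> h; apply/subsetPn; apply: contraL h => /subset_leq_card h.
by rewrite -leqNgt (leq_trans h) ?card_size.
Qed.

Lemma eq_nseq_leq c n : all (leq c) n -> (sumn n <= size n * c)%N ->
  n = nseq (size n) c.
Proof.
move=> ge; have le s : all (leq c) s -> (size s * c <= sumn s)%N.
  elim: s => //= y s IH /andP[cy cs].
  by rewrite mulSn leq_add ?IH.
elim: n ge => //= x n IH /andP[cx cn]; rewrite mulSn => h.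
have ln := le n cn.
have [ex le'] : x = c /\ (sumn n <= size n * c)%N by move: cx h ln; clear; lia.
by rewrite ex -IH.
Qed.

Lemma eq_nseq_sum d n : all (ltn 0) n -> all (dvdn d) n ->
  sumn n = (size n * d)%N -> n = nseq (size n) d.
Proof.
move=> pn dn e; apply: eq_nseq_leq; last by rewrite e.
by apply/allP => x xn; apply: dvdn_leq; [exact: (allP pn)|exact: (allP dn)].
Qed.

Section SmallFactors.
Variables (K : closedFieldType) (N : nat).
Hypothesis K0 : forall m, (m.+1)%:R != 0 :> K.
Local Notation R := {mpoly K[N]}.
Local Notation T := (@linforms K N).
Local Notation Lq := (@lincompl K N).
Local Notation S := (@Sdiff K N).
Local Notation mono := (@varprod K N).
Local Notation z i := (subst i 0).
Implicit Types (V W : {set 'I_N}) (n : seq nat) (p q i j : 'I_N) (w : K).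
Implicit Types (f g h G H C : R).

Lemma pprod_Lq W e d : pprods (is_lin W e (fun w => w ^+ d != 1)) (Lq W e d).
Proof. exact: pprod_L. Qed.

Lemma dvd_assocr f g h : assoc g h -> dvdr f g -> dvdr f h.
Proof. by move=> /assoc_dvd gh /dvd_trans; apply. Qed.

Lemma subst_comm i p t f : i != p -> freeof i t ->
  z i (subst p t f) = subst p t (z i f).
Proof. by move=> ip ft; rewrite !subst0_coef upoly_subst 1?eq_sym // coef_map. Qed.

Lemma lc_z i j f : i != j -> z i (lc j f) != 0 ->
  lc j (z i f) = z i (lc j f) /\ dg j (z i f) = dg j f.
Proof.
by move=> ij h; rewrite subst_lc ?dg_subst //; apply: free0.
Qed.

Lemma lc_z_unit i j f : i != j -> lc j f \is a GRing.unit ->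
  lc j (z i f) \is a GRing.unit /\ dg j (z i f) = dg j f.
Proof.
move=> ij u; have u' := subst_unit i 0 u.
have u0 : z i (lc j f) != 0 by apply: contraTneq u' => ->; rewrite unitr0.
by have [-> ->] := lc_z ij u0.
Qed.

Lemma X_ndvd_unit p f : f \is a GRing.unit -> ~ dvdr 'X_p f.
Proof.
by move=> fu /dvd_unit /(_ fu); apply/negP; case: (prime_var K p).
Qed.

Lemma lin_ndvd_unit p q w f : p != q -> f \is a GRing.unit -> ~ dvdr (lin p q w) f.
Proof.
by move=> pq fu /dvd_unit /(_ fu); apply/negP; case: (prime_lin_form w pq).
Qed.

(** A variable x_p dividing z i f would divide its leading coefficient in a third variable x_j,
    which is a unit. So z i f is a unit; its degree in x_j is that of f, and f equals its leading
    coefficient. *)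
Lemma unit_of_facets V i k f : (2 < #|V|)%N -> i \in V ->
  (forall j, j \in V -> lc j f \is a GRing.unit) ->
  dvdr (z i f) (mono (V :\ i) ^+ k) -> f \is a GRing.unit.
Proof.
move=> cV iV lu zf.
have zu : z i f \is a GRing.unit.
  apply: (dvd_unit (q := 1)); last exact: unitr1.
  apply: (pprod_strip (pprod_mono K (V :\ i) k)); last by rewrite mulr1.
  move=> _ [p + ->] => /setD1P [pi pV] h.
  have [j jV] := @pick_out _ V [:: i; p] cV.
  rewrite !inE negb_or => /andP[ji jp].
  have := lc_dvd j h; rewrite lc_free; last by apply: freeX; rewrite eq_sym.
  by apply: X_ndvd_unit; apply: (lc_z_unit _ (lu j jV)).1; rewrite eq_sym.
have [j jV] := @pick_out _ V [:: i] (ltnW cV).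
rewrite inE => ji; apply: (unit_dg_lc (lu j jV)).
have ij : i != j by rewrite eq_sym.
by have [_ <-] := lc_z_unit ij (lu j jV); apply: dg_unit.
Qed.

Lemma lin_ndvd_lc_mono W k p q w j : p != q -> w != 0 ->
  ~ dvdr (lin p q w) (lc j (mono W ^+ k)).
Proof.
move=> pq w0; have pr := prime_lin_form w pq; have [_ pu pp] := pr.
rewrite lcX lc_prod; elim: k => [|k IH]; first exact: lin_ndvd_unit (unitr1 _).
rewrite exprS => /pp [|//] /(prime_dvd_prod pr) [i [_ _]].
have [->|ij] := eqVneq i j; last by rewrite lc_free; [apply: lin_ndvd_X|apply: freeX].
by rewrite /lc upolyX lead_coefX; apply: lin_ndvd_unit => //; apply: unitr1.
Qed.

(* A linear form dividing both kinds of facets has w^e = w^e' = 1, hence w^d = 1. *)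
Lemma small_unit V e e' d k f : (3 < #|V|)%N -> (0 < e)%N -> (0 < e')%N ->
  (d %| e)%N -> (d %| e')%N -> gcdn e e' = d ->
  (forall i j, i \in V -> j \in V -> i != j -> z i (lc j f) != 0) ->
  (forall i, i \in V -> dvdr (z i f) (mono (V :\ i) ^+ k * Lq (V :\ i) e d)) ->
  (forall j, j \in V -> dvdr (lc j f) (Lq (V :\ j) e' d)) ->
  f \is a GRing.unit.
Proof.
move=> cV e0 e0' de de' gd nz sz sl.
have w1 w : w \in rts K e -> w \in rts K e' -> w ^+ d = 1.
  rewrite !mem_rts // => /eqP we /eqP we'.
  by rewrite -gd; apply: unity_gcd.
have lu j : j \in V -> lc j f \is a GRing.unit.
  move=> jV; apply: (dvd_unit (q := 1)); last exact: unitr1.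
  apply: (pprod_strip (pprod_Lq (V :\ j) e' d)); last first.
    by rewrite mulr1; apply: sl.
  move=> _ [p [q [w [Wpq we' wd ->]]]] h.
  have [/setD1P [/= pj pV] /setD1P [/= qj qV] pq] := and3P Wpq.
  have npq := pairs_neq Wpq; have w0 := rts_neq0 e0' we'.
  (* Here four variables are needed: setting x_i to 0 must leave the form unchanged. *)
  have [i iV] := @pick_out _ V [:: j; p; q] cV.
  rewrite !inE !negb_or => /and3P[ij ip iq].
  have zl : z i (lin p q w) = lin p q w.
    by rewrite /lin substB substM substC !substXn // eq_sym.
  have := subst_dvd i 0 h; rewrite zl.
  have [<- _] := lc_z ij (nz i j iV jV ij).
  move/dvd_trans => /(_ _ (lc_dvd j (sz i iV))); rewrite lcM.
  have [_ _ pp] := prime_lin_form w npq.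
  case/pp; first exact: lin_ndvd_lc_mono.
  have jVi : j \in V :\ i by rewrite !inE jV eq_sym ij.
  move/(dvd_assocr (lc_L _ e0 jVi)).
  case/(lin_dvd_L e0 pq w0) => _ _ we _.
  by rewrite (w1 w) ?eqxx in wd.
have [i iV] : exists i, i \in V by apply/card_gt0P; case: #|V| cV.
apply: (unit_of_facets (ltnW cV) iV lu (k := k)).
apply: (pprod_strip (pprod_Lq (V :\ i) e d)); last first.
  by rewrite mulrC; apply: sz.
move=> _ [p [q [w [Wpq we wd ->]]]] h.
have [/setD1P [/= pi pV] /setD1P [/= qi qV] pq] := and3P Wpq.
have [j jV] := @pick_out _ V [:: i; p; q] cV.
rewrite !inE !negb_or => /and3P[ji jp jq].
have := lc_dvd j h; rewrite lc_lin //.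
apply: lin_ndvd_unit; first exact: pairs_neq Wpq.
by apply: (lc_z_unit _ (lu j jV)).1; rewrite eq_sym.
Qed.

Lemma is_quot_nseq W m e : (0 < e)%N -> #|W| = m.+1 -> is_quot W (nseq m e) e (1 : R).
Proof. by move=> e0 cW; rewrite /is_quot mulr1; apply: S_nseq. Qed.

(** The forms for e are those for d together with [Lq], so dividing only by the forms for d leaves
    [Lq] behind. *)
Lemma quot_split W n e d C C' : (0 < e)%N -> (d %| e)%N ->
  is_quot W n e C' -> is_quot W n d C -> assoc C (Lq W e d * C').
Proof.
move=> e0 de h' h; apply: (@assoc_cancel _ (T W d)); first exact: T_neq0.
apply: (assoc_trans (assoc_sym h)); apply: (assoc_trans h').
by rewrite mulrA -T_split //; apply: assoc_refl.
Qed.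

Lemma z_quot2 V n b d e C C' i : (0 < d)%N -> is_quot V (rcons n b) d C ->
  #|V| = (size n).+2 -> all (ltn 0) n -> (0 < b)%N -> (d <= b)%N -> i \in V ->
  (0 < e)%N -> (d %| e)%N -> is_quot (V :\ i) n e C' ->
  assoc (z i C) (mono (V :\ i) ^+ (b - d) * (Lq (V :\ i) e d * C')).
Proof.
move=> d0 hC cV pn b0 db iV e0 de hC'; have h := z_quot K0 d0 hC cV pn b0 db iV.
apply: (@assoc_cancel _ (T (V :\ i) d)); first exact: T_neq0.
apply: (assoc_trans (assoc_sym h)); rewrite mulrCA; apply: assoc_mull.
by apply: (assoc_trans hC'); rewrite mulrA -T_split //; apply: assoc_refl.
Qed.

Lemma dvd_Xn i m f : (forall s, (s < m)%N -> (upoly i f)`_s = 0) -> dvdr ('X_i ^+ m) f.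
Proof.
move=> h; rewrite -[f](upolyK i) horner_coef.
elim/big_ind: _ => [||s _]; first exact: dvd0.
  by move=> x y [a ->] [b ->]; exists (a + b); rewrite mulrDl.
case: (ltnP s m) => [/h ->|ms]; first by rewrite mul0r; apply: dvd0.
by exists ((upoly i f)`_s * 'X_i ^+ (s - m)); rewrite -mulrA -exprD subnK.
Qed.

Lemma dvd_Xn_strip i m f g : ~ dvdr 'X_i f -> dvdr ('X_i ^+ m) (f * g) ->
  dvdr ('X_i ^+ m) g.
Proof.
move=> nf; elim: m g => [|m IH] g; first by move=> _; exact: dvd1.
have [p0 _ pp] := prime_var K i.
move=> h; have : dvdr 'X_i (f * g).
  by apply: dvd_trans h; rewrite exprS; apply/dvd_mulr/dvd_refl.
case/pp => // -[a e]; move: h; rewrite exprS e mulrA [f * a * _]mulrC.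
by move/(dvd_cancel p0) => /IH ha; rewrite mulrC; apply: dvd_mul => //; apply: dvd_refl.
Qed.

Lemma L_lin_simple W e (a : pred K) p q w : (0 < e)%N -> pairs W (p, q) -> w \in rts K e -> a w ->
  exists2 r, linprod W e a = lin p q w * r & ~ dvdr (lin p q w) r.
Proof.
move=> e0 Wpq we aw; have npq := pairs_neq Wpq; have pr := prime_lin_form w npq.
have [_ _ pp] := pr; have [_ _ pq] := and3P Wpq; have w0 := rts_neq0 e0 we.
rewrite /linprod (bigD1 (p, q)) //= {1}/pairF (perm_big _ (perm_to_rem we)) /= big_cons aw -mulrA.
eexists; first by [].
case/pp => /(prime_dvd_prod pr).
  move=> [v [+ _]]; rewrite mem_rem_uniq ?uniq_rts // => /andP[/= vw ve].
  apply: lin_ndvd_lin => //; first exact: rts_neq0 ve.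
  by apply: contraNneq vw => -[->].
move=> [x [_ /andP[Wx xn]]] /(prime_dvd_prod pr) [v [ve _]].
have [_ _ x12] := and3P Wx.
apply: lin_ndvd_lin => //; first exact: rts_neq0 ve.
by apply: contraNneq xn => -[-> -> _]; case: x {Wx x12}.
Qed.

(** The forms in [Lq] are pairwise not associated, so each is a simple factor; a form dividing both
    f and g would occur twice. *)
Lemma lin_not_both W e d k p q w f g : (0 < e)%N -> pairs W (p, q) -> w \in rts K e ->
  w ^+ d != 1 -> assoc (f * g) (mono W ^+ k * Lq W e d) ->
  dvdr (lin p q w) f -> ~ dvdr (lin p q w) g.
Proof.
move=> e0 Wpq we wd fg [a ea] [b eb].
have [r er nr] := @L_lin_simple W e (fun w => w ^+ d != 1) p q w e0 Wpq we wd.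
have npq := pairs_neq Wpq; have [l0 _ pp] := prime_lin_form w npq.
move: fg; rewrite /lincompl er ea eb mulrACA [a * b * _]mulrC -mulrA [mono _ ^+ k * _]mulrCA.
move=> /(assoc_cancel l0) h.
have : dvdr (lin p q w) (mono W ^+ k * r).
  by apply: dvd_assocr h _; apply/dvd_mulr/dvd_refl.
by case/pp => //; apply: lin_ndvd_mono => //; apply: rts_neq0 we.
Qed.

End SmallFactors.

Lemma is_quotE (K : closedFieldType) (N : nat) (V : {set 'I_N}) n d (C : {mpoly K[N]}) :
  is_quot V n d C <-> assoc (Sdiff K V n) (linforms K V d * C).
Proof. by []. Qed.

(* Unification otherwise unfolds these constants down to the representation of
   multivariate polynomials. *)
Opaque Sdiff alternant linprod linforms lincompl varprod is_quot lin subst upoly lc dg.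

(** * Three variables: an Eisenstein argument *)

Lemma assoc3_neq0 (D : idomainType) (a b c e : D) : assoc a (b * (c * e)) ->
  a != 0 -> [/\ b != 0, c != 0 & e != 0].
Proof. by move=> /assoc_neq0 ->; rewrite !mulf_eq0 !negb_or => /and3P[]. Qed.

Section Eisenstein.
Variables (K : closedFieldType) (N : nat).
Hypothesis K0 : forall m, (m.+1)%:R != 0 :> K.
Local Notation R := {mpoly K[N]}.
Local Notation T := (@linforms K N).
Local Notation Lq := (@lincompl K N).
Local Notation S := (@Sdiff K N).
Local Notation mono := (@varprod K N).
Local Notation z i := (subst i 0).
Variables (V : {set 'I_N}) (n1 n2 d : nat).
Hypotheses (cV : #|V| = 3) (d0 : (0 < d)%N) (d1 : (d %| n1)%N) (d2 : (d %| n2)%N).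
Hypotheses (p1 : (0 < n1)%N) (p2 : (0 < n2)%N) (gd : gcdn n1 n2 = d).
Implicit Types (p q i j : 'I_N) (w : K) (G H : R).

Lemma dg_assoc3 i (f g h k : R) : assoc f (g * (h * k)) -> f != 0 ->
  dg i f = (dg i g + (dg i h + dg i k))%N.
Proof.
move=> e f0; have [g0 h0 k0] := assoc3_neq0 e f0.
by rewrite (dg_assoc i e) !dgM ?mulf_neq0.
Qed.

Let pn : all (ltn 0) [:: n1; n2]. Proof. by rewrite /= p1 p2. Qed.

Let cVi i : i \in V -> #|V :\ i| = 2.
Proof. by move=> iV; apply: cardsD1_S. Qed.

Let w_gcd w : w \in rts K n1 -> w \in rts K n2 -> w ^+ d = 1.
Proof. by rewrite !mem_rts // -gd => /eqP ? /eqP ?; apply: unity_gcd. Qed.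

(** In the two remaining variables an alternant is a product of linear forms, so the facet has no
    further factor. *)
Lemma z_three G H i : is_quot V [:: n1; n2] d (G * H) -> i \in V ->
  assoc (z i G * z i H) (mono (V :\ i) ^+ (n2 - d) * Lq (V :\ i) n1 d).
Proof.
move=> hC iV; rewrite -substM -[Lq _ _ _]mulr1.
have h := @z_quot2 K N K0 V [:: n1] n2 d n1 (G * H) 1 i d0 hC.
apply: h => //; [by rewrite /= p1|exact: dvdn_leq|].
exact: (is_quot_nseq K0 (m := 1) p1 (cVi iV)).
Qed.

Lemma lc_three G H i : is_quot V [:: n1; n2] d (G * H) -> i \in V ->
  assoc (lc i G * lc i H) (Lq (V :\ i) n2 d).
Proof.
move=> hC iV; rewrite -lcM -[Lq _ _ _]mulr1.
apply: (quot_split K0 (n := [:: n2])) => //; last exact: lc_quot hC _ _ iV.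
exact: (is_quot_nseq K0 (m := 1) p2 (cVi iV)).
Qed.

Section Specialization.
Variables (i p q : 'I_N) (w : K) (G H : R).
Hypotheses (hC : is_quot V [:: n1; n2] d (G * H)) (iV : i \in V).
Hypotheses (pqV : pairs (V :\ i) (p, q)).
Let npq := pairs_neq pqV.
Let sg := subst p (w%:MP * 'X_q : R).
Let SV := S V [:: n1; n2].

Let ip : i != p.
Proof. by have [/setD1P [/= h _] _ _] := and3P pqV; rewrite eq_sym. Qed.
Let pi : p != i. Proof. by rewrite eq_sym. Qed.
Let iq : i != q.
Proof. by have [_ /setD1P [/= h _] _] := and3P pqV; rewrite eq_sym. Qed.
Let pq : (p < q)%N. Proof. by have [] := and3P pqV. Qed.
Let ft : freeof i (w%:MP * 'X_q : R).
Proof. by apply: freeM; [apply: freeC|apply: freeX; rewrite eq_sym]. Qed.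

Let zS : assoc (z i SV) (mono (V :\ i) ^+ n2 * T (V :\ i) n1).
Proof.
apply: assoc_trans (z_S K (n := [:: n1]) cV iV _ p2) _; first by rewrite /= p1.
by apply/assoc_mull/(S_nseq K0 (m := 1)) => //; apply: cVi.
Qed.

Let lcS : assoc (upoly i SV)`_(n1 + n2) (T (V :\ i) n2).
Proof.
have := @coef_S_top K N V n1 [:: n2] i cV iV pn; rewrite /= addn0 => /assoc_trans; apply.
by apply/(S_nseq K0 (m := 1)) => //; apply: cVi.
Qed.

Let zT : assoc (z i (T V d)) (mono (V :\ i) ^+ d * T (V :\ i) d).
Proof. by apply: z_T => //; rewrite cV. Qed.

Let sgS : assoc (sg SV) (sg (T V d) * (sg G * sg H)).
Proof. have := subst_assoc p (w%:MP * 'X_q) (proj1 (@is_quotE K N V _ d _) hC).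
by rewrite (substM _ _ (T V d)) (substM _ _ G). Qed.

Let coef_sg s : (upoly i (sg SV))`_s = sg (upoly i SV)`_s.
Proof. by rewrite /sg upoly_subst 1?eq_sym // coef_map. Qed.

Let sgz f : z i (sg f) = sg (z i f).
Proof. exact: (subst_comm f ip ft). Qed.

Let sgP f : dvdr (lin p q w) f <-> sg f = 0.
Proof. exact: dvd_lin_form. Qed.

Let lin_mono_T k e : (0 < e)%N -> w != 0 ->
  dvdr (lin p q w) (mono (V :\ i) ^+ k * T (V :\ i) e) -> w \in rts K e.
Proof.
move=> e0 w0; have [_ _ pp] := prime_lin_form w npq.
case/pp; first by move/lin_ndvd_mono => /(_ npq w0).
by case/(lin_dvd_L e0 pq w0).
Qed.

Let supp s : (upoly i SV)`_s != 0 -> [\/ s = n1 + n2, s = n2 | s = 0]%N.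
Proof.
case/(@coef_S_supp K N V [:: n1; n2] i cV iV) => -[|[|[|//]]] _ ->; rewrite /expo /= ?addn0;
  by [constructor 1|constructor 2|constructor 3].
Qed.

(* Modulo the linear form, S is divisible by x_i^n2, and only G can absorb this. *)
Lemma eis_min : w \in rts K n1 -> w ^+ d != 1 -> dvdr (lin p q w) (z i G) ->
  (n2 <= dg i G)%N.
Proof.
move=> w1 wd lG; have w0 := rts_neq0 p1 w1.
have wd' : w \notin rts K d by rewrite mem_rts.
have w2 : w \notin rts K n2 by apply: contra wd => /(w_gcd w1) ->.
have lH : ~ dvdr (lin p q w) (z i H).
  exact: (lin_not_both K0 p1 pqV w1 wd (z_three hC iV) lG).
have dS : dvdr ('X_i ^+ n2) (sg SV).
  apply: dvd_Xn => s sn; rewrite coef_sg.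
  have [->|/supp] := eqVneq ((upoly i SV)`_s) 0; first by rewrite /sg rmorph0.
  case=> [e|e|->]; [by move: sn; rewrite e ltnNge leq_addl|by move: sn; rewrite e ltnn|].
  rewrite -subst0_coef; apply/sgP; apply: (dvd_assocr (assoc_sym zS)).
  by apply/dvd_mull/L_dvd_lin.
have S0 : sg SV != 0.
  apply: contraNneq w2 => s0; apply: (@lin_mono_T 0 _ p2 w0).
  rewrite expr0 mul1r; apply: (dvd_assocr lcS); apply/sgP.
  by rewrite -coef_sg s0 rmorph0 coef0.
have := dvd_assocr sgS dS => /dvd_Xn_strip.
have nT : ~ dvdr 'X_i (sg (T V d)).
  move/dvd_var; rewrite sgz => /sgP /(dvd_assocr zT).
  by move/(lin_mono_T d0 w0); apply/negP.
move/(_ nT); rewrite mulrC => /dvd_Xn_strip.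
have nH : ~ dvdr 'X_i (sg H).
  by move/dvd_var; rewrite sgz => /sgP.
move/(_ nH) => dG; have [_ G0 _] := assoc3_neq0 sgS S0.
have := dg_dvd i dG G0; rewrite (dgX i n2 (X_neq0 K i)) dg_X muln1 => /leq_trans; apply.
exact: (dg_subst_le G pi ft).
Qed.

(* Modulo the linear form, the leading coefficient of S in x_i vanishes, so its
   degree drops to n2, while that of G is unchanged. *)
Lemma eis_max : w \in rts K n2 -> w ^+ d != 1 -> dvdr (lin p q w) (lc i H) ->
  (dg i G + 2 * d <= n2)%N.
Proof.
move=> w2 wd lH; have w0 := rts_neq0 p2 w2.
have wd' : w \notin rts K d by rewrite mem_rts.
have w1 : w \notin rts K n1 by apply: contra wd => /w_gcd ->.
have lG : ~ dvdr (lin p q w) (lc i G).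
  apply: (lin_not_both K0 p2 pqV w2 wd (k := 0) (f := lc i H)) lH.
  by rewrite expr0 mul1r mulrC; apply: lc_three.
have S0 : sg SV != 0.
  apply: contraNneq w1 => s0; apply: (lin_mono_T p1 w0).
  apply: (dvd_assocr zS); apply/sgP.
  by rewrite -sgz s0 rmorph0.
have dG : dg i (sg G) = dg i G.
  by apply: (dg_subst pi ft); apply/eqP => /sgP.
have iVT : dg i (sg (T V d)) = (2 * d)%N.
  have -> : dg i (sg (T V d)) = dg i (T V d).
    apply: (dg_subst pi ft); apply/eqP => /sgP /(dvd_assocr (lc_L _ d0 iV)).
    by case/(lin_dvd_L d0 pq w0) => _ _ /(negP wd').
  by rewrite dg_T ?cV.
have dS : (dg i (sg SV) <= n2)%N.
  apply: dg_le => s sn; rewrite coef_sg.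
  have [->|/supp] := eqVneq ((upoly i SV)`_s) 0; first by rewrite /sg rmorph0.
  case=> [->|e|e]; [|by move: sn; rewrite e ltnn|by move: sn; rewrite e].
  by apply/sgP; apply: (dvd_assocr (assoc_sym lcS)); apply: L_dvd_lin.
have ar a b c : (a + b <= b + (a + c))%N by rewrite addnA [(b + a)%N]addnC leq_addr.
apply: leq_trans dS; have h := dg_assoc3 i sgS S0.
rewrite h -iVT -dG; exact: ar.
Qed.

End Specialization.

Hypotheses (lt1 : (d < n1)%N) (le12 : (n1 <= n2)%N).

Let ex_pair i : i \in V -> exists p q, pairs (V :\ i) (p, q).
Proof.
move=> iV; have /eqP/cards2P [p [q [pq e]]] := cVi iV.
case: (ltngtP p q) => h; last by case/eqP: pq; apply: val_inj.
  by exists p, q; rewrite /pairs e !inE !eqxx orbT.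
by exists q, p; rewrite /pairs e !inE !eqxx orbT.
Qed.

Let dC G H i : is_quot V [:: n1; n2] d (G * H) -> i \in V ->
  (dg i G + dg i H + 2 * d = n1 + n2)%N.
Proof.
move=> hC iV; have := dg_quot K0 d0 hC cV pn iV.
have := quot_neq0 hC cV pn; rewrite mulf_eq0 negb_or => /andP[G0 H0].
by rewrite dgM //= addn0.
Qed.

Let z_lc_neq0 G H i j : is_quot V [:: n1; n2] d (G * H) -> i \in V -> j \in V ->
  i != j -> z i (lc j H) != 0.
Proof.
move=> hC iV jV ij; have h := subst_assoc i 0 (lc_three hC jV).
have iVj : i \in V :\ j by rewrite !inE ij.
have c1 : (1 < #|V :\ j|)%N by rewrite cVi.
have h2 := assoc_trans h (z_Lq K0 p2 d2 iVj c1).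
have n0 := mulf_neq0 (mono_neq0 K (V :\ j :\ i) (n2 - d)) (Lq_neq0 K (V :\ j :\ i) n2 d).
rewrite -(assoc_neq0 h2) in n0; apply: dvd_neq0 n0.
exact/subst_dvd/dvd_mull/dvd_refl.
Qed.

(** The degrees of G and H in x_i add up to n1 + n2 - 2d and n1 <= n2, so H has degree less than n2.
    By [eis_min] no form divides z i H, and only variables are left. *)
Lemma three_side G H i : is_quot V [:: n1; n2] d (G * H) -> i \in V ->
  (n2 <= dg i G)%N -> dvdr (z i H) (mono (V :\ i) ^+ (n2 - d)).
Proof.
move=> hC iV dG.
have hC' : is_quot V [:: n1; n2] d (H * G) by rewrite mulrC.
have h := assoc_dvd (z_three hC' iV).
apply: (pprod_strip (pprod_Lq K (V :\ i) n1 d)); last first.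
  rewrite mulrC; apply: dvd_trans (assoc_dvd (z_three hC iV)).
  exact/dvd_mull/dvd_refl.
move=> _ [p [q [w [Wpq we wd ->]]]] lH.
have := eis_min hC' iV Wpq we wd lH.
by have := dC hC iV; lia.
Qed.

(** As d < n1, there is a form with w^n1 = 1 and w^d <> 1 in the facet; [eis_min] applies to the
    factor that it divides. *)
Lemma three_dichotomy G H i : is_quot V [:: n1; n2] d (G * H) -> i \in V ->
  (n2 <= dg i G)%N \/ (n2 <= dg i H)%N.
Proof.
move=> hC iV; have [p [q Wpq]] := ex_pair iV.
have [|w w1 wd] := exists_rts K0 (b := d) p1.
  by apply/negP => /(dvdn_leq d0); rewrite leqNgt lt1.
have [_ _ pp] := prime_lin_form w (pairs_neq Wpq).
have hC' : is_quot V [:: n1; n2] d (H * G) by rewrite mulrC.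
case: (pp (z i G) (z i H)).
- apply: dvd_assocr (assoc_sym (z_three hC iV)) _.
  by apply/dvd_mull; apply: L_dvd_lin.
- by move/(eis_min hC iV Wpq w1 wd); left.
- by move/(eis_min hC' iV Wpq w1 wd); right.
Qed.

(** The bound of [eis_max] contradicts dg j G >= n2, so no form divides lc j H, which is therefore a
    unit. *)
Lemma three_unit G H : is_quot V [:: n1; n2] d (G * H) ->
  (forall i, i \in V -> (n2 <= dg i G)%N) -> H \is a GRing.unit.
Proof.
move=> hC dG.
have [i iV] : exists i, i \in V by apply/card_gt0P; rewrite cV.
apply: (unit_of_facets (i := i) _ iV _ (three_side hC iV (dG i iV))); first by rewrite cV.
move=> j jV; apply: (dvd_unit (q := 1)); last exact: unitr1.
apply: (pprod_strip (pprod_Lq K (V :\ j) n2 d)); last first.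
  rewrite mulr1; apply: dvd_trans (assoc_dvd (lc_three hC jV)).
  exact/dvd_mull/dvd_refl.
move=> _ [p [q [w [Wpq we wd ->]]]] lH.
have := eis_max hC jV Wpq we wd lH.
by have := dC hC jV; have := dG j jV; lia.
Qed.

Theorem three_irr (C : R) : is_quot V [:: n1; n2] d C -> irreducible_elt C.
Proof.
move=> hC; have [i iV] : exists i, i \in V by apply/card_gt0P; rewrite cV.
apply: irr_intro => [|G H e].
  apply/negP => Cu; have hC' : is_quot V [:: n1; n2] d (C * 1) by rewrite mulr1.
  have := dC hC' iV; rewrite (dg_unit i Cu) (dg_free (free1 K i)) => h; move: lt1 le12 h; clear; lia.
rewrite e in hC.
have hC' : is_quot V [:: n1; n2] d (H * G) by rewrite mulrC.
(* The factor of large degree is the same in all variables: z j B keeps the degree of B in x_k, but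
   divides a monomial of degree n2 - d in x_k. *)
have mix (A B : R) j k : is_quot V [:: n1; n2] d (A * B) -> j \in V -> k \in V -> j != k ->
    (n2 <= dg j A)%N -> (n2 <= dg k B)%N -> False.
  move=> hAB jV kV jk dA dB; have := three_side hAB jV dA.
  move/(dg_dvd k) => /(_ (mono_neq0 K _ _)).
  have [_ ->] := lc_z jk (z_lc_neq0 hAB jV kV jk).
  have kVj : k \in V :\ j by rewrite !inE eq_sym jk.
  have m0 : mono (V :\ j) != 0 by rewrite -[mono _]expr1 mono_neq0.
  rewrite (dgX k _ m0).
  rewrite (dg_mono K kVj) => h; move: d0 lt1 le12 dB h; clear; lia.
case: (three_dichotomy hC iV) => di; [right|left].
- apply: (three_unit hC) => j jV; have [<-|ij] := eqVneq i j; first exact: di.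
  case: (three_dichotomy hC jV) => dj; first exact: dj.
  by case: (mix _ _ _ _ hC iV jV ij di dj).
- apply: (three_unit hC') => j jV; have [<-|ij] := eqVneq i j; first exact: di.
  case: (three_dichotomy hC' jV) => dj; first exact: dj.
  by case: (mix _ _ _ _ hC' iV jV ij di dj).
Qed.

End Eisenstein.

(** * A resultant in three variables *)

Section Bezout.
Variables (K : closedFieldType) (N : nat).
Local Notation R := {mpoly K[N]}.
Implicit Types (f g : R) (v : 'I_N -> K) (i x y z : 'I_N).

(** The restriction of f to the line through v parallel to the x_i-axis. *)
Definition line v i f : {poly K} := map_poly (meval v) (upoly i f).

Lemma lineM v i f g : line v i (f * g) = line v i f * line v i g.
Proof. by rewrite /line !rmorphM. Qed.

Lemma line_root v i f : (line v i f).[v i] = f.@[v].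
Proof.
have -> : v i = ('X_i).@[v] by rewrite mevalXU.
by rewrite /line horner_map /= upolyK.
Qed.

Lemma meval_unit v f : f \is a GRing.unit -> f.@[v] != 0.
Proof. by move=> fu; rewrite -unitfE; apply: rmorph_unit. Qed.

Lemma size_line v i f : lc i f \is a GRing.unit ->
  size (line v i f) = size (upoly i f).
Proof. by move/(meval_unit v) => h; rewrite /line size_map_poly_id0 // -lcE. Qed.

Lemma line_ext v v' x f : (forall j, j != x -> v j = v' j) ->
  line v x f = line v' x f.
Proof.
move=> vv; apply: (mpoly_hom_ext (f := map_poly (meval v) \o upoly x)
                                 (g := map_poly (meval v') \o upoly x)) => [c|j] /=.
  by rewrite upolyC !map_polyC /= !mevalC.
case: (eqVneq j x) => [->|jx]; first by rewrite upolyX !map_polyX.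
by rewrite upolyXn // !map_polyC /= !mevalXU vv.
Qed.

(** f along the polynomial curve [h]; the resultants at the points of the curve thereby become
    values of one polynomial. *)
Definition coef2 (h : 'I_N -> {poly K}) f : {poly K} := mmap (@polyC K) h f.
HB.instance Definition _ h := GRing.RMorphism.copy (coef2 h) (mmap (@polyC K) h).

Lemma coef2_line (h : 'I_N -> {poly K}) s x f :
  map_poly (horner_eval s) (map_poly (coef2 h) (upoly x f)) =
    line (fun i => (h i).[s]) x f.
Proof.
apply: (mpoly_hom_ext
  (f := map_poly (horner_eval s) \o map_poly (coef2 h) \o upoly x)
  (g := map_poly (meval (fun i => (h i).[s])) \o upoly x)) => [c|j] /=.
  by rewrite upolyC !map_polyC /= /coef2 mmapC mevalC /horner_eval hornerC.
case: (eqVneq j x) => [->|jx]; first by rewrite upolyX !map_polyX.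
by rewrite upolyXn // !map_polyC /= /coef2 mmapX mmap1U mevalXU.
Qed.

Lemma coef2_unit h f : f \is a GRing.unit ->
  exists2 c, c != 0 & coef2 h f = c%:P.
Proof.
move=> fu; have : coef2 h f \is a GRing.unit by apply: rmorph_unit.
by rewrite poly_unitE => /andP[/size_poly1P [c c0 ->]]; exists c.
Qed.

Definition res x v f g : K := resultant (line v x f) (line v x g).

(** Unit leading coefficients stay nonzero at every point of the curve, so the resultant commutes
    with evaluation. *)
Lemma res_poly (h : 'I_N -> {poly K}) x f g :
  lc x f \is a GRing.unit -> lc x g \is a GRing.unit ->
  exists P : {poly K}, forall s, P.[s] = res x (fun i => (h i).[s]) f g.
Proof.
move=> fu gu; have [c c0 ec] := coef2_unit h fu; have [b b0 eb] := coef2_unit h gu.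
exists (resultant (map_poly (coef2 h) (upoly x f)) (map_poly (coef2 h) (upoly x g))) => s.
have lf : lead_coef (map_poly (coef2 h) (upoly x f)) = c%:P.
  by rewrite lead_coef_map_eq /= -lcE ec ?polyC_eq0.
have lg : lead_coef (map_poly (coef2 h) (upoly x g)) = b%:P.
  by rewrite lead_coef_map_eq /= -lcE eb ?polyC_eq0.
rewrite /res -!coef2_line -(map_resultant (f := horner_eval s)) //.
  by rewrite lf /= /horner_eval hornerC.
by rewrite lg /= /horner_eval hornerC.
Qed.

Lemma res_eq0 x v f g : lc x f \is a GRing.unit -> res x v f g = 0 ->
  exists t, f.@[fun i => if i == x then t else v i] = 0 /\
            g.@[fun i => if i == x then t else v i] = 0.
Proof.
move=> fu /eqP; rewrite resultant_eq0 => h.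
have /closed_rootP [t] : size (gcdp (line v x f) (line v x g)) != 1%N.
  by apply: contraTneq h => ->.
rewrite root_gcd => /andP[/rootP ft /rootP gt]; exists t.
set v' := (fun i => if i == x then t else v i).
have vv j : j != x -> v j = v' j by rewrite /v' => /negbTE ->.
have vx : v' x = t by rewrite /v' eqxx.
have ef k : k.@[v'] = (line v x k).[t].
  by have := line_root v' x k; rewrite vx -(line_ext k vv) => <-.
by split; [apply: etrans (ef f) ft|apply: etrans (ef g) gt].
Qed.

Lemma resultant_root (p q : {poly K}) t : p != 0 -> root p t -> root q t ->
  resultant p q = 0.
Proof.
move=> p0 rp rq; apply/eqP; rewrite resultant_eq0.
have g0 : gcdp p q != 0 by rewrite gcdp_eq0 negb_and p0.
rewrite ltn_neqAle size_poly_gt0 g0 andbT eq_sym; apply/closed_rootP.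
by exists t; rewrite root_gcd rp rq.
Qed.

(* The resultant in x is a polynomial in y and z whose only zero is y = z = 0.
   So it is constant in y for every z != 0, hence also for z = 0, which is absurd. *)
Lemma common_zero x y z f g : x != y -> x != z -> y != z ->
  lc x f \is a GRing.unit -> lc x g \is a GRing.unit ->
  (0 < dg x f)%N -> (0 < dg x g)%N ->
  (forall v, f.@[v] = 0 -> g.@[v] = 0 -> v y = 0 /\ v z = 0) ->
  (forall v, v y = 0 -> v z = 0 -> (forall j, j != x -> j != y -> j != z -> v j = 0) ->
     f.@[v] = 0 \/ g.@[v] = 0 -> v x = 0) -> False.
Proof.
move=> xy xz yz fu gu f1 g1 hzero hax.
(* [h1 r] moves y while z = r, [h2 s] moves z while y = s, and all other coordinates are 0; [p s r]
   is the point with y = s, z = r. *)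
pose h1 r i : {poly K} := if i == y then 'X else if i == z then r%:P else 0.
pose h2 s i : {poly K} := if i == z then 'X else if i == y then s%:P else 0.
pose p s r i : K := if i == y then s else if i == z then r else 0.
have e1 s r : (fun i => (h1 r i).[s]) =1 p s r.
  move=> i; rewrite /h1 /p; case: ifP => _; first by rewrite hornerX.
  by case: ifP => _; rewrite hornerE.
have e2 s r : (fun i => (h2 s i).[r]) =1 p s r.
  move=> i; rewrite /h2 /p; case: (eqVneq i z) => [->|_].
    by rewrite eq_sym (negbTE yz) hornerX.
  by case: ifP => _; rewrite hornerE.
have ext v v' : v =1 v' -> res x v f g = res x v' f g.
  by move=> vv; rewrite /res !(line_ext (v' := v')).
have nz s r : res x (p s r) f g = 0 -> s = 0 /\ r = 0.
  move/(res_eq0 fu) => [t [ft gt]]; have [] := hzero _ ft gt.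
  rewrite /p ![_ == x]eq_sym (negbTE xy) (negbTE xz) !eqxx.
  by rewrite [z == y]eq_sym (negbTE yz).
have P1 r : exists P : {poly K}, forall s, P.[s] = res x (p s r) f g.
  by have [P hP] := res_poly (h1 r) fu gu; exists P => s; rewrite hP; apply: ext.
have P2 s : exists P : {poly K}, forall r, P.[r] = res x (p s r) f g.
  by have [P hP] := res_poly (h2 s) fu gu; exists P => r; rewrite hP; apply: ext.
have cst s r : r != 0 -> res x (p s r) f g = res x (p 0 r) f g.
  move=> r0; have [P hP] := P1 r; rewrite -!hP.
  have : size P == 1%N.
    apply/negPn/negP => /closed_rootP [t /rootP]; rewrite hP => /nz [_ e].
    by rewrite e eqxx in r0.
  by case/size_poly1P => c _ ->; rewrite !hornerC.
have [A hA] := P2 0; have [B hB] := P2 1.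
have AB : 'X * (A - B) = 0.
  apply/eqP/negPn/negP => /closed_nonrootP [r]; rewrite rootE !hornerE hA hB.
  case: (eqVneq r 0) => [->|r0]; first by rewrite mul0r eqxx.
  by rewrite (cst 1 r r0) subrr mulr0 eqxx.
(* On the x-axis f and g both have a zero, and [hax] places each of them at the origin, so they
   coincide. *)
have r00 : res x (p 0 0) f g = 0.
  have v0 : p 0 0 =1 (fun=> 0) by move=> i; rewrite /p !if_same.
  have rt k : lc x k \is a GRing.unit -> (0 < dg x k)%N ->
      (forall v, v y = 0 -> v z = 0 ->
        (forall j, j != x -> j != y -> j != z -> v j = 0) -> k.@[v] = 0 -> v x = 0) ->
      root (line (p 0 0) x k) 0.
    move=> ku k1 hk.
    have /closed_rootP [t] : size (line (p 0 0) x k) != 1%N.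
      by rewrite size_line //; apply: contraTneq k1; rewrite dgE => ->.
    set v := (fun i => if i == x then t else p 0 0 i).
    have vx : v x = t by rewrite /v eqxx.
    have vv j : j != x -> p 0 0 j = v j by rewrite /v => /negbTE ->.
    have ek : k.@[v] = (line (p 0 0) x k).[t].
      by have := line_root v x k; rewrite vx -(line_ext k vv) => <-.
    move=> /[dup] /rootP; rewrite -ek => kv; suff <- : t = 0 by [].
    rewrite -vx; apply: hk => //.
    - by rewrite -vv 1?eq_sym // v0.
    - by rewrite -vv 1?eq_sym // v0.
    - by move=> j jx _ _; rewrite -vv // v0.
  apply: (resultant_root (t := 0)).
  - by rewrite -size_poly_gt0 size_line // size_poly_gt0 upoly_eq0; apply: contraTneq fu => ->; rewrite lc0 unitr0.
  - by apply: rt => // v h1' h2' h3 h4; apply: hax => //; left.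
  - by apply: rt => // v h1' h2' h3 h4; apply: hax => //; right.
have : A = B by apply/eqP; rewrite -subr_eq0; move/eqP: AB; rewrite mulf_eq0 polyX_eq0.
move/(congr1 (horner^~ 0)); rewrite hA hB r00 => /esym /nz [/eqP].
by rewrite oner_eq0.
Qed.

End Bezout.

(** * Three variables: the complete homogeneous case *)

Lemma poly_supp3 (D : nzRingType) (f : {poly D}) a b : (0 < b)%N -> (b < a)%N ->
  (forall s, f`_s != 0 -> [\/ s = a, s = b | s = 0%N]) ->
  f = (f`_a)%:P * 'X^a + (f`_b)%:P * 'X^b + (f`_0)%:P.
Proof.
move=> b0 ba supp; apply/polyP => s; rewrite !coefD !coefCM !coefXn coefC.
case: (eqVneq s a) => [->|sa].
  by rewrite (gtn_eqF ba) (gtn_eqF (ltn_trans b0 ba)) mulr1 mulr0 !addr0.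
case: (eqVneq s b) => [->|sb].
  by rewrite (gtn_eqF b0) mulr1 mulr0 add0r addr0.
case: (eqVneq s 0%N) => [->|s0]; first by rewrite !mulr0 !add0r.
rewrite !mulr0 !addr0; apply/eqP/negPn/negP => /supp.
by case=> e; move: sa sb s0; rewrite e eqxx.
Qed.

Section Trinomials.
Variable K : closedFieldType.
Hypothesis K0 : forall m, (m.+1)%:R != 0 :> K.
Implicit Types (P B : {poly K}) (x y a b c : K).

Lemma nat_neq0 m : (0 < m)%N -> m%:R != 0 :> K.
Proof. by case: m. Qed.

Lemma deriv_root P B x : P = ('X - x%:P) * B ->
  P.[x] = 0 /\ P^`().[x] = B.[x].
Proof.
move=> ->; rewrite derivM derivXsubC mul1r hornerD !hornerM hornerXsubC subrr.
by rewrite !mul0r addr0.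
Qed.

Lemma double_root P B x : P = ('X - x%:P) ^+ 2 * B -> P.[x] = 0 /\ P^`().[x] = 0.
Proof.
rewrite expr2 -mulrA => /deriv_root [-> ->]; split=> //.
by have [->] := deriv_root (erefl (('X - x%:P) * B)).
Qed.

Lemma triple_root P B x : P = ('X - x%:P) ^+ 3 * B -> P^`()^`().[x] = 0.
Proof.
rewrite exprS -mulrA => ->; set Q := _ * B.
rewrite derivM derivXsubC mul1r derivD derivM derivXsubC mul1r !hornerD.
rewrite hornerM hornerXsubC subrr mul0r addr0.
by have [_ ->] := double_root (erefl Q); rewrite addr0.
Qed.

(** P(x) = 0 and x P'(x) = 0 are linear equations for b and c. *)
Lemma trinomial_double (q d : nat) a b c x : (0 < q)%N -> (0 < d)%N -> x != 0 -> a != 0 ->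
  let P := a *: 'X^(q.+1 * d) + b *: 'X^d + c%:P in
  P.[x] = 0 -> P^`().[x] = 0 ->
  b = - a * q.+1%:R * (x ^+ d) ^+ q /\ c = a * q%:R * (x ^+ d) ^+ q.+1.
Proof.
move=> q0 d0 x0 a0 P; rewrite /P !derivE !(hornerD, hornerZ, hornerMn, hornerXn, hornerC) -!(mulr_natr (_ ^+ _)) => e0 e1.
have X0 : x ^+ d != 0 by rewrite expf_neq0.
have xm m : (0 < m)%N -> x ^+ m.-1 * x = x ^+ m by move=> m0; rewrite -exprSr prednK.
have e2 : a * (q.+1 * d)%:R * x ^+ (q.+1 * d) + b * d%:R * x ^+ d = 0.
  rewrite -(xm (q.+1 * d)%N) ?muln_gt0 // -[X in _ + _ * X](xm d) //.
  transitivity (0 * x); last by rewrite mul0r.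
  rewrite -[in RHS]e1; ring.
have eX : x ^+ (q.+1 * d) = x ^+ d * (x ^+ d) ^+ q by rewrite -exprS -exprM mulnC.
have e3 : b = - a * q.+1%:R * (x ^+ d) ^+ q.
  apply: (mulIf X0); apply: (mulfI (nat_neq0 d0)).
  apply/eqP; rewrite -subr_eq0; apply/eqP; rewrite -[RHS]e2 eX natrM; ring.
split=> //; apply/eqP; rewrite -subr_eq0; apply/eqP.
rewrite -[RHS]e0 e3 eX exprS -[q.+1%:R]natr1; ring.
Qed.

(** Once b is eliminated, x^2 P''(x) equals a q (q + 1) d^2 x^((q + 1)d), which is not 0. *)
Lemma trinomial_not_triple (q d : nat) a b c x : (0 < q)%N -> (0 < d)%N -> x != 0 ->
  a != 0 -> let P := a *: 'X^(q.+1 * d) + b *: 'X^d + c%:P in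
  P.[x] = 0 -> P^`().[x] = 0 -> P^`()^`().[x] = 0 -> False.
Proof.
move=> q0 d0 x0 a0 P h0 h1 h2.
have [eb _] := trinomial_double q0 d0 x0 a0 h0 h1.
have X0 : x ^+ d != 0 by rewrite expf_neq0.
have xm m : x ^+ m.-2 * m.-1%:R * m%:R * x ^+ 2 = x ^+ m * m%:R * (m%:R - 1).
  by case: m => [|[|m]] /=; [ring|ring|rewrite -[m.+2%:R]natr1 !exprS; ring].
have e3 : a * (x ^+ (q.+1 * d) * (q.+1 * d)%:R * ((q.+1 * d)%:R - 1))
   + b * (x ^+ d * d%:R * (d%:R - 1)) = 0.
  rewrite -!xm; transitivity (0 * x ^+ 2); last by rewrite mul0r.
  rewrite -[in RHS]h2 /P !derivE !(hornerD, hornerZ, hornerMn, hornerXn, hornerC).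
  rewrite -!(mulr_natr (_ ^+ _)) -!(mulr_natr (_ * _)); ring.
have eX : x ^+ (q.+1 * d) = x ^+ d * (x ^+ d) ^+ q by rewrite -exprS -exprM mulnC.
have : a * q.+1%:R * (d%:R) ^+ 2 * q%:R * (x ^+ d * (x ^+ d) ^+ q) = 0.
  rewrite -[RHS]e3 eb eX natrM -[q.+1%:R]natr1; ring.
apply/eqP; rewrite !mulf_neq0 ?expf_neq0 //; try exact: nat_neq0.
Qed.

(** Here x and y stand for d-th powers: y satisfies the trinomial that has x as a double root, and
    conversely. *)
Lemma two_double (q : nat) x y : (0 < q)%N -> x != 0 -> y != 0 ->
  y ^+ q.+1 - q.+1%:R * x ^+ q * y + q%:R * x ^+ q.+1 = 0 ->
  x ^+ q.+1 - q.+1%:R * y ^+ q * x + q%:R * y ^+ q.+1 = 0 -> x = y.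
Proof.
move=> q0 x0 y0; rewrite -[q.+1%:R]natr1 !exprS; set p := x ^+ q; set r := y ^+ q => e1 e2.
have p0 : p != 0 by rewrite expf_neq0.
have : p * (q%:R + 1) * q%:R * (x - y) ^+ 2 = 0.
  (* This combination of the relations eliminates y^q and leaves a multiple of (x - y)^2. *)
  transitivity (y * 0 + ((q%:R + 1) * x - q%:R * y) * 0); last by rewrite !mulr0 addr0.
  rewrite -{1}e2 -[in RHS]e1; ring.
move/eqP; rewrite !mulf_eq0 (negbTE p0) natr1 (negbTE (nat_neq0 _)) // (negbTE (nat_neq0 q0)) /=.
by rewrite orbb subr_eq0 => /eqP.
Qed.

End Trinomials.

Section ThreeComplete.
Variables (K : closedFieldType) (N : nat).
Hypothesis K0 : forall m, (m.+1)%:R != 0 :> K.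
Local Notation R := {mpoly K[N]}.
Local Notation T := (@linforms K N).
Local Notation S := (@Sdiff K N).
Implicit Types (C G H : R) (v : 'I_N -> K) (i j : 'I_N).

Lemma quot_nseq_unit (W : {set 'I_N}) m d C : (0 < d)%N -> #|W| = m.+1 ->
  is_quot W (nseq m d) d C -> C \is a GRing.unit.
Proof.
move=> d0 cW /is_quotE h.
have h1 : assoc (T W d * C) (T W d * 1).
  by rewrite mulr1; apply: assoc_trans (assoc_sym h) (S_nseq K0 d0 cW).
by rewrite (assoc_unit (assoc_cancel (T_neq0 K W d) h1)) unitr1.
Qed.

Variables (V : {set 'I_N}) (q d : nat).
Hypotheses (cV : #|V| = 3) (q1 : (1 < q)%N) (d0 : (0 < d)%N).
Let n := [:: (q * d)%N; d].

Let q0 : (0 < q)%N. Proof. exact: ltnW. Qed.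
Let pn : all (ltn 0) n. Proof. by rewrite /= d0 muln_gt0 q0 d0. Qed.
Let cVi i : i \in V -> #|V :\ i| = 2. Proof. by move=> iV; apply: cardsD1_S. Qed.

Definition dprod i : R := \prod_(j in V :\ i) ('X_i ^+ d - 'X_j ^+ d).

(** [dprod i * C] is S divided by forms free of x_i, so it has only the three exponents of S in
    x_i. *)
Lemma quot_trinomial i C : i \in V -> is_quot V n d C ->
  exists a b c : R, a \is a GRing.unit /\
    upoly i (dprod i * C) = a%:P * 'X^(q.+1 * d) + b%:P * 'X^d + c%:P.
Proof.
move=> iV /is_quotE hC; set Q := dprod i * C.
have hT := assoc_mulr C (T_split_at K0 d0 iV).
have [u uu eS] : assoc (S V n) (T (V :\ i) d * Q).
  by apply: (assoc_trans hC); rewrite /Q mulrA.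
have fT : freeof i (T (V :\ i) d) by apply: free_L; rewrite !inE eqxx.
have fu : freeof i u by apply/dg0_free/dg_unit.
have cS s : (upoly i (S V n))`_s = u * (T (V :\ i) d * (upoly i Q)`_s).
  by rewrite eS !rmorphM /= fu fT !coefCM.
have T0 : T (V :\ i) d != 0 by apply: T_neq0.
have u0 : u != 0 by apply: contraTneq uu => ->; rewrite unitr0.
have supp s : (upoly i Q)`_s != 0 -> [\/ s = q.+1 * d, s = d | s = 0]%N.
  move=> h; have : (upoly i (S V n))`_s != 0 by rewrite cS; apply: mulf_neq0 u0 (mulf_neq0 T0 h).
  case/(@coef_S_supp K N V n i cV iV) => -[|[|[|//]]] _ ->; rewrite /expo /= ?addn0.
  - by constructor 1; rewrite mulSn addnC.
  - by constructor 2.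
  - by constructor 3.
exists (upoly i Q)`_(q.+1 * d), (upoly i Q)`_d, (upoly i Q)`_0; split.
  have eqd : (q * d + sumn [:: d] = q.+1 * d)%N by rewrite /= addn0 mulSn addnC.
  have h := @coef_S_top K N V (q * d) [:: d] i cV iV pn.
  rewrite eqd -/n cS in h.
  have h2 : assoc (T (V :\ i) d * (upoly i Q)`_(q.+1 * d)) (T (V :\ i) d * 1).
    rewrite mulr1; apply: (assoc_trans (assoc_sym (assoc_unitl _ uu))).
    apply: (assoc_trans h); apply: (S_nseq K0 (m := 1) d0 (cVi iV)).
  by rewrite (assoc_unit (assoc_cancel T0 h2)) unitr1.
by apply: poly_supp3 => //; rewrite -{1}[d]mul1n ltn_mul2r d0.
Qed.

Lemma line_dprod v i : i \in V ->
  line v i (dprod i) = \prod_(j in V :\ i) ('X^d - (v j ^+ d)%:P).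
Proof.
move=> iV; rewrite /line /dprod !rmorph_prod /=; apply: eq_bigr => j /setD1P [ji _].
have -> : upoly i ('X_i ^+ d - 'X_j ^+ d) = 'X^d - ('X_j ^+ d)%:P :> {poly R}.
  by rewrite rmorphB !rmorphXn /= upolyX upolyXn // polyC_exp.
by rewrite rmorphB /= map_polyXn map_polyC /= rmorphXn /= mevalXU.
Qed.

Lemma root_dprod v i j : i \in V -> j \in V -> j != i -> forall t, t ^+ d = v j ^+ d ->
  root (line v i (dprod i)) t.
Proof.
move=> iV jV ji t td; rewrite line_dprod // (bigD1 j) ?inE ?ji //= rootM.
by apply/orP; left; rewrite rootE !hornerE td subrr.
Qed.

Lemma line_trinomial v i C : i \in V -> is_quot V n d C ->
  exists a b c : K, a != 0 /\
    line v i (dprod i) * line v i C = a *: 'X^(q.+1 * d) + b *: 'X^d + c%:P.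
Proof.
move=> iV hC; have [a [b [c [au e]]]] := quot_trinomial iV hC.
exists a.@[v], b.@[v], c.@[v]; split; first exact: meval_unit.
rewrite -lineM /line e !rmorphD !rmorphM /= !map_polyC /= !map_polyXn.
by rewrite !mul_polyC.
Qed.

(** A common zero of G and H is a double root of the trinomial in x_i and fixes its coefficients up
    to the factor a. The trinomial also vanishes at v j, because [dprod i] does: this is the
    equation. If y = x, [dprod i] would supply a third root at v i. *)
Lemma double_zero G H v i j : is_quot V n d (G * H) -> i \in V -> j \in V -> j != i ->
  G.@[v] = 0 -> H.@[v] = 0 -> v i != 0 ->
  let x := v i ^+ d in let y := v j ^+ d in
  [/\ v j != 0, y != x &
    y ^+ q.+1 - q.+1%:R * x ^+ q * y + q%:R * x ^+ q.+1 = 0].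
Proof.
move=> hC iV jV ji Gv Hv vi0 x y.
have [a [b [c [a0 e]]]] := line_trinomial v iV hC.
have rt f : f.@[v] = 0 -> exists p, line v i f = p * ('X - (v i)%:P).
  by rewrite -(line_root v i) => /rootP/factor_theorem.
have [g eg] := rt _ Gv; have [h eh] := rt _ Hv.
have eP : a *: 'X^(q.+1 * d) + b *: 'X^d + c%:P =
    ('X - (v i)%:P) ^+ 2 * (line v i (dprod i) * g * h).
  rewrite -e lineM eg eh; ring.
have [P0 P1] := double_root eP.
have [eb ec] := trinomial_double K0 q0 d0 vi0 a0 P0 P1.
have Pj : a * y ^+ q.+1 + b * y + c = 0.
  have : root (line v i (dprod i) * line v i (G * H)) (v j).
    rewrite rootM; apply/orP; left.
    exact: (@root_dprod v i j iV jV ji (v j) erefl).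
  rewrite e => /rootP; rewrite !(hornerD, hornerZ, hornerXn, hornerC).
  by rewrite mulnC exprM.
have x0 : x != 0 by rewrite expf_neq0.
have hy : y ^+ q.+1 - q.+1%:R * x ^+ q * y + q%:R * x ^+ q.+1 = 0.
  apply: (mulfI a0); rewrite mulr0 -[RHS]Pj eb ec -/x; ring.
split=> //.
- apply: contra_eq_neq hy => vj0; rewrite /y vj0 expr0n eqn0Ngt d0 /=.
  rewrite expr0n /= mulr0 subr0 add0r mulf_neq0 ?expf_neq0 //.
  exact: nat_neq0.
- apply/negP => /eqP yx.
  have := @root_dprod v i j iV jV ji (v i) (esym yx) => /factor_theorem [p ep].
  have eP3 : a *: 'X^(q.+1 * d) + b *: 'X^d + c%:P =
      ('X - (v i)%:P) ^+ 3 * (p * g * h).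
    rewrite eP ep; ring.
  exact: (trinomial_not_triple K0 q0 d0 vi0 a0 P0 P1 (triple_root eP3)).
Qed.

Lemma no_double_zero G H v i : is_quot V n d (G * H) -> i \in V ->
  G.@[v] = 0 -> H.@[v] = 0 -> v i = 0.
Proof.
move=> hC iV Gv Hv; apply/eqP/negPn/negP => vi0.
have [|j jV] := @pick_out _ V [:: i]; first by rewrite cV.
rewrite inE => ji.
have [vj0 yx e1] := double_zero hC iV jV ji Gv Hv vi0.
have ij : i != j by rewrite eq_sym.
have [_ _ e2] := double_zero hC jV iV ij Gv Hv vj0.
case/eqP: yx; apply: (two_double K0 q0 _ _ e2 e1); exact: expf_neq0.
Qed.

(** When the other variables are 0, [dprod i] is x_i^(2d), which leaves no room for the terms b and
    c: x_i^(2d) C equals a x_i^((q + 1)d). *)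
Lemma axis_zero C v i : is_quot V n d C -> i \in V ->
  (forall j, j \in V -> j != i -> v j = 0) -> C.@[v] = 0 -> v i = 0.
Proof.
move=> hC iV vj Cv; have [a [b [c [a0]]]] := line_trinomial v iV hC.
rewrite line_dprod // (eq_bigr (fun=> 'X^d)) => [|j /setD1P [ji jV]]; last first.
  by rewrite vj // expr0n eqn0Ngt d0 polyC0 subr0.
rewrite prodr_const (cVi iV) -exprM => e.
have dq : (d < q.+1 * d)%N by rewrite -{1}[d]mul1n ltn_mul2r d0.
have e0 := congr1 (fun f : {poly K} => f`_0) e.
have ed := congr1 (fun f : {poly K} => f`_d) e.
have d2 : (d < d * 2)%N by rewrite -{1}[d]muln1 ltn_mul2l d0.
rewrite !coefXnM muln_gt0 d0 /= !coefD !coefZ !coefXn coefC /= in e0.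
rewrite !coefXnM d2 /= !coefD !coefZ !coefXn coefC eqxx in ed.
rewrite ![0%N == _]eq_sym (gtn_eqF d0) (gtn_eqF (ltn_trans d0 dq)) !mulr0 !add0r in e0.
rewrite (gtn_eqF d0) (ltn_eqF dq) mulr0 add0r mulr1 addr0 in ed.
move: e; rewrite -e0 -ed polyC0 scale0r !addr0 => /(congr1 (horner^~ (v i))).
rewrite hornerM line_root Cv mulr0 hornerZ hornerXn => /esym/eqP.
by rewrite mulf_eq0 (negbTE a0) expf_eq0 => /andP[_ /eqP].
Qed.

(** As in [double_zero], except that one of the two roots now comes from [dprod i], which vanishes
    at v i because v j has the same d-th power. *)
Lemma collision_zero C v i j l : is_quot V n d C -> i \in V -> j \in V -> l \in V ->
  j != i -> l != i -> l != j -> C.@[v] = 0 -> v i != 0 -> v j ^+ d = v i ^+ d ->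
  let x := v i ^+ d in let y := v l ^+ d in
  y != x /\ y ^+ q.+1 - q.+1%:R * x ^+ q * y + q%:R * x ^+ q.+1 = 0.
Proof.
move=> hC iV jV lV ji li lj Cv vi0 ej x y.
have [a [b [c [a0 e]]]] := line_trinomial v iV hC.
have rt (t : K) : t ^+ d = x -> exists p, 'X^d - (t ^+ d)%:P = p * ('X - (v i)%:P).
  by move=> tx; apply/factor_theorem/rootP; rewrite hornerD hornerN hornerXn hornerC tx subrr.
have [pj epj] := rt _ ej.
have : root (line v i C) (v i) by apply/rootP; rewrite line_root.
move/factor_theorem => [h eh].
have [pr epr] : exists pr, line v i (dprod i) =
    ('X^d - (v j ^+ d)%:P) * (('X^d - (v l ^+ d)%:P) * pr).
  rewrite line_dprod // (bigD1 j) ?inE ?ji //= (bigD1 l) ?inE ?li ?lV ?lj //=.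
  by eexists.
have eP : a *: 'X^(q.+1 * d) + b *: 'X^d + c%:P =
    ('X - (v i)%:P) ^+ 2 * (pj * (('X^d - (v l ^+ d)%:P) * pr) * h).
  rewrite -e epr eh epj; ring.
have [P0 P1] := double_root eP.
have [eb ec] := trinomial_double K0 q0 d0 vi0 a0 P0 P1.
split.
  apply/negP => /eqP yx; have [pl epl] := rt _ yx.
  have eP3 : a *: 'X^(q.+1 * d) + b *: 'X^d + c%:P =
      ('X - (v i)%:P) ^+ 3 * (pj * (pl * pr) * h).
    rewrite eP epl; ring.
  exact: (trinomial_not_triple K0 q0 d0 vi0 a0 P0 P1 (triple_root eP3)).
have Pl : a * y ^+ q.+1 + b * y + c = 0.
  have : root (line v i (dprod i) * line v i C) (v l).
    rewrite rootM; apply/orP; left.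
    exact: (@root_dprod v i l iV lV li (v l) erefl).
  rewrite e => /rootP; rewrite !(hornerD, hornerZ, hornerXn, hornerC).
  by rewrite mulnC exprM.
apply: (mulfI a0); rewrite mulr0 -[RHS]Pl eb ec -/x; ring.
Qed.

Theorem three_complete_irr C : is_quot V n d C -> irreducible_elt C.
Proof.
move=> hC; have [x xV] : exists i, i \in V by apply/card_gt0P; rewrite cV.
have [|y yV] := @pick_out _ V [:: x]; first by rewrite cV.
rewrite inE => yx.
have [|z zV] := @pick_out _ V [:: x; y]; first by rewrite cV.
rewrite !inE negb_or => /andP[zx zy].
have Vxyz j : j \in V -> j != x -> j = y \/ j = z.
  move=> jV jx; have /eqP/cards1P [t et] : #|V :\ x :\ y| = 1%N.
    by apply: cardsD1_S; [apply: cVi|rewrite !inE yx].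
  case: (eqVneq j y) => [->|jy]; [by left|right].
  have : j \in V :\ x :\ y by rewrite !inE jx jy.
  have : z \in V :\ x :\ y by rewrite !inE zx zy.
  by rewrite et !inE => /eqP -> /eqP.
(* The leading facet has the single difference d, so its quotient is a unit. *)
have lu (A B : R) : is_quot V n d (A * B) -> lc x A \is a GRing.unit.
  move=> h; have := lc_quot d0 h cV pn xV; rewrite lcM.
  move/(quot_nseq_unit (m := 1) d0 (cVi xV)).
  by move=> h2; apply: dvd_unit h2; apply/dvd_mulr/dvd_refl.
apply: irr_intro => [|G H e].
  apply/negP => Cu; have := dg_quot K0 d0 hC cV pn xV.
  rewrite (dg_unit x Cu) /= addn0 add0n => h; have h2 : (2 * d <= q * d)%N.
    by rewrite leq_mul2r q1 orbT.
  by move: h h2 d0; clear; lia.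
rewrite e in hC; have hC' : is_quot V n d (H * G) by rewrite mulrC.
have Gl := lu _ _ hC; have Hl := lu _ _ hC'.
case: (posnP (dg x G)) => [G1|G1]; first by left; apply: unit_dg_lc Gl G1.
case: (posnP (dg x H)) => [H1|H1]; first by right; apply: unit_dg_lc Hl H1.
exfalso; apply: (common_zero (x := x) (y := y) (z := z) _ _ _ Gl Hl G1 H1).
- by rewrite eq_sym.
- by rewrite eq_sym.
- by rewrite eq_sym.
- move=> v Gv Hv; split; first exact: no_double_zero hC yV Gv Hv.
  exact: no_double_zero hC zV Gv Hv.
move=> v vy vz _ GHv; apply: (axis_zero hC xV).
  by move=> j jV jx; case: (Vxyz j jV jx) => ->.
by rewrite mevalM; case: GHv => ->; rewrite ?mul0r ?mulr0.
Qed.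

End ThreeComplete.

(** * Reversal of the exponents *)

Transparent varprod Sdiff alternant is_quot.

Section Torus.
Variables (K : closedFieldType) (N : nat).
Hypothesis K0 : forall m, (m.+1)%:R != 0 :> K.
Local Notation R := {mpoly K[N]}.
Implicit Types (f g p q r : R) (x : 'I_N -> K) (i j : 'I_N) (k l : nat).

Lemma nat_inj_char0 : injective (fun m => m%:R : K).
Proof.
have h m l : (m < l)%N -> m%:R != l%:R :> K.
  move=> ml; rewrite eq_sym -subr_eq0 -natrB 1?ltnW //.
  by rewrite -(prednK (_ : 0 < l - m)%N) ?subn_gt0.
by move=> m l e; case: (ltngtP m l) => // /h; rewrite e eqxx.
Qed.

Lemma nonroot_const (g : {poly R}) : g != 0 -> exists2 c : K, c != 0 & g.[c%:MP] != 0.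
Proof.
move=> g0; pose s : seq R := [seq (m.+1)%:R%:MP | m <- iota 0 (size g)].
have us : uniq s.
  rewrite map_inj_uniq ?iota_uniq // => a b /eqP.
  by rewrite mpolyC_eq => /eqP /nat_inj_char0 [].
have : ~~ all (root g) s.
  apply/negP => h; have := max_poly_roots g0 h us.
  by rewrite size_map size_iota ltnn.
move=> /allPn [_ /mapP [m _ ->] gm].
by exists (m.+1)%:R; [apply: K0|rewrite -rootE].
Qed.

Let spec (s : seq 'I_N) x f : R :=
  mmap (@mpolyC N K) (fun i => if i \in s then (x i)%:MP else 'X_i) f.
HB.instance Definition _ s x := GRing.RMorphism.copy (spec s x)
  (mmap (@mpolyC N K) (fun i => if i \in s then (x i)%:MP else 'X_i)).

Let specX s x i : spec s x 'X_i = if i \in s then (x i)%:MP else 'X_i.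
Proof. by rewrite /spec mmapX mmap1U. Qed.

Let specC s x c : spec s x c%:MP = c%:MP.
Proof. by rewrite /spec mmapC. Qed.

Let spec_cons s x j f : spec (j :: s) x f = subst j (x j)%:MP (spec s x f).
Proof.
apply: (mpoly_hom_ext (f := spec (j :: s) x)
  (g := subst j (x j)%:MP \o spec s x)) => [c|i].
  by change (spec (j :: s) x c%:MP = subst j (x j)%:MP (spec s x c%:MP)); rewrite !specC substC.
change (spec (j :: s) x 'X_i = subst j (x j)%:MP (spec s x 'X_i)).
rewrite !specX inE; have [->|ij] := eqVneq i j => /=.
  by case: ifP => _; rewrite ?substC ?substX.
by case: ifP => _; rewrite ?substC ?substXn.
Qed.

Let spec_ext s x y f : {in s, x =1 y} -> spec s x f = spec s y f.
Proof.
move=> xy; apply: (mpoly_hom_ext (f := spec s x) (g := spec s y)) => [c|i].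
  by change (spec s x c%:MP = spec s y c%:MP); rewrite !specC.
change (spec s x 'X_i = spec s y 'X_i); rewrite !specX.
by case: ifP => // /xy ->.
Qed.

(** The variables are specialized one after another, each to one of the infinitely many nonzero
    constants; [spec s] is the evaluation of those in [s]. *)
Lemma torus_point f : f != 0 ->
  exists2 x, (forall i, x i != 0) & f.@[x] != 0.
Proof.
move=> f0.
have [x x0 h] : exists2 x, (forall i, x i != 0) & spec (enum 'I_N) x f != 0.
  elim: (enum 'I_N) (enum_uniq 'I_N) => [|j s IH] /=.
    exists (fun=> 1) => [i|]; first exact: oner_neq0.
    suff -> : spec [::] (fun=> 1) f = f by [].
    apply: (mpoly_hom_ext (f := spec [::] (fun=> 1)) (g := idfun)) => [c|i] /=.
      exact: specC.
    exact: specX.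
  case/andP => js /IH [x x0 h].
  have [|c c0 hc] := @nonroot_const (upoly j (spec s x f)); first by rewrite upoly_eq0.
  exists (fun i => if i == j then c else x i) => [i|]; first by case: ifP.
  rewrite spec_cons eqxx substE (@spec_ext s _ x) // => i si /=.
  by case: eqP si js => // -> ->.
exists x => //; apply: contraNneq h => fx.
suff -> : spec (enum 'I_N) x f = (f.@[x])%:MP by rewrite fx mpolyC0.
apply: (mpoly_hom_ext (f := spec (enum 'I_N) x)
  (g := @mpolyC N K \o meval x)) => [c|i] /=.
  by change (spec (enum 'I_N) x c%:MP = ((c%:MP : R).@[x])%:MP); rewrite specC mevalC.
change (spec (enum 'I_N) x 'X_i = (('X_i : R).@[x])%:MP).
by rewrite specX mem_enum mevalXU.
Qed.

Lemma torus_ext f g : (forall x, (forall i, x i != 0) -> f.@[x] = g.@[x]) -> f = g.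
Proof.
move=> h; apply/eqP; rewrite -subr_eq0; apply/negPn/negP => /torus_point [x x0].
by rewrite mevalB h // subrr eqxx.
Qed.

(* [q] is [p(1/x)] cleared of denominators by the [k]-th power of x_1 ... x_N. *)
Definition isrev k p q := forall x, (forall i, x i != 0) ->
  q.@[x] = (\prod_i x i) ^+ k * p.@[fun i => (x i)^-1].
Local Notation M := (varprod K [set: 'I_N]).

Lemma meval_M x : M.@[x] = \prod_i x i.
Proof.
rewrite /varprod rmorph_prod /=; apply: eq_big => [i|i _]; first by rewrite inE.
exact: mevalXU.
Qed.

Lemma prod_inv x : \prod_i (x i)^-1 = (\prod_i x i)^-1.
Proof. by rewrite prodfV. Qed.

Lemma prod_torus x : (forall i, x i != 0) -> \prod_i x i != 0.
Proof. by move=> x0; apply/prodf_neq0. Qed.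

Lemma isrev_mul k l p q p' q' : isrev k p q -> isrev l p' q' ->
  isrev (k + l) (p * p') (q * q').
Proof. by move=> h h' x x0; rewrite !mevalM h // h' // exprD mulrACA. Qed.

Lemma isrev_sym k p q : isrev k p q -> isrev k q p.
Proof.
move=> h x x0; rewrite h; last by move=> i; rewrite invr_eq0.
rewrite prod_inv mulrA exprVn mulfV ?expf_neq0 ?prod_torus // mul1r.
by apply: meval_eq => i; rewrite invrK.
Qed.

Lemma isrev_uniq k l p q q' : isrev k p q -> isrev l p q' -> M ^+ l * q = M ^+ k * q'.
Proof.
move=> h h'; apply: torus_ext => x x0.
by rewrite !mevalM !rmorphXn /= meval_M h // h' // mulrCA.
Qed.

Lemma isrevC c : isrev 0 c%:MP c%:MP.
Proof. by move=> x x0; rewrite expr0 mul1r !mevalC. Qed.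

Lemma isrev_M k : isrev k (M ^+ k) 1.
Proof.
move=> x x0; rewrite meval1 rmorphXn /= meval_M prod_inv exprVn mulfV //.
by rewrite expf_neq0 ?prod_torus.
Qed.

Lemma isrevX i : isrev 1 'X_i (\prod_(j | j != i) 'X_j).
Proof.
move=> x x0; rewrite expr1 mevalXU [X in X * _](bigD1 i) //= mulrAC mulfV // mul1r.
by rewrite rmorph_prod /=; apply: eq_bigr => j _; rewrite mevalXU.
Qed.

Lemma ex_rev p : exists k q, isrev k p q.
Proof.
have hX i m : exists k q, isrev k ('X_i ^+ m) q.
  elim: m => [|m [k [q h]]]; first by exists 0%N, 1%:MP; apply: isrevC.
  rewrite exprS; exists (1 + k)%N; eexists.
  by apply: isrev_mul h; apply: isrevX.
elim/mpolyind: p => [|c m p _ _ [k [q h]]].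
  by exists 0%N, 0 => x x0; rewrite !meval0 mulr0.
have [l [r h']] : exists k q, isrev k ('X_[m] : R) q.
  rewrite mpolyXE_id; elim/big_ind: _ => [|a b [ka [qa ha]] [kb [qb hb]]|i _].
  - by exists 0%N, 1%:MP; apply: isrevC.
  - by exists (ka + kb)%N, (qa * qb); apply: isrev_mul.
  - exact: hX.
exists (k + l)%N, (M ^+ k * (c *: r) + M ^+ l * q) => x x0.
rewrite mevalD !mevalM !rmorphXn /= !meval_M mevalZ h // h' // mevalD mevalZ.
by rewrite exprD mulrDr; congr (_ + _); ring.
Qed.

Lemma isrev_dvd_mono f g k : isrev k f g -> (exists s, dvdr g (M ^+ s)) ->
  exists t, dvdr f (M ^+ t).
Proof.
move=> h [s [r e]]; have [l [r' hr]] := ex_rev r.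
exists (l + k)%N; exists (M ^+ s * r').
have h2 := isrev_mul hr (isrev_sym h); rewrite -e in h2.
by rewrite -mulrA -(isrev_uniq (isrev_M s) h2) mulr1.
Qed.

Lemma expo_rev (n : seq nat) (j : nat) : (j <= size n)%N ->
  (expo (rev n) j + expo n (size n - j) = sumn n)%N.
Proof.
move=> jn; rewrite /expo drop_rev sumn_rev -sumn_cat cat_take_drop //.
Qed.

(** Taking y_i^A out of each row replaces exponents of y_i by complementary exponents of 1/y_i; what
    remains is a reversal of the columns. *)
Lemma det_rev m : exists c : nat, forall (y : 'I_m -> K) (a b : nat -> nat) A,
  (forall j : nat, (j < m)%N -> (b j + a (m - j.+1) = A)%N) -> (forall i : 'I_m, y i != 0) ->
  \det (\matrix_(i < m, j < m) y i ^+ b j) =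
    (-1) ^+ c * (\prod_i y i) ^+ A * \det (\matrix_(i < m, j < m) (y i)^-1 ^+ a j).
Proof.
pose s := perm (@rev_ord_inj m); exists (s^-1)%g => y a b A hab y0.
pose D : 'rV[K]_m := \row_i y i ^+ A.
have -> : \matrix_(i < m, j < m) y i ^+ b j =
    col_perm s (diag_mx D *m \matrix_(i < m, j < m) (y i)^-1 ^+ a j).
  rewrite mul_diag_mx; apply/matrixP => u t; rewrite !mxE permE /=.
  rewrite -(hab t (ltn_ord t)) exprD exprVn mulfK //.
  by rewrite expf_neq0.
rewrite col_permE !det_mulmx det_perm det_diag mulrC mulrA; congr (_ * _ * _).
by rewrite -prodrXl; apply: eq_bigr => u _; rewrite mxE.
Qed.

Lemma meval_alt k (v : 'I_k -> 'I_N) (a : nat -> nat) x :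
  (alternant K v a).@[x] = \det (\matrix_(i < k, j < k) x (v i) ^+ a j).
Proof.
rewrite /alternant -det_map_mx; congr (\det _); apply/matrixP => u t.
by rewrite !mxE rmorphXn /= mevalXU.
Qed.

(** [isrev] uses the product of all N variables, whence the power of those outside [V]. *)
Lemma isrev_S (V : {set 'I_N}) (n : seq nat) : #|V| = (size n).+1 ->
  exists c : nat, isrev (sumn n) (Sdiff K V n)
    ((-1) ^+ c * (varprod K (~: V) ^+ sumn n * Sdiff K V (rev n))).
Proof.
move=> cV; have [c hc] := det_rev #|V|; exists c => x x0.
rewrite !mevalM !rmorphXn rmorphN1 /= /Sdiff !meval_alt.
rewrite (hc _ (expo n) (expo (rev n)) (sumn n)) => [|j|u]; last exact: x0.
  have e : \prod_i x i = (varprod K (~: V)).@[x] * \prod_(i < #|V|) x (enum_val i).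
    rewrite (bigID (mem (~: V))) /= /varprod rmorph_prod /=; congr (_ * _).
      by apply: eq_bigr => i _; rewrite mevalXU.
    by rewrite -big_enum_val; apply: eq_bigl => i; rewrite inE negbK.
  rewrite e exprMn -!mulrA [LHS]mulrCA signrMK.
  by [].
rewrite cV ltnS => jn; rewrite subSS; exact: (expo_rev jn).
Qed.

Lemma mono_split (V : {set 'I_N}) : M = varprod K (~: V) * varprod K V.
Proof.
rewrite /varprod (bigID (mem (~: V))) /=; congr (_ * _); apply: eq_bigl => i.
  by rewrite !inE.
by rewrite !inE negbK.
Qed.

Lemma pprod_mono_setT (V : {set 'I_N}) k : pprods (is_var [set: 'I_N]) (varprod K V ^+ k).
Proof.
by apply: pprod_sub (pprod_mono K V k) => f [p _ ->]; exists p => //; rewrite inE.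
Qed.

Section Reversal.
Variables (V : {set 'I_N}) (n : seq nat) (d : nat).
Hypotheses (cV : #|V| = (size n).+1) (d0 : (0 < d)%N) (pn : all (ltn 0) n).
Local Notation is_quot := (@is_quot K N V).
Local Notation S := (@Sdiff K N V).
Local Notation mv := (varprod K (~: V)).

Let D := S (nseq (size n) d).

Let D_quot n' C : is_quot n' d C -> assoc (S n') (D * C).
Proof.
move/is_quotE => h; apply: (assoc_trans h); apply/assoc_mulr/assoc_sym.
exact: (S_nseq K0 d0 cV).
Qed.

Let unit_const (u : R) : u \is a GRing.unit -> isrev 0 u u.
Proof. by case/andP => /eqP e _; rewrite e; apply: isrevC. Qed.

(** The denominator [D] is its own reversal up to sign and variables outside [V], so it cancels from
    the two reversals of S(n) and only monomials f and g remain. *)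
Lemma quot_rev k C C' q : is_quot n d C -> is_quot (rev n) d C' -> isrev k C q ->
  exists f g s, [/\ pprods (is_var [set: 'I_N]) g, dvdr g (M ^+ s) &
    assoc (f * q) (g * C')].
Proof.
move=> hC hC' hq; have [u uu e] := D_quot hC; have [u' uu' e'] := D_quot hC'.
have [c1 h1] := isrev_S cV.
have cV2 : #|V| = (size (nseq (size n) d)).+1 by rewrite size_nseq.
have [c2] := isrev_S cV2; rewrite rev_nseq sumn_nseq => h2.
rewrite e in h1; have h3 := isrev_mul (unit_const uu) (isrev_mul h2 hq).
have {h1 h3} := isrev_uniq h1 h3.
set A := sumn n; set B := (d * size n)%N => E.
exists (M ^+ A * mv ^+ B), (M ^+ (0 + (B + k)) * mv ^+ A), (0 + (B + k) + A)%N.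
split.
- by apply: pprodM; apply: pprod_mono_setT.
- rewrite [X in dvdr _ X]exprD; apply: dvd_mul; first exact: dvd_refl.
  by rewrite (mono_split V) exprMn; apply/dvd_mulr/dvd_refl.
have D0 : D != 0 by apply: S_neq0; rewrite ?size_nseq //; apply: all_nseqP.
apply: (@assoc_cancel _ D) => //.
have sg c f : assoc ((-1) ^+ c * f) f by apply: assoc_sign.
have l1 : assoc (M ^+ (0 + (B + k)) * ((-1) ^+ c1 * (mv ^+ A * S (rev n))))
    (D * (M ^+ (0 + (B + k)) * mv ^+ A * C')).
  rewrite -[_ * mv ^+ A * C']mulrA [D * _]mulrCA; apply: assoc_mull.
  apply: (assoc_trans (sg _ _)); rewrite [D * _]mulrCA; apply: assoc_mull.
  by exists u'.
have l2 : assoc (M ^+ A * (u * ((-1) ^+ c2 * (mv ^+ B * D) * q)))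
    (D * (M ^+ A * mv ^+ B * q)).
  rewrite -[_ * mv ^+ B * q]mulrA [D * _]mulrCA; apply: assoc_mull.
  apply: (assoc_trans (assoc_unitl _ uu)); rewrite -mulrA.
  apply: (assoc_trans (sg _ _)); rewrite [mv ^+ B * D]mulrC -mulrA.
  exact: assoc_refl.
by apply: assoc_trans l1; apply: assoc_sym; rewrite E.
Qed.

Lemma X_ndvd_S i : ~ dvdr 'X_i (S n).
Proof.
move/dvd_var; have [iV|iV] := boolP (i \in V); last first.
  rewrite subst_free; last exact: free_S.
  by apply/eqP; apply: S_neq0.
case/lastP: n cV pn => [cV1 _|n' b]; last first.
  rewrite size_rcons all_rcons => cV' /andP[b0 pn'] /eqP; apply/negP.
  rewrite (assoc_neq0 (z_S K cV' iV pn' b0)) mulf_neq0 ?mono_neq0 //.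
  by apply: S_neq0 => //; apply: cardsD1_S.
move/eqP; apply/negP; rewrite (assoc_neq0 (subst_assoc i 0 (S_nil K cV1))).
by rewrite rmorph1 oner_neq0.
Qed.

(** The reversals of G and H multiply to C' up to monomials, so one of them divides a monomial by
    [pprod_irr], and then so does G or H itself. No variable divides C, because none divides S, so
    that factor is a unit. *)
Theorem quot_reversal : all (dvdn d) n ->
  (forall C, is_quot (rev n) d C -> irreducible_elt C) ->
  forall C, is_quot n d C -> C \isn't a GRing.unit -> irreducible_elt C.
Proof.
move=> dn irr C hC Cu; apply: irr_intro => [//|G H e].
have cV' : #|V| = (size (rev n)).+1 by rewrite size_rev.
have dn' : all (dvdn d) (rev n) by rewrite all_rev.
have [C' hC'] := ex_quot K0 d0 cV' dn'.
have [kG [qG hG]] := ex_rev G; have [kH [qH hH]] := ex_rev H.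
have hGH := isrev_mul hG hH; rewrite -e in hGH.
have [f [g [s [pg gs fg]]]] := quot_rev hC hC' hGH.
rewrite mulrA in fg.
have fin (A B q : R) k : A * B = C -> isrev k A q -> dvdr q g -> A \is a GRing.unit.
  move=> AB hq qg.
  have [t At] : exists t, dvdr A (M ^+ t).
    by apply: (isrev_dvd_mono hq); exists s; apply: dvd_trans gs.
  apply: (dvd_unit (q := 1)); last exact: unitr1.
  apply: (pprod_strip (pprod_mono_setT setT t)); last by rewrite mulr1.
  move=> _ [i _ ->] XA; apply: (@X_ndvd_S i).
  apply: (dvd_assocr (assoc_sym (D_quot hC))); apply: dvd_mull.
  by rewrite -AB; apply: dvd_mulr.
case: (pprod_irr pg (irr _ hC') fg) => [h|h]; [left|right].
- apply: (fin G H qG kG) => //.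
  by apply: dvd_trans h; apply/dvd_mull/dvd_refl.
- by apply: (fin H G qH kH) => //; rewrite mulrC.
Qed.

End Reversal.
End Torus.
Opaque varprod Sdiff alternant is_quot.

(** * Facets of a factorization *)

Definition gcds (s : seq nat) : nat := foldr gcdn 0%N s.

Lemma dvdn_gcds k s : (k %| gcds s)%N = all (dvdn k) s.
Proof. by elim: s => [|x s IH] /=; rewrite ?dvdn0 // dvdn_gcd IH. Qed.

Lemma gcds_dvd s : all (dvdn (gcds s)) s.
Proof. by rewrite -dvdn_gcds. Qed.

Lemma gcds_eqi s s' : s =i s' -> gcds s = gcds s'.
Proof.
move=> h; apply/eqP; rewrite eqn_dvd !dvdn_gcds.
by rewrite (eq_all_r h) gcds_dvd -(eq_all_r h) gcds_dvd.
Qed.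

Lemma gcds_rev s : gcds (rev s) = gcds s.
Proof. by apply: gcds_eqi => x; rewrite mem_rev. Qed.

Lemma gcds_gt0 x s : all (ltn 0) (x :: s) -> (0 < gcds (x :: s))%N.
Proof. by move=> /= /andP[x0 _]; rewrite gcdn_gt0 x0. Qed.

Lemma gcds_rcons s b : gcds (rcons s b) = gcdn (gcds s) b.
Proof.
by elim: s => [|x s IH] /=; [rewrite gcdnC|rewrite IH gcdnA].
Qed.

(** Write e = sd and e' = td with s and t coprime. The members of m are multiples of lcm(e, e') =
    std, and std - (sd + td - d) = (s - 1)(t - 1)d >= 0. The bound on the sum forces equality, so s
    = 1 or t = 1. *)
Lemma mid_shape e e' d m : (0 < d)%N -> (0 < size m)%N -> all (ltn 0) m ->
  all (dvdn e) m -> all (dvdn e') m -> gcdn e e' = d ->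
  (sumn m <= size m * (e + e' - d))%N ->
  (e' = d /\ m = nseq (size m) e) \/ (e = d /\ m = nseq (size m) e').
Proof.
move=> d0 m0 pm em em' gd hs.
have de : (d %| e)%N by rewrite -gd dvdn_gcdl.
have de' : (d %| e')%N by rewrite -gd dvdn_gcdr.
have key x : x \in m -> ((e + e' - d) <= x)%N /\
    ((x <= e + e' - d)%N -> e = d \/ e' = d).
  move=> xm; have x0 := allP pm _ xm; have ex := allP em _ xm; have ex' := allP em' _ xm.
  have lx : (lcmn e e' %| x)%N by rewrite dvdn_lcm ex ex'.
  have hl : (lcmn e e' * d = e * e')%N by rewrite -gd muln_lcm_gcd.
  have lex := dvdn_leq x0 lx.
  case/dvdnP: de => s es; case/dvdnP: de' => t et.
  have s0 : (0 < s)%N by case: (s) es ex x0 => // ->; rewrite mul0n dvd0n => /eqP ->.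
  have t0 : (0 < t)%N by case: (t) et ex' x0 => // ->; rewrite mul0n dvd0n => /eqP ->.
  have el : lcmn e e' = (s * t * d)%N.
    apply/eqP; rewrite -(eqn_pmul2r d0) hl es et; apply/eqP; ring.
  rewrite el es et in lex *.
  case: s s0 lex {es el} => // s _; case: t t0 {et} => // t _ lex.
  have e1 : (s.+1 * t.+1 * d = s.+1 * d + t.+1 * d - d + s * t * d)%N.
    by rewrite !mulSn !mulnDl ?mulnS !mulnDl; lia.
  split; first by move: lex; rewrite e1; clear; lia.
  move=> xl; have st : (s * t * d = 0)%N by move: lex xl; rewrite e1; clear; lia.
  move: st => /eqP; rewrite !muln_eq0 (gtn_eqF d0) orbF.
  by case/orP => /eqP ->; rewrite mul1n; [left|right].
have hm := eq_nseq_leq (_ : all (leq (e + e' - d)) m) hs.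
have {}hm : m = nseq (size m) (e + e' - d)%N by apply: hm; apply/allP => x /key [].
have xm : (e + e' - d)%N \in m by rewrite hm mem_nseq eqxx andbT.
have [_ /(_ (leqnn _))] := key _ xm.
case=> ed; [right|left]; split=> //; rewrite {1}hm ed; congr nseq.
  by rewrite addKn.
by rewrite addnK.
Qed.

Section Induction.
Variables (K : closedFieldType) (N : nat).
Hypothesis K0 : forall m, (m.+1)%:R != 0 :> K.
Local Notation R := {mpoly K[N]}.
Local Notation T := (@linforms K N).
Local Notation Lq := (@lincompl K N).
Local Notation mono := (@varprod K N).
Local Notation z i := (subst i 0).
Implicit Types (V W : {set 'I_N}) (n : seq nat) (p q i j l : 'I_N) (w : K).
Implicit Types (f g h G H C : R).

Lemma quot_nonunit V n d C : (0 < d)%N -> (0 < size n)%N -> #|V| = (size n).+1 ->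
  all (ltn 0) n -> all (dvdn d) n -> n <> nseq (size n) d -> is_quot V n d C ->
  C \isn't a GRing.unit.
Proof.
move=> d0 n0 cV pn dn nn hC; apply/negP => Cu.
have [i iV] : exists i, i \in V by apply/card_gt0P; rewrite cV.
have := dg_quot K0 d0 hC cV pn iV; rewrite (dg_unit i Cu) add0n => e.
by apply: nn; apply: eq_nseq_sum.
Qed.

(** Constant differences mean lambda = d(lambda) rho. The quantifier over [V] is what lets the
    facets, on smaller sets, use the statement. *)
Definition irr_card m := forall V n, #|V| = m -> #|V| = (size n).+1 ->
  all (ltn 0) n -> n <> nseq (size n) (gcds n) ->
  forall C, is_quot V n (gcds n) C -> irreducible_elt C.

Lemma irr_rev V n d : (0 < size n)%N -> #|V| = (size n).+1 -> all (ltn 0) n ->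
  n <> nseq (size n) d -> d = gcds n ->
  (forall C, is_quot V (rev n) d C -> irreducible_elt C) ->
  forall C, is_quot V n d C -> irreducible_elt C.
Proof.
move=> n0 cV pn nn ed irr C hC.
have d0 : (0 < d)%N by rewrite ed; case: (n) n0 pn => // x s _; apply: gcds_gt0.
have dn : all (dvdn d) n by rewrite ed gcds_dvd.
apply: (quot_reversal K0 cV d0 pn dn irr hC).
exact: (quot_nonunit d0 n0 cV pn dn nn hC).
Qed.

Lemma irr_card3 : irr_card 3.
Proof.
move=> V n cV; rewrite cV => -[] sn.
case: n sn => [|n1 [|n2 [|//]]] // _ pn nn C hC.
set d := gcds [:: n1; n2] in nn hC.
have d0 : (0 < d)%N by apply: gcds_gt0.
have /and3P[d1 d2 _] : all (dvdn d) [:: n1; n2] by apply: gcds_dvd.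
have /and3P[p1 p2 _] := pn.
have gd : gcdn n1 n2 = d by rewrite /d /= gcdn0.
have gd' : gcdn n2 n1 = d by rewrite gcdnC.
(* Up to reversal either d < m1 <= m2, or m2 = d and m1 is a proper multiple of d. *)
have main m1 m2 (B : R) : (d %| m1)%N -> (d %| m2)%N -> (0 < m1)%N -> (0 < m2)%N ->
    gcdn m1 m2 = d -> (d < m1)%N -> (d <= m2)%N -> (m1 <= m2)%N \/ m2 = d ->
    is_quot V [:: m1; m2] d B -> irreducible_elt B.
  move=> e1 e2 q1 q2 gm lt1 le2 [le12|ed] hB.
    exact: (three_irr K0 cV d0 e1 e2 q1 q2 gm lt1 le12 hB).
  have [t et] := dvdnP e1; rewrite et ed in hB.
  apply: (three_complete_irr K0 cV _ d0 hB).
  by move: lt1; rewrite et -{1}[d]mul1n ltn_pmul2r.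
have le1 := dvdn_leq p1 d1; have le2 := dvdn_leq p2 d2.
have rv : (forall B : R, is_quot V [:: n2; n1] d B -> irreducible_elt B) -> irreducible_elt C.
  move=> irr; apply: (@irr_rev V [:: n1; n2] d _ _ pn nn _ _ C hC) => //.
case: (leqP n1 n2) => le12.
  have := le1; rewrite leq_eqVlt => /orP [/eqP e1|lt1].
    apply: rv => B hB; apply: (main n2 n1 B) => //; last by right.
    by rewrite ltn_neqAle le2 andbT; apply/negP => /eqP e2; apply: nn; rewrite /= -e1 -e2.
  by apply: (main n1 n2 C) => //; left.
have := le2; rewrite leq_eqVlt => /orP [/eqP e2|lt2].
  by apply: (main n1 n2 C) => //; [rewrite e2|right].
by apply: rv => B hB; apply: (main n2 n1 B) => //; left; apply: ltnW.
Qed.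

Lemma pprod_irr_unit P f (p : R) g h : pprods P f ->
  irreducible_elt p \/ p \is a GRing.unit -> assoc (g * h) (f * p) ->
  dvdr g f \/ dvdr h f.
Proof.
move=> Pf [ip|pu] gh; first exact: (pprod_irr Pf ip gh).
left; apply: (dvd_trans (q := g * h)); first exact/dvd_mulr/dvd_refl.
apply: dvd_trans (assoc_dvd gh) _; rewrite mulrC.
exact/assoc_dvd/assoc_unitl.
Qed.

(** A facet may have constant differences although the whole has not; its quotient is then a
    unit. *)
Lemma irr_or_unit m V n C : irr_card m -> #|V| = m -> (0 < size n)%N -> #|V| = (size n).+1 ->
  all (ltn 0) n -> is_quot V n (gcds n) C ->
  irreducible_elt C \/ C \is a GRing.unit.
Proof.
move=> irr cm n0 cV pn hC.
have [e|ne] := eqVneq n (nseq (size n) (gcds n)); [right|left].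
  have g0 : (0 < gcds n)%N by case: (n) n0 pn => // x s _; apply: gcds_gt0.
  move/is_quotE: hC; rewrite {1}e => h.
  have := assoc_trans (assoc_sym h) (S_nseq K0 g0 cV).
  rewrite -[X in assoc _ X]mulr1 => /(assoc_cancel (T_neq0 K V _)) /assoc_unit ->.
  exact: unitr1.
by apply: (irr V n cm cV pn _ C hC); apply/eqP.
Qed.

Transparent varprod.
Lemma mono_split1 W i : i \in W -> 'X_i * mono (W :\ i) = mono W.
Proof. by move=> iW; rewrite /varprod [RHS](big_setD1 i). Qed.

Lemma mono_set0 : mono set0 = 1.
Proof. by rewrite /varprod big_set0. Qed.

Lemma free_mono W i : i \notin W -> freeof i (mono W).
Proof.
move=> iW; apply: free_prod => p pW; apply: freeX.
by apply: contraNneq iW => <-.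
Qed.

Opaque varprod.

(** * Distribution of the facets between two factors *)

Section Facets.
Variables (V : {set 'I_N}) (a b : nat) (mid : seq nat).
Local Notation n := (a :: rcons mid b).
Local Notation d := (gcds n).
Local Notation e := (gcds (a :: mid)).
Local Notation e' := (gcds (rcons mid b)).
Hypotheses (cV : #|V| = (size mid).+3) (mid0 : (0 < size mid)%N) (pn : all (ltn 0) n).
Hypothesis IH : irr_card (size mid).+2.

Let pm : all (ltn 0) mid. Proof. by move: pn; rewrite /= all_rcons => /and3P[]. Qed.
Let a0 : (0 < a)%N. Proof. by move: pn; rewrite /= => /andP[]. Qed.
Let b0 : (0 < b)%N. Proof. by move: pn; rewrite /= all_rcons => /and3P[]. Qed.
Let pnm : all (ltn 0) (a :: mid). Proof. by rewrite /= a0. Qed.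
Let pnp : all (ltn 0) (rcons mid b). Proof. by rewrite all_rcons; apply/andP; split; [exact: b0|exact: pm]. Qed.
Lemma facet_d0 : (0 < d)%N. Proof. exact: gcds_gt0. Qed.
Lemma facet_e0 : (0 < e)%N. Proof. exact: gcds_gt0. Qed.
Lemma facet_e'0 : (0 < e')%N.
Proof. by rewrite gcds_rcons gcdn_gt0 b0 orbT. Qed.
Lemma facet_de : (d %| e)%N.
Proof.
by rewrite -rcons_cons gcds_rcons dvdn_gcdl.
Qed.
Lemma facet_de' : (d %| e')%N. Proof. by rewrite dvdn_gcdr. Qed.
Lemma facet_db : (d %| b)%N.
Proof. by rewrite -rcons_cons gcds_rcons dvdn_gcdr. Qed.
Lemma facet_gcd : gcdn e e' = d.
Proof.
apply/eqP; rewrite eqn_dvd dvdn_gcd facet_de facet_de' !andbT dvdn_gcds /= all_rcons.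
have h1 := gcds_dvd (a :: mid); have h2 := gcds_dvd (rcons mid b).
move: h1 h2; rewrite /= all_rcons => /andP[ha hm] /andP[hb _].
rewrite (dvdn_trans (dvdn_gcdl _ _) ha) (dvdn_trans (dvdn_gcdr _ _) hb) /=.
by apply/allP => x xm; apply: dvdn_trans (dvdn_gcdl _ _) (allP hm _ xm).
Qed.
Let d0 := facet_d0. Let e0 := facet_e0. Let e'0 := facet_e'0.
Let de := facet_de. Let de' := facet_de'.
Let db : (d <= b)%N. Proof. exact: (dvdn_leq b0 facet_db). Qed.

Lemma card_facet i : i \in V -> #|V :\ i| = (size mid).+2.
Proof. exact: cardsD1_S. Qed.

Lemma minus_facet i : i \in V -> exists Cm,
  [/\ is_quot (V :\ i) (a :: mid) e Cm,
      irreducible_elt Cm \/ Cm \is a GRing.unit &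
      forall C, is_quot V n d C ->
        assoc (z i C) (mono (V :\ i) ^+ (b - d) * (Lq (V :\ i) e d * Cm))].
Proof.
move=> iV; have cVi := card_facet iV.
have [Cm hm] := ex_quot K0 e0 (n := a :: mid) cVi (gcds_dvd _).
exists Cm; split=> //.
  exact: (irr_or_unit (n := a :: mid) IH cVi _ cVi pnm hm).
move=> C hC.
exact: (z_quot2 K0 d0 (n := a :: mid) hC cV pnm b0 db iV e0 de hm).
Qed.

Lemma plus_facet j : j \in V -> exists Cp,
  [/\ is_quot (V :\ j) (rcons mid b) e' Cp,
      irreducible_elt Cp \/ Cp \is a GRing.unit &
      forall C, is_quot V n d C -> assoc (lc j C) (Lq (V :\ j) e' d * Cp)].
Proof.
move=> jV; have cVj := card_facet jV.
have cVj' : #|V :\ j| = (size (rcons mid b)).+1 by rewrite size_rcons.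
have [Cp hp] := ex_quot K0 e'0 cVj' (gcds_dvd _).
exists Cp; split=> //.
  by apply: (irr_or_unit IH cVj _ cVj' pnp hp); rewrite size_rcons.
move=> C hC; apply: (quot_split K0 e'0 de' hp).
by apply: (lc_quot d0 hC _ pn jV); rewrite size_rcons.
Qed.

(** For a factor f of C, small means that f takes only variables and linear forms from the facet,
    while the quotient known by induction goes to the other factor. *)
Definition small_z i f := dvdr (z i f) (mono (V :\ i) ^+ (b - d) * Lq (V :\ i) e d).
Definition small_lc j f := dvdr (lc j f) (Lq (V :\ j) e' d).

Lemma smz_or G H i : is_quot V n d (G * H) -> i \in V -> small_z i G \/ small_z i H.
Proof.
move=> hC iV; have [Cm [_ irr h]] := minus_facet iV.
have := h _ hC; rewrite substM mulrA; apply: (pprod_irr_unit (P := fun=> True)) => //.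
by apply: pprodM; [apply: pprod_sub (pprod_mono K _ _)|apply: pprod_sub (pprod_Lq K _ _ _)].
Qed.

Lemma sml_or G H j : is_quot V n d (G * H) -> j \in V -> small_lc j G \/ small_lc j H.
Proof.
move=> hC jV; have [Cp [_ irr h]] := plus_facet jV.
have := h _ hC; rewrite lcM; apply: (pprod_irr_unit (P := fun=> True)) => //.
by apply: pprod_sub (pprod_Lq K _ _ _).
Qed.

Lemma z_lc_neq0 C i j : is_quot V n d C -> i \in V -> j \in V -> i != j ->
  z i (lc j C) != 0.
Proof.
move=> hC iV jV ij.
have h : is_quot (V :\ j) (rcons mid b) d (lc j C).
  by apply: (lc_quot d0 hC _ pn jV); rewrite size_rcons.
have iVj : i \in V :\ j by rewrite !inE ij.
have h2 := z_quot K0 d0 h (card_facet jV) pm b0 db iVj.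
have : T (V :\ j :\ i) d * z i (lc j C) != 0.
  rewrite -(assoc_neq0 h2) mulf_neq0 ?mono_neq0 // S_neq0 //.
  exact: cardsD1_S (card_facet jV) iVj.
by rewrite mulf_eq0 negb_or => /andP[].
Qed.

Lemma z_lc_neq0r G H i j : is_quot V n d (G * H) -> i \in V -> j \in V -> i != j ->
  z i (lc j H) != 0.
Proof.
move=> hC iV jV ij; apply: dvd_neq0 (z_lc_neq0 hC iV jV ij).
by apply/subst_dvd/lc_dvd/dvd_mull/dvd_refl.
Qed.

Lemma all_small G H : is_quot V n d (G * H) ->
  (forall i, i \in V -> small_z i H) -> (forall j, j \in V -> small_lc j H) ->
  H \is a GRing.unit.
Proof.
move=> hC sz sl; have c4 : (3 < #|V|)%N by rewrite cV !ltnS.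
apply: (small_unit c4 e0 e'0 de de' facet_gcd _ sz sl).
by move=> i j; apply: z_lc_neq0r hC.
Qed.

(** Smallness spreads: a G that is small at x_x = 0 is small in all other leading coefficients,
    hence at every x_i = 0, hence in the leading coefficient in x_x too. Then [all_small]
    applies. *)
Lemma facet_split :
  (forall G H i j, is_quot V n d (G * H) -> i \in V -> j \in V -> i != j ->
     small_z i G -> small_lc j H -> False) ->
  forall G H, is_quot V n d (G * H) -> G \is a GRing.unit \/ H \is a GRing.unit.
Proof.
move=> no.
have [x xV] : exists i, i \in V by apply/card_gt0P; rewrite cV.
have main G H : is_quot V n d (G * H) -> small_z x G -> G \is a GRing.unit.
  move=> hC szx; have hC' : is_quot V n d (H * G) by rewrite mulrC.
  have l1 j : j \in V -> j != x -> small_lc j G.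
    move=> jV jx; case: (sml_or hC jV) => h; first exact: h.
    by case: (no G H x j hC xV jV _ szx h); rewrite eq_sym.
  have z1 i : i \in V -> small_z i G.
    move=> iV; case: (smz_or hC iV) => h; first exact: h.
    have [|j jV] := @pick_out _ V [:: i; x]; first by rewrite cV.
    rewrite !inE negb_or => /andP[ji jx].
    by case: (no H G i j hC' iV jV _ h (l1 j jV jx)); rewrite eq_sym.
  apply: (all_small hC' z1) => j jV; case: (sml_or hC jV) => h; first exact: h.
  have [|i iV] := @pick_out _ V [:: j]; first by rewrite cV.
  rewrite !inE => ij; by case: (no G H i j hC iV jV ij (z1 i iV) h).
move=> G H hC; case: (smz_or hC xV) => h; [left|right].
  exact: (main G H hC h).
by apply: (main H G) h; rewrite mulrC.
Qed.

(* The middle differences are multiples of lcm(e, e'), and the degrees force them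
   to be at most e + e' - d on average. *)
Lemma opposite_shape G H i j : is_quot V n d (G * H) -> i \in V -> j \in V -> i != j ->
  small_z i G -> small_lc j H ->
  (e' = d /\ mid = nseq (size mid) e) \/ (e = d /\ mid = nseq (size mid) e').
Proof.
move=> hC iV jV ij sG sH; have ji : j != i by rewrite eq_sym.
have cVj := card_facet jV; have cVi := card_facet iV.
have iVj : i \in V :\ j by rewrite !inE ij.
have jVi : j \in V :\ i by rewrite !inE ji.
have eW : V :\ i :\ j = V :\ j :\ i by rewrite !setDDl setUC.
set W := V :\ j :\ i in eW.
have cW : #|W| = (size mid).+1 by apply: cardsD1_S iVj.
have dmid : all (dvdn d) mid.
  by have := gcds_dvd n; rewrite /= all_rcons => /and3P[].
(* The corner common to both facets has the differences [mid]; its quotient [Q] must consist of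
   linear forms from the two small parts. *)
have [Q hQ] := ex_quot K0 d0 cW dmid.
have hl : is_quot (V :\ j) (rcons mid b) d (lc j (G * H)).
  by apply: (lc_quot d0 hC _ pn jV); rewrite size_rcons.
have h1 : assoc (mono W ^+ (b - d) * Q) (z i (lc j (G * H))).
  apply: (@assoc_cancel _ (T W d)); first exact: T_neq0.
  rewrite mulrCA; apply: assoc_trans (z_quot K0 d0 hl cVj pm b0 db iVj).
  by apply/assoc_mull/assoc_sym; apply/is_quotE.
have Gn : z i (lc j G) != 0.
  by apply: (@z_lc_neq0r H G i j); rewrite // mulrC.
have lmono k : lc j (mono (V :\ i) ^+ k) = mono W ^+ k.
  rewrite lcX -(mono_split1 jVi) lcM eW; congr (_ ^+ _).
  rewrite [lc j (mono W)]lc_free; last first.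
    by rewrite -eW; apply: free_mono; rewrite !inE eqxx.
  by rewrite lcE upolyX lead_coefX mul1r.
have dG : dvdr (z i (lc j G)) (mono W ^+ (b - d) * Lq W e d).
  have [<- _] := lc_z ij Gn; apply: dvd_trans (lc_dvd j sG) _.
  rewrite lcM lmono; apply/dvd_mul; first exact: dvd_refl.
  by rewrite -eW; apply/assoc_dvd; apply: lc_L.
have dH : dvdr (z i (lc j H)) (mono W ^+ (e' - d) * Lq W e' d).
  apply: dvd_trans (subst_dvd i 0 sH) _; apply: assoc_dvd.
  by apply: z_Lq => //; rewrite cVj.
have dQ : dvdr Q (Lq W e d * Lq W e' d).
  apply: (pprod_strip (pprod_mono K W (b - d + (e' - d)))).
    move=> _ [u _ ->] uQ; apply: (X_ndvd_S cW pm (i := u)).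
    apply: (dvd_assocr (assoc_sym (proj1 (is_quotE _ _ _ _) hQ))).
    exact: dvd_mull.
  have h2 : dvdr (mono W ^+ (b - d) * Q) (z i (lc j G) * z i (lc j H)).
    by rewrite -substM -lcM; apply: assoc_dvd.
  have h3 := dvd_trans h2 (dvd_mul dG dH).
  rewrite mulrACA -exprD in h3.
  by apply: dvd_trans h3; apply/dvd_mull/dvd_refl.
have [t tW] : exists t, t \in W by apply/card_gt0P; rewrite cW.
have := dg_dvd t dQ (mulf_neq0 (Lq_neq0 K W e d) (Lq_neq0 K W e' d)).
rewrite dgM ?Lq_neq0 // !dg_Lq // cW /= => hd.
have hs := dg_quot K0 d0 hQ cW pm tW.
have em : all (dvdn e) mid by have := gcds_dvd (a :: mid) => /= /andP[].
have em' : all (dvdn e') mid.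
  by have := gcds_dvd (rcons mid b); rewrite all_rcons => /andP[].
apply: (mid_shape d0 mid0 pm em em' facet_gcd).
have le := dvdn_leq e0 de; have le' := dvdn_leq e'0 de'.
have ed : (e + e' - d = (e - d) + (e' - d) + d)%N by move: le le'; clear; lia.
by rewrite -hs ed !mulnDr leq_add2r.
Qed.

End Facets.

End Induction.

(** * Constant leading differences *)

Lemma pprod_divisor (D : idomainType) (P : D -> Prop) (f g : D) :
  pprods P f -> dvdr g f -> pprods (fun p => P p /\ dvdr p g) g.
Proof.
move=> Pf; elim: Pf g => [u uu|p k pp Pp _ IH] g.
  by move=> /dvd_unit /(_ uu) gu; apply: pprod_unit.
have [p0 _ pq] := pp; move=> [r er].
have : dvdr p (r * g) by rewrite -er; apply/dvd_mulr/dvd_refl.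
case/pq => [[s es]|[s es]].
  apply: IH; exists s; apply: (mulfI p0).
  by rewrite er es [s * p]mulrC mulrA.
have {er} er : k = r * s by apply: (mulfI p0); rewrite er es mulrA mulrC.
rewrite es mulrC; apply: (pprod_cons pp).
  by split; [exact: Pp|apply/dvd_mulr/dvd_refl].
apply: (pprod_sub _ (IH s _)); last by exists r.
by move=> x [Px xs]; split; [exact: Px|apply: dvd_mull].
Qed.

Section BadShapes.
Variables (K : closedFieldType) (N : nat).
Hypothesis K0 : forall m, (m.+1)%:R != 0 :> K.
Local Notation R := {mpoly K[N]}.
Local Notation Lq := (@lincompl K N).
Local Notation mono := (@varprod K N).
Local Notation z i := (subst i 0).
Implicit Types (V W : {set 'I_N}) (n : seq nat) (p q i j l t u : 'I_N) (w : K).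
Implicit Types (f g h G H C : R).

Lemma X_ndvd_z i j p f : i != j -> p != j -> lc j f \is a GRing.unit ->
  ~ dvdr 'X_p (z i f).
Proof.
move=> ij pj fu /(lc_dvd j); rewrite lc_free; last exact: freeX.
by apply: X_ndvd_unit; apply: (lc_z_unit ij fu).1.
Qed.

Lemma lin_ndvd_z i j p q w f : i != j -> p != q -> j != p -> j != q ->
  lc j f \is a GRing.unit -> ~ dvdr (lin p q w) (z i f).
Proof.
move=> ij pq jp jq fu /(lc_dvd j); rewrite lc_lin //.
by apply: (lin_ndvd_unit pq); apply: (lc_z_unit ij fu).1.
Qed.

Lemma Lq_diag W d : (0 < d)%N -> Lq W d d = 1.
Proof.
move=> d0; apply: (mulfI (T_neq0 K W d)).
by rewrite mulr1 -(T_split K0) // dvdnn.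
Qed.

Lemma dg_pprod0 i P f : pprods P f -> (forall r : R, P r -> dg i r = 0%N) -> dg i f = 0%N.
Proof.
move=> Pf hP; elim: Pf => [u uu|p k [p0 _ _] Pp Pk IH]; first exact: dg_unit.
by rewrite dgM ?(pprod_neq0 Pk) // hP.
Qed.

Section Context.
Variables (V : {set 'I_N}) (a b : nat) (mid : seq nat).
Local Notation n := (a :: rcons mid b).
Local Notation d := (gcds n).
Local Notation e := (gcds (a :: mid)).
Local Notation e' := (gcds (rcons mid b)).
Hypotheses (cV : #|V| = (size mid).+3) (mid0 : (0 < size mid)%N) (pn : all (ltn 0) n).
Hypothesis IH : @irr_card K N (size mid).+2.
Hypothesis e'd : e' = d.
Local Notation sml := (@small_lc K N V a b mid).

Let d0 : (0 < d)%N. Proof. exact: facet_d0. Qed.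
Let e0 : (0 < e)%N. Proof. exact: facet_e0 pn. Qed.
Let c3 : (2 < #|V|)%N. Proof. by rewrite cV. Qed.
Let c4 : (3 < #|V|)%N. Proof. by rewrite cV. Qed.

(** For e' = d there is no form with w^e' = 1 and w^d <> 1. *)
Lemma sml_unit j f : sml j f -> lc j f \is a GRing.unit.
Proof.
rewrite /small_lc e'd (Lq_diag _ d0) => /dvd_unit; apply; exact: unitr1.
Qed.

Lemma lc_unit_or G H j : is_quot V n d (G * H) -> j \in V ->
  lc j G \is a GRing.unit \/ lc j H \is a GRing.unit.
Proof. by move=> hC jV; case: (sml_or K0 cV pn IH hC jV) => /sml_unit; [left|right]. Qed.

(** * The shape (e, ..., e, b) *)

Section ConstantHead.
Hypothesis hz : forall i C, i \in V -> is_quot V n d C ->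
  assoc (z i C) (mono (V :\ i) ^+ (b - d) * Lq (V :\ i) e d).
Hypothesis big : (d < b)%N \/ (d < e)%N.

Let quotC G H : is_quot V n d (G * H) -> is_quot V n d (H * G).
Proof. by rewrite mulrC. Qed.

(* No prime divisor of [z i G] involves x_t, as its leading coefficient in x_x
   or in x_y would not be constant. *)
Lemma dg_side G H x y t i : is_quot V n d (G * H) -> x \in V -> y \in V -> i \in V ->
  t \in V -> x != y -> i != x -> i != y -> i != t -> t != x -> t != y ->
  lc x G \is a GRing.unit -> lc y G \is a GRing.unit -> dg t G = 0%N.
Proof.
move=> hC xV yV iV tV xy ix iy it tx ty ux uy.
have [_ <-] := lc_z it (z_lc_neq0r K0 cV pn (quotC hC) iV tV it).
have dz : dvdr (z i G) (mono (V :\ i) ^+ (b - d) * Lq (V :\ i) e d).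
  apply: dvd_trans (assoc_dvd (hz iV hC)).
  by rewrite substM; apply/dvd_mulr/dvd_refl.
have pp : pprods (fun f : R => is_var (V :\ i) f \/
    is_lin (V :\ i) e (fun w => w ^+ d != 1) f)
    (mono (V :\ i) ^+ (b - d) * Lq (V :\ i) e d).
  apply: pprodM; first by apply: pprod_sub (pprod_mono K _ _) => f h; left.
  by apply: pprod_sub (pprod_Lq K _ _ _) => f h; right.
apply: (dg_pprod0 (pprod_divisor pp dz)) => _ [[[u _ ->]|[p [q [w [Wpq _ _ ->]]]]] h].
  apply: dg_free; apply: freeX; apply/eqP => ut.
  by rewrite ut in h; apply: (X_ndvd_z ix tx ux h).
have npq := pairs_neq Wpq.
have hx := lin_ndvd_z ix npq _ _ ux h; have hy := lin_ndvd_z iy npq _ _ uy h.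
apply: dg_free; apply: freeD; first apply: freeX.
  apply/eqP => pt; rewrite pt in hx hy npq.
  have [xq|xq] := eqVneq x q; last by apply: hx; rewrite // eq_sym.
  by apply: hy; rewrite 1?eq_sym -?xq.
apply/freeN/freeM; [exact: freeC|apply: freeX].
apply/eqP => qt; rewrite qt in hx hy npq.
have [xp|xp] := eqVneq x p; last by apply: hx; rewrite // eq_sym.
by apply: hy; rewrite 1?eq_sym -?xp.
Qed.

(** The facet contains a prime with x_t but without x_j: x_t itself if d < b, a form in x_t and a
    further variable if d < e. As lc j H is a unit, this prime does not divide z i H, so it divides
    z i G. *)
Lemma dg_pos G H t j : is_quot V n d (G * H) -> t \in V -> j \in V -> t != j ->
  lc j H \is a GRing.unit -> (0 < dg t G)%N.
Proof.
move=> hC tV jV tj uj.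
have [i iV] := @pick_out _ V [:: t; j] c3; rewrite !inE negb_or => /andP[it ij].
have [x xV] := @pick_out _ V [:: t; j; i] c4.
rewrite !inE !negb_or => /and3P[xt xj xi].
have G0 : z i G != 0.
  have nz := z_lc_neq0r K0 cV pn (quotC hC) iV tV it.
  by rewrite -(lc_eq0 t) (lc_z it nz).1.
have zC := hz iV hC; rewrite substM in zC.
have fin (pi : R) : prime_elt pi -> dvdr pi (mono (V :\ i) ^+ (b - d) * Lq (V :\ i) e d) ->
    ~ dvdr pi (z i H) -> dg t pi = 1%N -> (0 < dg t G)%N.
  move=> [_ _ pp] /(dvd_assocr (assoc_sym zC)) /pp [|//] piG nH d1.
  apply: (@leq_trans (dg t (z i G))); last by apply: dg_subst_le; [|apply: free0].
  by rewrite -d1; apply: dg_dvd.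
case: big => [db|lt].
  apply: (fin _ (prime_var K t)); last exact: dg_X.
    apply: dvd_mulr; rewrite -(prednK (_ : 0 < b - d)%N) ?subn_gt0 // exprS.
    apply: dvd_mulr; rewrite -(mono_split1 K (W := V :\ i) (i := t)); last by rewrite !inE eq_sym it.
    exact/dvd_mulr/dvd_refl.
  by apply: X_ndvd_z uj.
have [|w we wd] := exists_rts K0 (b := d) e0.
  by apply/negP => /(dvdn_leq d0); rewrite leqNgt lt.
have w0 := rts_neq0 e0 we.
have main p q : pairs (V :\ i) (p, q) -> j != p -> j != q -> (t == p) || (t == q) ->
    (0 < dg t G)%N.
  move=> Wpq jp jq tpq; have npq := pairs_neq Wpq.
  apply: (fin _ (prime_lin_form w npq)).
  - by apply/dvd_mull; apply: L_dvd_lin.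
  - exact: lin_ndvd_z uj.
  - by have [] := lc_lin_unit (N := N) npq w0 tpq.
case: (ltngtP t x) => h; last by case/eqP: xt; apply: val_inj.
  apply: (main t x); rewrite ?eqxx // 1?eq_sym //.
  by rewrite /pairs /= !inE eq_sym it tV xi xV.
apply: (main x t); rewrite ?eqxx ?orbT // 1?eq_sym //.
by rewrite /pairs /= !inE xi xV [t == i]eq_sym it tV.
Qed.

Lemma two_sides G H x y j : is_quot V n d (G * H) -> x \in V -> y \in V -> j \in V ->
  x != y -> lc x G \is a GRing.unit -> lc y G \is a GRing.unit ->
  lc j H \is a GRing.unit -> False.
Proof.
move=> hC xV yV jV xy ux uy uj.
have [t tV] := @pick_out _ V [:: x; y; j] c4.
rewrite !inE !negb_or => /and3P[tx ty tj].
have [i iV] := @pick_out _ V [:: x; y; t] c4.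
rewrite !inE !negb_or => /and3P[ix iy it].
have := dg_pos hC tV jV tj uj.
by rewrite (dg_side hC xV yV iV tV xy ix iy it tx ty ux uy).
Qed.

Lemma constant_head_unit G H : is_quot V n d (G * H) ->
  (forall j, j \in V -> lc j H \is a GRing.unit) -> H \is a GRing.unit.
Proof.
move=> hC u; apply: (all_small K0 cV mid0 pn hC) => [i iV|j jV].
  apply: dvd_trans (assoc_dvd (hz iV hC)).
  by rewrite substM; apply/dvd_mull/dvd_refl.
exact: unit_dvd (u j jV).
Qed.

(** If neither factor is a unit, each has a unit leading coefficient in some variable. Among three
    variables two belong to the same factor in this sense, which [two_sides] excludes. *)
Lemma constant_head_split G H : is_quot V n d (G * H) ->
  G \is a GRing.unit \/ H \is a GRing.unit.
Proof.
move=> hC; have hC' := quotC hC.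
have all_or (A B : R) : is_quot V n d (A * B) ->
    B \is a GRing.unit \/ exists2 j, j \in V & lc j A \is a GRing.unit.
  move=> h; have [/forall_inP uB|] := boolP [forall (j | j \in V), lc j B \is a GRing.unit].
    by left; apply: (constant_head_unit h) => j jV; apply: uB.
  rewrite negb_forall_in => /exists_inP [j jV nB]; right; exists j; first exact: jV.
  case: (lc_unit_or h jV) => u; first exact: u.
  case: (negP nB); exact: u.
case: (all_or G H hC) => [?|[j jV uj]]; first by right.
case: (all_or H G hC') => [?|[k kV uk]]; first by left.
exfalso.
have [x xV _] := @pick_out _ V [::] (ltnW (ltnW c3)).
have [y yV] := @pick_out _ V [:: x] (ltnW c3); rewrite inE => yx.
have [u uV] := @pick_out _ V [:: x; y] c3; rewrite !inE negb_or => /andP[ux uy].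
have sG p q : p \in V -> q \in V -> p != q -> lc p G \is a GRing.unit ->
    lc q G \is a GRing.unit -> False.
  by move=> pV qV pq h1 h2; apply: (two_sides hC pV qV kV pq h1 h2 uk).
have sH p q : p \in V -> q \in V -> p != q -> lc p H \is a GRing.unit ->
    lc q H \is a GRing.unit -> False.
  by move=> pV qV pq h1 h2; apply: (two_sides hC' pV qV jV pq h1 h2 uj).
case: (lc_unit_or hC xV) => hx; case: (lc_unit_or hC yV) => hy;
  case: (lc_unit_or hC uV) => hu.
- exact: (sG y x yV xV yx hy hx).
- exact: (sG y x yV xV yx hy hx).
- exact: (sG u x uV xV ux hu hx).
- exact: (sH u y uV yV uy hu hy).
- exact: (sG u y uV yV uy hu hy).
- exact: (sH u x uV xV ux hu hx).
- exact: (sH y x yV xV yx hy hx).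
- exact: (sH y x yV xV yx hy hx).
Qed.

End ConstantHead.
End Context.
End BadShapes.

(** * Complete homogeneous facets *)

Section CompleteHomogeneous.
Variables (K : closedFieldType) (N : nat).
Hypothesis K0 : forall m, (m.+1)%:R != 0 :> K.
Local Notation R := {mpoly K[N]}.
Local Notation S := (@Sdiff K N).
Local Notation mono := (@varprod K N).
Local Notation z i := (subst i 0).
Implicit Types (V W : {set 'I_N}) (p i j l t u : 'I_N) (w : K).
Implicit Types (f g h G H C : R).

Variables (q e : nat).
Hypotheses (q1 : (1 < q)%N) (e0 : (0 < e)%N).
Local Notation hs m := ((q * e)%N :: nseq m e).

Let q0 : (0 < q)%N. Proof. exact: ltnW. Qed.
Let qe0 : (0 < q * e)%N. Proof. by rewrite muln_gt0 q0. Qed.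

Lemma hs_pos m : all (ltn 0) (hs m).
Proof. by apply/andP; split; [exact: qe0|apply: all_nseqP]. Qed.

Lemma hsS m : hs m.+1 = rcons (hs m) e.
Proof. by rewrite nseqSr. Qed.

Lemma h_z W m p h : is_quot W (hs m.+1) e h -> #|W| = m.+3 -> p \in W ->
  is_quot (W :\ p) (hs m) e (z p h).
Proof.
rewrite hsS => hh cW pW; apply/is_quotE.
have cW' : #|W| = (size (hs m)).+2 by rewrite /= size_nseq.
have := z_quot K0 e0 hh cW' (hs_pos m) e0 (leqnn e) pW.
by rewrite subnn expr0 mul1r.
Qed.

Lemma h_lc W m j h : is_quot W (hs m) e h -> #|W| = m.+2 -> j \in W ->
  lc j h \is a GRing.unit.
Proof.
move=> hh cW jW; have cWj : #|W :\ j| = m.+1 by apply: cardsD1_S.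
apply: (quot_nseq_unit K0 e0 cWj).
by apply: (lc_quot e0 hh _ (hs_pos m) jW); rewrite size_nseq.
Qed.

Lemma h_dg W m j h : is_quot W (hs m) e h -> #|W| = m.+2 -> j \in W -> (0 < dg j h)%N.
Proof.
move=> hh cW jW; have cW' : #|W| = (size (hs m)).+1 by rewrite /= size_nseq.
have := dg_quot K0 e0 hh cW' (hs_pos m) jW; rewrite /= size_nseq sumn_nseq mulSn.
have : (2 * e <= q * e)%N by rewrite leq_mul2r q1 orbT.
by move: e0; rewrite [(m * e)%N]mulnC; clear; lia.
Qed.

Lemma S_two W i j (m : nat) : W = [set i; j] -> i != j -> (0 < m)%N ->
  assoc (S W [:: m]) ('X_i ^+ m - 'X_j ^+ m).
Proof.
move=> eW ij m0; have cW : #|W| = 2 by rewrite eW cards2 ij.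
have iW : i \in W by rewrite eW !inE eqxx.
apply: (assoc_trans (S_nseq K0 (m := 1) m0 cW)).
apply: (assoc_trans (T_split_at K0 m0 iW)).
have -> : W :\ i = [set j] by rewrite eW setU1K // inE.
rewrite big_set1; apply: assoc_unitl.
have h := S_nseq K0 (m := 0) m0 (cards1 j).
rewrite -(assoc_unit h) (assoc_unit (S_nil K (cards1 j))).
exact: unitr1.
Qed.

(** Setting variables to 0 reduces to two of them, where h is a unit times (x_i^(qe) -
    x_j^(qe))/(x_i^e - x_j^e), a geometric sum that contains x_i^e because q > 1. *)
Lemma h_coef W m i h : is_quot W (hs m) e h -> #|W| = m.+2 -> i \in W ->
  (upoly i h)`_e != 0.
Proof.
elim: m W h => [|m IHm] W h hh cW iW.
  have /eqP/cards2P [x [y [xy eW]]] := cW.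
  have [j ij eij] : exists2 j, i != j & W = [set i; j].
    move: iW; rewrite eW !inE => /orP [/eqP ->|/eqP ->]; first by exists y.
    by exists x; rewrite 1?eq_sym // setUC.
  have hST := proj1 (is_quotE _ _ _ _) hh.
  have hT := S_two eij ij e0; have hT2 := S_nseq K0 (m := 1) e0 cW.
  have [c cu ec] : assoc (('X_i ^+ e - 'X_j ^+ e) * h) ('X_i ^+ (q * e) - 'X_j ^+ (q * e)).
    apply: assoc_trans (S_two eij ij qe0); apply: assoc_sym.
    apply: (assoc_trans hST); apply: assoc_mulr.
    by apply: (assoc_trans (assoc_sym hT2)).
  have fu : freeof i c by apply/dg0_free/dg_unit.
  have fX (k : nat) : upoly i ('X_i ^+ k - 'X_j ^+ k) = 'X^k - ('X_j ^+ k)%:P :> {poly R}.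
    by rewrite rmorphB !rmorphXn /= upolyX upolyXn 1?eq_sym // polyC_exp.
  have := congr1 (upoly i) ec.
  rewrite [upoly i (_ * h)]rmorphM [upoly i (c * _)]rmorphM /= !fX fu => E.
  have E0 := congr1 (fun f : {poly R} => f`_0) E.
  have E1 := congr1 (fun f : {poly R} => f`_e) E.
  have eqe : (e < q * e)%N by rewrite -{1}[e]mul1n ltn_mul2r e0.
  rewrite mulrBl coefB coefXnM e0 coefCM coefCM coefB coefXn coefC eqxx in E0.
  rewrite (ltn_eqF qe0) !sub0r in E0.
  rewrite mulrBl coefB coefXnM ltnn subnn coefCM coefCM coefB coefXn coefC in E1.
  rewrite (ltn_eqF eqe) (gtn_eqF e0) subrr mulr0 in E1.
  apply/eqP => U0; move: E1; rewrite U0 mulr0 subr0 => U1.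
  move: E0; rewrite U1 mulr0 oppr0 => /esym/eqP.
  rewrite mulrN oppr_eq0; apply/negP; apply: mulf_neq0; last exact/expf_neq0/X_neq0.
  by apply: contraTneq cu => ->; rewrite unitr0.
have [|p pW] := @pick_out _ W [:: i]; first by rewrite cW.
rewrite inE => pi.
have iWp : i \in W :\ p by rewrite !inE eq_sym pi.
have := IHm _ _ (h_z hh cW pW) (cardsD1_S cW pW) iWp.
rewrite (upoly_subst h pi (free0 K i)) coef_map /=.
by apply: contraNneq => ->; rewrite rmorph0.
Qed.

Lemma meval_subst p (t : R) f (v : 'I_N -> K) : v p = t.@[v] -> (subst p t f).@[v] = f.@[v].
Proof.
by move=> e1; rewrite substE -horner_map /= -e1 -[map_poly _ _]/(line v p f) line_root.
Qed.

(* Setting variables to 0 reduces to W = {t, j}.  There a zero of the left side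
   gives a double root of the trinomial of [line_trinomial], and the right side
   would make it a triple root. *)
Lemma h_twist m W p t j w h k : #|W| = m.+2 -> p \notin W -> t \in W -> j \in W ->
  t != j -> w ^+ e = 1 -> is_quot (p |: W) (hs m.+1) e h ->
  ~ dvdr (subst p (w%:MP * 'X_t) h) (mono W ^+ k * S W (hs m)).
Proof.
elim: m W h k => [|m IHm] W h k cW pW tW jW tj we hh.
  have tp : t != p by apply: contraNneq pW => <-.
  have jp : j != p by apply: contraNneq pW => <-.
  have jt : j != t by rewrite eq_sym.
  have cpW : #|p |: W| = 3 by rewrite cardsU1 pW cW.
  have pP : p \in p |: W by rewrite !inE eqxx.
  have tP : t \in p |: W by rewrite !inE tW orbT.
  have jP : j \in p |: W by rewrite !inE jW orbT.
  have eW : W = [set t; j].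
    apply/eqP; rewrite eq_sym eqEcard cards2 tj cW /= andbT.
    by apply/subsetP => x; rewrite !inE => /orP [/eqP ->|/eqP ->].
  (* This makes x_p = w x_t with x_t = 1; the coordinate x_j is then chosen so that h vanishes. *)
  pose v0 (s : 'I_N) := if s == p then w else 1.
  have [y ry] : exists y, root (line v0 j h) y.
    apply: closed_rootP; rewrite (size_line v0 (h_lc hh cpW jP)).
    have := h_dg hh cpW jP; rewrite dgE; case: size => [|[]//].
    by [].
  pose v s := if s == j then y else v0 s.
  have hv : h.@[v] = 0.
    rewrite -(line_root v j) (@line_ext _ _ v v0 j) => [|s /negbTE sj]; last first.
      by rewrite /v sj.
    by rewrite {1}/v eqxx; apply/rootP.
  have vt : v t = 1 by rewrite /v (negbTE tj) /v0 (negbTE tp).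
  have vp : v p = w by rewrite /v eq_sym (negbTE jp) /v0 eqxx.
  have vj : v j = y by rewrite /v eqxx.
  have tz : v t != 0 by rewrite vt oner_neq0.
  have ez : v p ^+ e = v t ^+ e by rewrite vt vp we expr1n.
  have pt : p != t by rewrite eq_sym.
  have [yx ey] := collision_zero K0 cpW q1 e0 hh tP pP jP pt jt jp hv tz ez.
  rewrite vt vj !expr1n !mulr1 in yx ey.
  move=> [r er].
  have [u uu eS] := S_two eW tj qe0.
  have := congr1 (meval v) er.
  have sv : (subst p (w%:MP * 'X_t) h).@[v] = 0.
    by rewrite meval_subst // vp mevalM mevalC mevalXU vt mulr1.
  rewrite [in RHS]mevalM sv mulr0 mevalM eS mevalM mevalB !rmorphXn /= !mevalXU vt vj.
  rewrite expr1n => /eqP; rewrite mulf_eq0 expf_eq0 mulf_eq0 (negbTE (meval_unit v uu)) /=.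
  have y0 : y != 0.
    apply: contra_eq_neq ey => ->; rewrite (expr0n _ e) (gtn_eqF e0) expr0n /=.
    by rewrite mulr0 subr0 add0r nat_neq0.
  case/orP => [/andP[_]|].
    rewrite eW (_ : mono [set t; j] = 'X_t * 'X_j); last first.
      have tS : t \in [set t; j] by rewrite !inE eqxx.
      have jS : j \in [set j] by rewrite inE.
      rewrite -(mono_split1 K tS) setU1K ?inE //; congr (_ * _).
      by rewrite -(mono_split1 K jS) setDv mono_set0 mulr1.
    by rewrite mevalM !mevalXU vt vj mul1r (negbTE y0).
  (* With Y = y^e and Y^q = 1 the relation Y^(q+1) - (q + 1)Y + q = 0 reduces to q(1 - Y) = 0, but Y
     <> 1. *)
  rewrite subr_eq0 mulnC exprM => /eqP yq.
  move: ey; rewrite exprS -yq mulr1 -[q.+1%:R]natr1 => ey.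
  case/eqP: yx; apply: (mulfI (nat_neq0 K0 q0)); apply/eqP; rewrite mulr1 -subr_eq0.
  by rewrite -oppr_eq0 -[X in _ == X]ey; apply/eqP; ring.
have cpW : #|p |: W| = m.+4 by rewrite cardsU1 pW cW.
have [|u uW] := @pick_out _ W [:: t; j]; first by rewrite cW.
rewrite !inE negb_or => /andP[ut uj].
have up : u != p by apply: contraNneq pW => <-.
have tp : t != p by apply: contraNneq pW => <-.
have jp : j != p by apply: contraNneq pW => <-.
have uP : u \in p |: W by rewrite !inE uW orbT.
have jP : j \in p |: W by rewrite !inE jW orbT.
have eU : (p |: W) :\ u = p |: (W :\ u).
  by apply/setP => x; rewrite !inE; case: (eqVneq x p) => [->|]; rewrite ?(eq_sym p) ?up //.
have hz := h_z hh cpW uP; rewrite eU in hz.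
have sc : z u (subst p (w%:MP * 'X_t) h) = subst p (w%:MP * 'X_t) (z u h).
  apply: (subst_comm h up); apply: freeM; [exact: freeC|apply: freeX].
  by rewrite eq_sym.
have nX : ~ dvdr 'X_u (subst p (w%:MP * 'X_t) h).
  move/dvd_var; rewrite sc; have pt : p != t by rewrite eq_sym.
  move/(dvd_lin_form _ _ pt).
  by apply: (lin_ndvd_z uj pt jp _ (h_lc hh cpW jP)); rewrite eq_sym.
rewrite -(mono_split1 K uW) exprMn -mulrA => hd.
have {hd} : dvdr (subst p (w%:MP * 'X_t) h) (mono (W :\ u) ^+ k * S W (hs m.+1)).
  apply: (pprod_strip (P := fun f => f = 'X_u) (f := 'X_u ^+ k) _ _ hd).
    by apply: pprodX; apply: pprod_prime; first exact: prime_var.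
  by move=> f ->.
move/(subst_dvd u 0); rewrite sc substM subst_exp [z u (mono _)]subst_free; last first.
  by apply: free_mono; rewrite !inE eqxx.
have cW' : #|W| = (size (hs m)).+2 by rewrite /= size_nseq.
rewrite hsS => /(dvd_assocr (assoc_mull _ (z_S K cW' uW (hs_pos m) e0))).
rewrite mulrA -exprD.
apply: (IHm (W :\ u) _ (k + e)%N _ _ _ _ tj we hz).
- exact: cardsD1_S cW uW.
- by rewrite !inE (negbTE pW) andbF.
- by rewrite !inE eq_sym ut.
- by rewrite !inE eq_sym uj.
Qed.

End CompleteHomogeneous.

(** * Factorizations with opposite facets *)

Lemma coefM_ends (D : nzRingType) (p q : {poly D}) s :
  (forall k, (0 < k <= s)%N -> q`_k = 0) ->
  (p * q)`_s.+1 = p`_0 * q`_s.+1 + p`_s.+1 * q`_0.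
Proof.
move=> h; rewrite coefM big_ord_recl big_ord_recr /= subn0 subnn.
rewrite big1 ?add0r // => k _; rewrite h ?mulr0 //.
by rewrite subSS subn_gt0 ltn_ord leq_subr.
Qed.

Section Opposite.
Variables (K : closedFieldType) (N : nat).
Hypothesis K0 : forall m, (m.+1)%:R != 0 :> K.
Local Notation R := {mpoly K[N]}.
Local Notation T := (@linforms K N).
Local Notation Lq := (@lincompl K N).
Local Notation S := (@Sdiff K N).
Local Notation mono := (@varprod K N).
Local Notation z i := (subst i 0).
Implicit Types (V W : {set 'I_N}) (p i j l t u : 'I_N) (w : K).
Implicit Types (f g h G H C : R).

Lemma free_coef_other i j f k : i != j -> freeof i f -> freeof i (upoly j f)`_k.
Proof.
move=> ij ff; rewrite -(subst_free 0 ff) upoly_subst //; last exact: free0.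
by rewrite coef_map; apply: free_subst; apply: free0.
Qed.

Lemma coef_swap i j f (s k : nat) : i != j ->
  (upoly j (upoly i f)`_s)`_k = (upoly i (upoly j f)`_k)`_s.
Proof.
move=> ij; set c := fun x : nat => (upoly i f)`_x.
have e1 : (upoly j f)`_k =
    \sum_(l < size (upoly i f)) (upoly j (c l * 'X_i ^+ l))`_k.
  by rewrite -{1}(upolyK i f) horner_coef (raddf_sum (upoly j)) coef_sum.
apply: etrans (congr1 (fun g => (upoly i g)`_s) (esym e1)).
have e2 : (upoly i (\sum_(l < size (upoly i f)) (upoly j (c l * 'X_i ^+ l))`_k))`_s =
    \sum_(l < size (upoly i f)) (upoly i (upoly j (c l * 'X_i ^+ l))`_k)`_s.
  by rewrite (raddf_sum (upoly i)) coef_sum.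
apply: etrans (esym e2); change ((upoly j (c s))`_k =
    \sum_(l < size (upoly i f)) (upoly i (upoly j (c l * 'X_i ^+ l))`_k)`_s).
have term (l : nat) : (upoly i (upoly j (c l * 'X_i ^+ l))`_k)`_s =
    if l == s then (upoly j (c s))`_k else 0.
  rewrite (rmorphM (upoly j)) (rmorphXn (upoly j)) /= (upolyXn K ij) -polyC_exp coefMC.
  rewrite (rmorphM (upoly i)) (rmorphXn (upoly i)) /= upolyX.
  rewrite (free_coef_other k ij (coef_free i f l)) coefCM coefXn eq_sym.
  by case: eqP => [->|_]; rewrite ?mulr1 ?mulr0.
rewrite (eq_bigr _ (fun (l : 'I_(size (upoly i f))) _ => term l)).
have [sf|sf] := ltnP s (size (upoly i f)).
  rewrite (bigD1 (Ordinal sf)) //= eqxx big1 ?addr0 // => l ls.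
  by case: eqP => // e; case/eqP: ls; apply: val_inj.
rewrite big1 => [|l _].
  have -> : c s = 0 by apply: nth_default.
  by rewrite (rmorph0 (upoly j)) coef0.
by case: eqP => // e; move: (ltn_ord l); rewrite e ltnNge sf.
Qed.

(** The coefficient of the top power of x_j is a unit, hence a constant, and contributes nothing to
    x_i^s for s > 0. *)
Lemma dg_coef_lt i j f s : i != j -> (0 < s)%N -> (0 < dg j f)%N ->
  lc j f \is a GRing.unit -> (dg j (upoly i f)`_s < dg j f)%N.
Proof.
move=> ij s0 d0 uf; rewrite -(prednK d0) ltnS; apply: dg_le => k.
rewrite prednK // coef_swap // leq_eqVlt => /orP [/eqP <-|lt].
  have fu : freeof i (lc j f) by apply/dg0_free/dg_unit.
  by rewrite -lc_coef fu coefC (gtn_eqF s0).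
rewrite [X in upoly i X](_ : _ = 0) ?rmorph0 ?coef0 //.
by apply: nth_default; move: lt; rewrite dgE; case: size.
Qed.

Variables (q e b m d : nat) (V : {set 'I_N}).
Hypotheses (q1 : (1 < q)%N) (e0 : (0 < e)%N) (d0 : (0 < d)%N) (de : (d %| e)%N).
Hypotheses (b0 : (0 < b)%N) (db : (d %| b)%N) (cV : #|V| = m.+4).
Local Notation hs m := ((q * e)%N :: nseq m e).
Local Notation n := (rcons (hs m.+1) b).

Let ph k : all (ltn 0) (hs k). Proof. exact: hs_pos. Qed.
Let dh k : all (dvdn e) (hs k).
Proof. by apply/andP; split; [apply: dvdn_mull|apply: all_nseqP; apply: dvdnn]. Qed.
Let cVn : #|V| = (size (hs m.+1)).+2. Proof. by rewrite /= size_nseq. Qed.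
Let cVi i : i \in V -> #|V :\ i| = m.+3. Proof. exact: cardsD1_S. Qed.
Let c3 : (2 < #|V|)%N. Proof. by rewrite cV. Qed.
Let c4 : (3 < #|V|)%N. Proof. by rewrite cV. Qed.
Let leb : (d <= b)%N. Proof. exact: dvdn_leq. Qed.
Let cVn' : #|V| = (size n).+1. Proof. by rewrite size_rcons -cVn. Qed.

Let ex_h i : i \in V -> exists h, is_quot (V :\ i) (hs m.+1) e h.
Proof.
move=> iV; by apply: (ex_quot K0 e0); [rewrite cVi //= size_nseq|exact: (dh m.+1)].
Qed.

Let z_facet C i h : i \in V -> is_quot V n d C -> is_quot (V :\ i) (hs m.+1) e h ->
  assoc (z i C) (mono (V :\ i) ^+ (b - d) * (Lq (V :\ i) e d * h)).
Proof.
by move=> iV hC hh; apply: (z_quot2 K0 d0 hC cVn (ph _) b0 leb iV e0 de hh).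
Qed.

Let z_neq0 C i : i \in V -> is_quot V n d C -> z i C != 0.
Proof.
move=> iV hC; have [h hh] := ex_h iV.
rewrite (assoc_neq0 (z_facet iV hC hh)) !mulf_neq0 ?mono_neq0 ?Lq_neq0 //.
by apply: (quot_neq0 hh _ (ph _)); rewrite cVi //= size_nseq.
Qed.

Let complement G H i h : i \in V -> is_quot V n d (G * H) ->
  is_quot (V :\ i) (hs m.+1) e h ->
  forall r, mono (V :\ i) ^+ (b - d) * Lq (V :\ i) e d = r * z i G ->
  assoc (z i H) (r * h).
Proof.
move=> iV hC hh r er; have := z_facet iV hC hh.
rewrite mulrA er substM [r * _]mulrC -mulrA.
apply: assoc_cancel.
by have := z_neq0 iV hC; rewrite substM mulf_eq0 negb_or => /andP[].
Qed.

(** By the twist, sg H divides a monomial times an alternant without x_p. Since lc j H is a unit,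
    x_i does not divide sg H; powers of x_i can be stripped and x_i set to 0. But h divides z i H,
    and [h_twist] forbids sg h to divide the result. *)
Lemma opposite_twist G H i j : (d < e)%N -> gcdn e b = d -> is_quot V n d (G * H) ->
  i \in V -> j \in V -> i != j ->
  dvdr (z i G) (mono (V :\ i) ^+ (b - d) * Lq (V :\ i) e d) ->
  lc j H \is a GRing.unit -> False.
Proof.
move=> lt gd hC iV jV ij sG uj.
have [p [t [/andP[pV tV] [pi pj] [ti tj] pt]]] : exists p t,
    [/\ (p \in V) && (t \in V), p != i /\ p != j, t != i /\ t != j & p != t].
  have [p pV] := @pick_out _ V [:: i; j] c3; rewrite !inE negb_or => /andP[pi pj].
  have [t tV] := @pick_out _ V [:: i; j; p] c4; rewrite !inE !negb_or => /and3P[ti tj tp].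
  by exists p, t; rewrite pV tV; split; rewrite // eq_sym.
have [|w we wb] := exists_rts K0 (b := b) e0.
  apply/negP => /gcdn_idPl; rewrite gd => ed; by rewrite ed ltnn in lt.
have we1 : w ^+ e = 1 by apply/eqP; rewrite -mem_rts.
have w0 := rts_neq0 e0 we.
have [h hh] := ex_h iV; have [r er] := sG.
have hH : dvdr h (z i H).
  apply: (dvd_assocr (assoc_sym (complement iV hC hh er))).
  exact/dvd_mull/dvd_refl.
have [jp jt it] : [/\ j != p, j != t & i != t] by rewrite !(eq_sym j) (eq_sym i).
have ip : i != p by rewrite eq_sym.
set sg := subst p (w%:MP * 'X_t : R).
have ft : freeof i (w%:MP * 'X_t : R) by apply: freeM; [apply: freeC|apply: freeX].
have cVp := cVi pV; set W := V :\ p :\ i.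
have iVp : i \in V :\ p by rewrite !inE ip.
have cW : #|W| = m.+2 by apply: cardsD1_S cVp iVp.
have eS : assoc (sg (S V n)) (mono (V :\ p) ^+ b * S (V :\ p) (hs m.+1)).
  rewrite /sg (twist_S _ cVn pV tV pt (dh m.+1) we1).
  apply: assoc_trans (z_S K cVn pV (ph _) b0); apply: assoc_unitl.
  have nz : 1 - w ^+ b != 0 by rewrite subr_eq0 eq_sym.
  by apply/unitrPr; exists (1 - w ^+ b)^-1%:MP; rewrite -mpolyCM divff.
have dH : dvdr (sg H) (mono (V :\ p) ^+ b * S (V :\ p) (hs m.+1)).
  apply: (dvd_assocr eS).
  apply: (dvd_assocr (assoc_sym (subst_assoc p (w%:MP * 'X_t) (proj1 (is_quotE _ _ _ _) hC)))).
  by rewrite substM substM; apply/dvd_mull/dvd_mull/dvd_refl.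
have sgz f : z i (sg f) = sg (z i f) := subst_comm f ip ft.
have nX : ~ dvdr 'X_i (sg H).
  move/dvd_var; rewrite sgz => /(dvd_lin_form _ _ pt).
  exact: (lin_ndvd_z ij pt jp jt uj).
move: dH; rewrite -(mono_split1 K iVp) exprMn -mulrA => dH.
have {}dH : dvdr (sg H) (mono W ^+ b * S (V :\ p) (hs m.+1)).
  apply: (pprod_strip (P := fun f => f = 'X_i) (f := 'X_i ^+ b) _ _ dH).
    by apply: pprodX; apply: pprod_prime; first exact: prime_var.
  by move=> f ->.
have cVp' : #|V :\ p| = (size (hs m)).+2 by rewrite cVp /= size_nseq.
have := subst_dvd i 0 dH; rewrite sgz substM subst_exp [z i (mono _)]subst_free; last first.
  by apply: free_mono; rewrite !inE eqxx.
rewrite hsS => /(dvd_assocr (assoc_mull _ (z_S K cVp' iVp (ph _) e0))).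
rewrite mulrA -exprD => /(dvd_trans (subst_dvd p (w%:MP * 'X_t) hH)).
have eU : V :\ i = p |: W.
  apply/setP => x; rewrite !inE; case: (eqVneq x p) => [->|_]; last by [].
  by rewrite pi pV.
rewrite eU in hh.
apply: (h_twist K0 q1 e0 (k := (b + e)%N) cW _ _ _ tj we1 hh).
- by rewrite !inE eqxx andbF.
- by rewrite !inE ti tV eq_sym pt.
- by rewrite !inE jV jp eq_sym ij.
Qed.

(** * The case e = d < b *)

Section EqualGcd.
Hypotheses (ed : e = d) (lt : (d < b)%N).
Variables (G H : R) (i j : 'I_N).
Hypotheses (hC : is_quot V n d (G * H)) (iV : i \in V) (jV : j \in V) (ij : i != j).
Hypothesis sG : dvdr (z i G) (mono (V :\ i) ^+ (b - d) * Lq (V :\ i) e d).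
Hypothesis uj : lc j H \is a GRing.unit.
Hypothesis lcor : forall l, l \in V -> lc l G \is a GRing.unit \/ lc l H \is a GRing.unit.
Hypothesis zor : forall l, l \in V ->
  dvdr (z l G) (mono (V :\ l) ^+ (b - d) * Lq (V :\ l) e d) \/
  dvdr (z l H) (mono (V :\ l) ^+ (b - d) * Lq (V :\ l) e d).

Let ji : j != i. Proof. by rewrite eq_sym. Qed.

Let Lq1 W : Lq W e d = 1.
Proof. by rewrite ed Lq_diag // -ed. Qed.

(** If lc l G were a unit, a variable other than x_i, x_j, x_l would divide the facet z i C, as b >
    d, but neither z i G nor z i H. *)
Let lcH l : l \in V -> l != i -> lc l H \is a GRing.unit.
Proof.
move=> lV li; case: (lcor lV) => ul; last exact: ul.
have il : i != l by rewrite eq_sym.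
have [p pV] := @pick_out _ V [:: i; j; l] c4; rewrite !inE !negb_or => /and3P[pi pj pl].
have [h hh] := ex_h iV; have := z_facet iV hC hh; rewrite substM => zC.
have [_ _ pp] := prime_var K p.
case: (pp (z i G) (z i H)).
- apply: (dvd_assocr (assoc_sym zC)); apply: dvd_mulr.
  have pVi : p \in V :\ i by rewrite !inE pi.
  rewrite -(mono_split1 K pVi) exprMn -(prednK (_ : 0 < b - d)%N) ?subn_gt0 //.
  rewrite exprS -mulrA; exact/dvd_mulr/dvd_refl.
- move=> h1; exact: (False_ind _ (X_ndvd_z il pl ul h1)).
- move=> h1; exact: (False_ind _ (X_ndvd_z ij pj uj h1)).
Qed.

Let X_ndvd k p : k \in V -> ~ dvdr 'X_p (z k H).
Proof.
move=> kV; have [l lV] := @pick_out _ V [:: i; k; p] c4.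
rewrite !inE !negb_or => /and3P[li lk lp].
by apply: (X_ndvd_z _ _ (lcH lV li)); rewrite eq_sym.
Qed.

Let strip k (m' : nat) f g : k \in V -> dvdr f (z k H) -> dvdr f (mono (V :\ k) ^+ m' * g) ->
  dvdr f g.
Proof.
move=> kV fH; apply: (pprod_strip (pprod_mono K (V :\ k) m')).
by move=> _ [p _ ->] /dvd_trans /(_ fH); apply: X_ndvd.
Qed.

Let dgH0 : (0 < dg j H)%N.
Proof.
have [h hh] := ex_h iV; have [r er] := sG.
have hH : dvdr h (z i H).
  by apply: (dvd_assocr (assoc_sym (complement iV hC hh er))); apply/dvd_mull/dvd_refl.
have jVi : j \in V :\ i by rewrite !inE ji.
have := h_dg K0 q1 e0 hh (cVi iV) jVi; move/leq_trans; apply.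
have [_ <-] := lc_z_unit ij uj; apply: dg_dvd => //.
by have := z_neq0 iV hC; rewrite substM mulf_eq0 negb_or => /andP[].
Qed.

(** No variable divides z p H. So if z p G is small, z p H is h and nothing more; if z p H were
    small, it would be a unit, against its positive degree in x_j. *)
Let z_is_h p h : p \in V -> p != j -> is_quot (V :\ p) (hs m.+1) e h -> assoc (z p H) h.
Proof.
move=> pV pj hh; case: (zor pV); rewrite Lq1 mulr1 => hz.
  have [r er] := hz; have := @complement G H p h pV hC hh r.
  rewrite Lq1 mulr1 => /(_ er) zr.
  have ru : r \is a GRing.unit.
    apply: (dvd_unit (q := 1)); last exact: unitr1.
    apply: (@strip p (b - d) r 1 pV).
      by apply: (dvd_assocr (assoc_sym zr)); apply/dvd_mulr/dvd_refl.
    by rewrite mulr1 er; apply/dvd_mulr/dvd_refl.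
  exact: assoc_trans zr (assoc_unitl _ ru).
have zu : z p H \is a GRing.unit.
  apply: (dvd_unit (q := 1)); last exact: unitr1.
  by apply: (@strip p (b - d) _ 1 pV (dvd_refl _)); rewrite mulr1.
by have := dgH0; have [_ <-] := lc_z_unit pj uj; rewrite dg_unit.
Qed.

(** With the denominator joined to G, the product with H is associated to S, in which x_i^s with 0 <
    s < b does not occur. *)
Let Kp := T V d * G.

Let z_K : exists2 f, pprods (fun g => is_var (V :\ i) g \/ is_lin (V :\ i) d predT g) f &
  dvdr (z i Kp) f.
Proof.
exists (mono (V :\ i) ^+ d * T (V :\ i) d * (mono (V :\ i) ^+ (b - d))).
  have pv k : pprods (fun g => is_var (V :\ i) g \/ is_lin (V :\ i) d predT g)
      (mono (V :\ i) ^+ k).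
    by apply: pprod_sub (pprod_mono K (V :\ i) k) => f h; left.
  apply: pprodM; last exact: pv.
  by apply: pprodM; [exact: pv|apply: pprod_sub (pprod_L _ _ _) => f h; right].
rewrite /Kp substM; apply: dvd_mul.
  by apply: assoc_dvd; apply: z_T; rewrite ?cV.
by have := sG; rewrite Lq1 mulr1.
Qed.

Let coef_KH s : (0 < s < b)%N -> (upoly i Kp * upoly i H)`_s = 0.
Proof.
move=> /andP[s0 sb]; have [u uu eS] := proj1 (is_quotE _ _ _ _) hC.
have fu : freeof i u by apply/dg0_free/dg_unit.
have eS' : (upoly i (S V n))`_s = u * (upoly i Kp * upoly i H)`_s.
  by rewrite eS mulrA -/Kp -coefCM -fu !(rmorphM (upoly i)).
have u0 : u != 0 by apply: contraTneq uu => ->; rewrite unitr0.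
apply/eqP/negPn/negP => nz.
have : (upoly i (S V n))`_s != 0 by rewrite eS' mulf_neq0.
case/(coef_S_supp cVn' iV) => k kn es.
move: s0 sb; rewrite es; have [kb|kb] := leqP k (size (hs m.+1)).
  by rewrite expo_rcons // => _; rewrite ltnNge leq_addr.
by rewrite expo_size // size_rcons.
Qed.

(** By induction only two terms survive in the coefficient of x_i^s in the product, so z i H divides
    z i Kp times the coefficient of H. It has no prime in common with z i Kp, so it divides that
    coefficient, whose degree in x_j is too small unless it is 0. *)
Let coef_H s : (0 < s < b)%N -> (upoly i H)`_s = 0.
Proof.
have [l] := ubnP s; elim: l s => // l IHl [//|s]; rewrite ltnS => sl sb.
have E := coef_KH sb; rewrite coefM_ends in E; last first.
  move=> k /andP[k0 ks]; apply: IHl; first exact: leq_ltn_trans ks sl.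
  by rewrite k0 (leq_ltn_trans ks) //; case/andP: sb => _ /ltnW.
have {}E := etrans (congr2 (fun x y => x * (upoly i H)`_s.+1 + (upoly i Kp)`_s.+1 * y)
  (subst0_coef i Kp) (subst0_coef i H)) E.
have [f pf [r er]] := z_K.
apply/eqP/negPn/negP => Hs.
have d1 : dvdr (z i H) (upoly i H)`_s.+1.
  apply: (pprod_strip pf).
    move=> _ [[p _ ->]|[p [t [w [Wpt _ _ ->]]]]]; first exact: X_ndvd.
    have [t' t'V] := @pick_out _ V [:: i; p; t] c4.
    rewrite !inE !negb_or => /and3P[t'i t'p t't].
    have it' : i != t' by rewrite eq_sym.
    exact: (lin_ndvd_z it' (pairs_neq Wpt) t'p t't (lcH t'V t'i)).
  exists (- (r * (upoly i Kp)`_s.+1)).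
  rewrite er -mulrA; move/eqP: E; rewrite addr_eq0 => /eqP ->.
  by rewrite mulrN mulNr mulrA.
have := dg_dvd j d1 Hs; have [_ ->] := lc_z_unit ij uj.
by rewrite leqNgt (dg_coef_lt ij _ dgH0 uj).
Qed.

(* [coef_H] is the Eisenstein step: x_i^s does not occur in H for 0 < s < b,
   although x_i^d occurs in the facets of H. *)
Lemma opposite_eisenstein : False.
Proof.
have [p pV] := @pick_out _ V [:: i; j] c3; rewrite !inE negb_or => /andP[pi pj].
have [h hh] := ex_h pV.
have iVp : i \in V :\ p by rewrite !inE eq_sym pi.
have /eqP := h_coef K0 q1 e0 hh (cVi pV) iVp; apply.
have [u uu eh] := assoc_sym (z_is_h pV pj hh).
have fu : freeof i u by apply/dg0_free/dg_unit.
rewrite eh (rmorphM (upoly i)) /= fu coefCM (upoly_subst H pi (free0 K i)) coef_map /=.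
rewrite coef_H ?rmorph0 ?mulr0 // e0 /=.
by rewrite ed.
Qed.

End EqualGcd.

End Opposite.

(** * Induction on the number of variables *)

Section Main.
Variables (K : closedFieldType) (N : nat).
Hypothesis K0 : forall m, (m.+1)%:R != 0 :> K.
Local Notation R := {mpoly K[N]}.
Local Notation Lq := (@lincompl K N).
Local Notation mono := (@varprod K N).
Local Notation z i := (subst i 0).
Implicit Types (V W : {set 'I_N}) (p i j l t u : 'I_N) (w : K).
Implicit Types (f g h G H C : R).

Lemma bad_split V a b mid :
  let n := a :: rcons mid b in let d := gcds n in let e := gcds (a :: mid) in
  #|V| = (size mid).+3 -> (0 < size mid)%N -> all (ltn 0) n ->
  irr_card K N (size mid).+2 -> n <> nseq (size n) d ->
  gcds (rcons mid b) = d -> mid = nseq (size mid) e ->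
  forall G H, is_quot V n d (G * H) -> G \is a GRing.unit \/ H \is a GRing.unit.
Proof.
move=> n d e cV mid0 pn IH nn e'd em G H hC.
have d0 : (0 < d)%N := facet_d0 pn.
have e0 : (0 < e)%N := facet_e0 pn.
have de : (d %| e)%N := facet_de a b mid.
have db : (d %| b)%N := facet_db a b mid.
have [b0 pm] : (0 < b)%N /\ all (ltn 0) (a :: mid).
  move: pn; rewrite /n /= all_rcons => /and3P[h1 h2 h3].
  by split; [exact: h2|apply/andP; split].
have a0 : (0 < a)%N by case/andP: pm.
have leb := dvdn_leq b0 db; have lee := dvdn_leq e0 de.
have cV' : #|V| = (size (a :: mid)).+2 by rewrite cV.
have lq1 W : e = d -> Lq W e d = 1 by move=> ->; apply: Lq_diag.
have [q ea] : exists q, a = (q * e)%N.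
  by apply/dvdnP; have := gcds_dvd (a :: mid) => /andP[].
have q0 : (0 < q)%N by move: a0; rewrite ea; case: (q).
have cVi i : i \in V -> #|V :\ i| = (size mid).+2 by apply: cardsD1_S.
case: (ltngtP q 1) => [|q1|q1]; first by rewrite ltnS leqNgt q0.
  have [m sm] : exists m, size mid = m.+1 by exists (size mid).-1; rewrite prednK.
  have en : n = rcons ((q * e)%N :: nseq m.+1 e) b by rewrite -sm -em -ea.
  have cVm : #|V| = m.+4 by rewrite cV sm.
  have smE i f : i \in V -> small_z V a b mid i f ->
    dvdr (z i f) (mono (V :\ i) ^+ (b - d) * Lq (V :\ i) e d) by [].
  have [ed|ne] := eqVneq e d; last first.
    have lt : (d < e)%N by rewrite ltn_neqAle eq_sym ne.
    have gd : gcdn e b = d by rewrite -gcds_rcons.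
    apply: (facet_split K0 cV mid0 pn IH _ hC) => A B i j hAB iV jV ij sA sB.
    rewrite -/n -/d en in hAB.
    apply: (opposite_twist K0 q1 e0 d0 de b0 db cVm lt gd hAB iV jV ij sA).
    exact: (sml_unit K0 pn e'd sB).
  move: leb; rewrite leq_eqVlt => /orP [/eqP bd|lt].
    (* Now n = (qd, d, ..., d): all leading facets have constant differences, so both factors have
       unit leading coefficients, and a small z i A divides 1. *)
    have [i iV] : exists i, i \in V by apply/card_gt0P; rewrite cV.
    have lu (A B : R) j : is_quot V n d (A * B) -> j \in V -> lc j A \is a GRing.unit.
      move=> hAB jV; have h := lc_quot (m := a) (n := rcons mid b) d0 hAB _ pn jV.
      rewrite size_rcons in h; have {h} h := h cV.
      rewrite em ed -bd -nseqSr in h.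
      have := quot_nseq_unit K0 d0 (cVi j jV) h.
      by rewrite lcM => /dvd_unit; apply; apply/dvd_mulr/dvd_refl.
    have fin (A B : R) : is_quot V n d (A * B) -> small_z V a b mid i A -> A \is a GRing.unit.
      move=> hAB sA; have c3 : (2 < #|V|)%N by rewrite cV.
      apply: (unit_of_facets c3 iV (k := 0)).
        by move=> j; apply: lu hAB.
      have := smE i A iV sA; rewrite -bd subnn (lq1 _ ed) mulr1; exact: id.
    case: (smz_or K0 cV pn IH hC iV) => h; [left|right].
      exact: (fin _ _ hC h).
    by apply: (fin H G _ h); rewrite mulrC.
  apply: (facet_split K0 cV mid0 pn IH _ hC) => A B i j hAB iV jV ij sA sB.
  have lor := fun l lV => lc_unit_or K0 cV pn IH e'd hAB (j := l) lV.
  have zor := fun l lV => smz_or K0 cV pn IH hAB (i := l) lV.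
  have uB := sml_unit K0 pn e'd sB.
  rewrite -/n -/d en in hAB.
  exact: (opposite_eisenstein K0 q1 e0 d0 de b0 db cVm ed lt hAB iV jV ij sA uB lor zor).
(* For q = 1 the facet x_i = 0 has constant differences and consists of variables and forms only. *)
have nme : a :: mid = nseq (size mid).+1 e by rewrite ea q1 mul1n {1}em.
apply: (constant_head_split K0 cV mid0 pn IH e'd _ _ hC).
  move=> i C iV hC'; rewrite -[Lq _ _ _]mulr1.
  apply: (z_quot2 K0 d0 (n := a :: mid) hC' cV' pm b0 leb iV e0 de).
  by rewrite {1}nme; apply: (is_quot_nseq K0 e0); apply: cVi.
case: (ltngtP d b) leb => // [lt _|bd _]; [by left|right].
rewrite ltn_neqAle lee andbT; apply/negP => /eqP ed; apply: nn.
have nb : n = rcons (nseq (size mid).+1 e) b by rewrite -nme.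
have sn : size n = (size mid).+2 by rewrite /n /= size_rcons.
rewrite sn [LHS]nb (nseqSr (size mid).+1 d); congr (rcons _ _); last exact: esym bd.
by congr nseq; exact: esym ed.
Qed.

(** Reversal exchanges the two shapes left by [opposite_shape], so only the one with e' = d is
    treated directly. *)
Theorem irr_card_all m : irr_card K N m.+3.
Proof.
elim: m => [|m IH]; first exact: irr_card3.
have bad V a b mid : #|V| = (size mid).+3 -> size mid = m.+1 ->
    all (ltn 0) (a :: rcons mid b) ->
    (a :: rcons mid b) <> nseq (size (a :: rcons mid b)) (gcds (a :: rcons mid b)) ->
    gcds (rcons mid b) = gcds (a :: rcons mid b) ->
    mid = nseq (size mid) (gcds (a :: mid)) ->
    forall C, is_quot V (a :: rcons mid b) (gcds (a :: rcons mid b)) C -> irreducible_elt C.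
  move=> cV sm pn nn e'd em C hC.
  have mid0 : (0 < size mid)%N by rewrite sm.
  have IHm : irr_card K N (size mid).+2 by rewrite sm.
  apply: irr_intro => [|G H eC].
    apply: (quot_nonunit K0 (facet_d0 pn) _ _ pn (gcds_dvd _) nn hC) => //.
    by rewrite cV /= size_rcons.
  rewrite eC in hC.
  exact: (bad_split cV mid0 pn IHm nn e'd em hC).
move=> V n cV; rewrite cV => -[] sn; case: n sn => [//|a n] [].
case/lastP: n => [//|mid b]; rewrite size_rcons => -[] /esym sm pn nn.
have cV' : #|V| = (size mid).+3 by rewrite cV sm.
have mid0 : (0 < size mid)%N by rewrite sm.
have IHm : irr_card K N (size mid).+2 by rewrite sm.
have [/andP[/eqP e'd /eqP em]|nbad1] := boolP
  ((gcds (rcons mid b) == gcds (a :: rcons mid b)) &&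
   (mid == nseq (size mid) (gcds (a :: mid)))).
  exact: bad cV' sm pn nn e'd em.
have sz : #|V| = (size (a :: rcons mid b)).+1 by rewrite cV' /= size_rcons.
have [/andP[/eqP ed /eqP em']|nbad2] := boolP
  ((gcds (a :: mid) == gcds (a :: rcons mid b)) &&
   (mid == nseq (size mid) (gcds (rcons mid b)))).
  apply: (irr_rev K0 _ sz pn nn erefl) => // C.
  have er : rev (a :: rcons mid b) = b :: rcons (rev mid) a.
    by rewrite rev_cons rev_rcons.
  have eg := gcds_rev (a :: rcons mid b).
  rewrite -eg er; apply: bad.
  - by rewrite size_rev.
  - by rewrite size_rev.
  - by rewrite -er all_rev.
  - rewrite -er eg size_rev => /(congr1 rev); rewrite revK rev_nseq.
    exact: nn.
  - by rewrite -er eg -rev_cons gcds_rev.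
  - by rewrite -rev_rcons gcds_rev size_rev -rev_nseq -em'.
move=> C hC; apply: irr_intro => [|G H eC].
  by apply: (quot_nonunit K0 (facet_d0 pn) _ sz pn (gcds_dvd _) nn hC).
rewrite eC in hC; apply: (facet_split K0 cV' mid0 pn IHm _ hC) => A B i j hAB iV jV ij sA sB.
case: (opposite_shape K0 cV' mid0 pn hAB iV jV ij sA sB) => -[h1 h2].
  by rewrite h1 -h2 !eqxx in nbad1.
by rewrite h1 -h2 !eqxx in nbad2.
Qed.

End Main.

(** * The exponents of the theorem *)

Lemma CC_char0 m : (m.+1)%:R != 0 :> CC.
Proof. by change ((m.+1)%:R != 0 :> complex Rdefinitions.R); rewrite Num.Theory.pnatr_eq0. Qed.

Lemma telescope_iota (l : nat -> nat) j k :
  (forall i, (j <= i < j + k)%N -> (l i.+1 <= l i)%N) ->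
  (sumn [seq l i - l i.+1 | i <- iota j k] + l (j + k) = l j)%N.
Proof.
elim: k j => [|k IH] j h /=; first by rewrite addn0.
rewrite -addnA addnS -addSn IH => [|i /andP[ji ik]].
  by rewrite subnK // h // leqnn addnS ltnS leq_addr.
by apply: h; rewrite (ltnW ji) addnS -addSn.
Qed.

Section Bridge.
Variables (r : nat) (lam : 'I_r -> nat).
Hypotheses (r2 : (2 <= r)%N)
  (dec : forall i j : 'I_r, (i < j)%N -> (lam j < lam i)%N)
  (last0 : forall j : 'I_r, val j = r.-1 -> lam j = 0%N).

Definition lamn k : nat := if insub k is Some j then lam j else 0%N.
Definition diffs : seq nat := [seq (lamn k - lamn k.+1)%N | k <- iota 0 r.-1].

Lemma lamnE (j : 'I_r) : lamn j = lam j.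
Proof. by rewrite /lamn valK. Qed.

Lemma lamn_lt k : (k < r.-1)%N -> (lamn k.+1 < lamn k)%N.
Proof.
move=> kr; have k1 : (k.+1 < r)%N by rewrite -ltn_predRL.
have k0 := ltnW k1; rewrite -[k.+1]/(val (Ordinal k1)) -[k in ltnRHS]/(val (Ordinal k0)).
by rewrite !lamnE; apply: dec.
Qed.

Lemma expo_diffs j : (j < r)%N -> expo diffs j = lamn j.
Proof.
move=> jr; have jr' : (j <= r.-1)%N by rewrite -ltnS prednK // (ltnW r2).
rewrite /expo /diffs -map_drop drop_iota add0n.
have := @telescope_iota lamn j (r.-1 - j)%N; rewrite subnKC //.
have rr : (r.-1 < r)%N by rewrite prednK // (ltnW r2).
have -> : lamn r.-1 = 0%N by rewrite -[r.-1]/(val (Ordinal rr)) lamnE last0.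
by rewrite addn0; apply=> i /andP[_ ir]; apply/ltnW/lamn_lt.
Qed.

Lemma expo_diffs_ord (j : 'I_r) : expo diffs j = lam j.
Proof. by rewrite expo_diffs // lamnE. Qed.

Lemma size_diffs : size diffs = r.-1.
Proof. by rewrite size_map size_iota. Qed.

Lemma diffs_pos : all (ltn 0) diffs.
Proof.
by apply/allP => _ /mapP [k + ->]; rewrite mem_iota /= add0n subn_gt0 => /lamn_lt.
Qed.

(** As the last exponent is 0, exponents are sums of differences, so both families have the same
    common divisors. *)
Lemma gcds_diffs : gcds diffs = dlam lam.
Proof.
apply/eqP; rewrite eqn_dvd /dlam; apply/andP; split.
  apply/dvdn_biggcdP => j _; rewrite -expo_diffs_ord; apply: expo_dvd.
  exact: gcds_dvd.
rewrite dvdn_gcds; apply/allP => _ /mapP [k + ->]; rewrite mem_iota /= add0n => kr.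
have h (i : nat) : (\big[gcdn/0]_(i < r) lam i %| lamn i)%N.
  rewrite /lamn; case: insubP => [j _ _|_]; last exact: dvdn0.
  exact: biggcdn_inf.
by apply: dvdn_sub.
Qed.

Lemma expo_nseq m d j : expo (nseq m d) j = (d * (m - j))%N.
Proof. by rewrite /expo drop_nseq sumn_nseq. Qed.

Lemma drhoE d (j : 'I_r) : drho d j = expo (nseq r.-1 d) j.
Proof. by rewrite expo_nseq. Qed.

Lemma Sdet_S (mu : 'I_r -> nat) n : (forall j : 'I_r, mu j = expo n j) ->
  assoc (Sdiff CC [set: 'I_r] n) (Sdet mu).
Proof.
move=> e; have -> : Sdet mu = @alternant CC r r id (expo n).
  by congr (\det _); apply/matrixP => i j; rewrite !mxE e.
apply: S_alt => //; apply/setP => x; rewrite inE.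
by apply/imsetP; exists x.
Qed.

End Bridge.

Theorem theorem1p2 (r : nat) (lam : 'I_r -> nat) :
  (2 <= r)%N ->
  (forall i j : 'I_r, (i < j)%N -> (lam j < lam i)%N) ->
  (forall j : 'I_r, val j = r.-1 -> lam j = 0%N) ->
  lam <> drho (dlam lam) ->
  exists C : {mpoly CC[r]},
    Sdet lam = Sdet (drho (dlam lam)) * C /\ irreducible_elt C.
Proof.
move=> r2 dec last0 nl.
have r1 : r = r.-1.+1 by rewrite prednK // (ltnW r2).
have cV : #|[set: 'I_r]| = (size (diffs lam)).+1 by rewrite cardsT card_ord size_diffs.
have pn := diffs_pos dec; have eg := gcds_diffs r2 dec last0.
have nn : diffs lam <> nseq (size (diffs lam)) (gcds (diffs lam)).
  move=> e; apply: nl; apply: functional_extensionality => j.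
  by rewrite drhoE -(expo_diffs_ord r2 dec last0) {1}e eg size_diffs.
have d0 : (0 < gcds (diffs lam))%N.
  by case: (diffs lam) nn pn => // x s _; apply: gcds_gt0.
have hS := Sdet_S (fun j => esym (expo_diffs_ord r2 dec last0 j)).
have hT := Sdet_S (mu := drho (dlam lam)) (fun j : 'I_r => drhoE _ j).
have cT : #|[set: 'I_r]| = (r.-1).+1 by rewrite cardsT card_ord.
rewrite -eg in hT *.
have hT' := assoc_trans (assoc_sym (S_nseq CC_char0 d0 cT)) hT.
have [C0 hC0] := ex_quot CC_char0 d0 cV (gcds_dvd _).
have [u uu eu] : assoc (Sdet lam) (Sdet (drho (gcds (diffs lam))) * C0).
  apply: (assoc_trans (assoc_sym hS)); apply: (assoc_trans (proj1 (is_quotE _ _ _ _) hC0)).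
  exact: assoc_mulr.
(* The unit moves into the quotient, because an equality is claimed. *)
exists (u * C0); split; first by rewrite eu mulrCA.
have hC : is_quot [set: 'I_r] (diffs lam) (gcds (diffs lam)) (u * C0).
  apply/is_quotE; apply: (assoc_trans (proj1 (is_quotE _ _ _ _) hC0)).
  by apply/assoc_mull/assoc_sym/assoc_unitl.
(* For r = 2 the only difference is its own gcd, so lambda would be d(lambda) rho. *)
have r3 : (3 <= r)%N.
  rewrite ltn_neqAle r2 andbT; apply/negP => /eqP er.
  have : size (diffs lam) = 1%N by rewrite size_diffs -er.
  by case: (diffs lam) nn => [|x [|//]] //= h _; apply: h; rewrite gcdn0.
apply: (irr_card_all CC_char0 (m := (r - 3)%N) _ cV pn nn hC).
by rewrite cardsT card_ord -addn3 subnK.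
Qed.
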